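(* Let $n\ge 2$ be an integer and $0<r<\infty$. Let $s^{\max}_c(\alpha, \ell^{r,\infty})$ be the critical Sobolev exponent of the fractal sequential Schrödinger maximal estimate on $\mathbb R^n$. (1) If $n-1 \leq \alpha \leq n$, then $$s^{\max}_c(\alpha, \ell^{r, \infty}) \geq \frac{n-\alpha}2 + \min \Big( \frac{2\alpha - n}{2(n+1)}, \frac{r(2\alpha-n)}{r(n+1)+2\alpha-n} \Big).$$ (2) If $n/2 < \alpha \leq n - 1$, then $$s^{\max}_c(\alpha, \ell^{r, \infty}) \geq \frac{n-\alpha}2 + \min \Big( \frac{2\alpha - n}{2(n+1)}, \frac{r\alpha}{r(n+1) + n} \Big).$$
   Context: The Schrödinger operator on $\mathbb R^n$ is $$e^{it\Delta}f(x) = \int_{\mathbb{R}^n} \widehat f(\xi) \, e^{ 2\pi i (x \cdot \xi + t|\xi|^2) } \, d\xi .$$ $H^s=H^s(\mathbb R^n)$ is the usual $L^2$-based Sobolev space. For $0<r<\infty$, a real sequence $(t_k)_{k\in\mathbb N}$ belongs to $\ell^{r,\infty}=\ell^{r,\infty}(\mathbb N)$ if and only if $$\sup_{\delta>0} \delta^r\, \#\{ k \in \mathbb N: |t_k| \geq \delta \} < \infty.$$ $\mathcal M_\alpha$ is the set of $\alpha$-dimensional measures on $\mathbb R^n$: non-negative Borel measures $\mu$ for which there is a constant $C_\mu$ such that $\mu (B(x,\rho)) \le C_\mu \rho^\alpha$ for all $x \in \mathbb R^n$ and $\rho > 0$. The fractal sequential maximal estimate in $H^s$ is the statement $$\int_{B(0,1)}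 \sup_{k}|e^{it_k\Delta}f(x) |^2 \, d\mu(x) \lesssim C_\mu \|f\|_{H^s}^2, \qquad \forall (t_k) \in \ell^{r,\infty}, \ \forall f \in H^s, \ \forall \mu \in \mathcal M_\alpha,$$ where the implicit constant is independent of $f$ and $\mu$ (it may depend on $n,\alpha,r,s$ and on the sequence $(t_k)$). Since $\mu$ may be singular, the estimate is understood as an a priori estimate for Schwartz functions $f$. The critical exponent is $$s^{\max}_c(\alpha, \ell^{r, \infty}) = \inf \{ \, s\ge 0 : \text{the fractal sequential maximal estimate in } H^s \text{ holds} \, \}.$$ *)

(* Defs.v *)
From HB Require Import structures.
From mathcomp Require Import all_boot all_order all_algebra.
From mathcomp Require Import all_classical all_reals all_analysis.
From mathcomp Require Import measurable_realfun complex.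

Set Implicit Arguments.
Unset Strict Implicit.
Unset Printing Implicit Defensive.

Import Order.TTheory GRing.Theory Num.Theory.
Import numFieldNormedType.Exports.

Local Open Scope classical_set_scope.
Local Open Scope ring_scope.

(* R^n as row vectors, with the Borel sigma-algebra of its usual topology. *)
Notation Rn R n := (g_sigma_algebraType (@open 'rV[R]_n)).

Section borel_Rn.
Context {R : realType}.

Lemma measurable_coord n (i : 'I_n) :
  measurable_fun [set: Rn R n] (fun x : Rn R n => (x : 'rV[R]_n) ord0 i).
Proof.
apply: (measurability _ (RGenOpens.measurableE R)).
move=> _ [_ [a [b ->]] <-]; rewrite setTI.
apply: sub_sigma_algebra => /=.
apply: open_comp; last exact: interval_open.
by move=> x _; exact: coord_continuous.
Qed.

Lemma measurable_rV d (T : measurableType d) n (g : T -> Rn R n) :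
  (forall i, measurable_fun [set: T] (fun x => (g x : 'rV[R]_n) ord0 i)) ->
  measurable_fun [set: T] g.
Proof.
move=> mg; apply: (@measurability _ _ T (Rn R n) setT g (@open 'rV[R]_n) erefl).
move=> _ [U oU <-]; rewrite setTI.
pose c (q : 'rV[rat]_n) : 'rV[R]_n := map_mx ratr q.
pose W (p : 'rV[rat]_n * nat) : set T :=
  if `[< ball (c p.1) p.2.+1%:R^-1 `<=` U >]
  then \bigcap_(i in [set: 'I_n])
    ((fun x => (g x : 'rV[R]_n) ord0 i) @^-1` ball (c p.1 ord0 i) p.2.+1%:R^-1)
  else set0.
have -> : g @^-1` U = \bigcup_p W p.
  apply/seteqP; split => [x Ux|x [p _]]; last first.
    rewrite /W; case: asboolP => // cU H; apply: cU; split.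
      by rewrite invr_gt0.
    by move=> i j; rewrite (ord1 i); exact: H.
  have /nbhs_ballP[e /= e0 eU] : nbhs (g x : 'rV[R]_n) U.
    exact: open_nbhs_nbhs.
  have [k ke] : exists k : nat, k.+1%:R^-1 < e / 2.
    have e2 : 0 < e / 2 by rewrite divr_gt0.
    exists (Num.trunc (e / 2)^-1); rewrite invf_plt ?posrE//.
    exact: truncnS_gt.
  have r (i : 'I_n) :
    {q : rat | ball ((g x : 'rV[R]_n) ord0 i) k.+1%:R^-1 (ratr q)}.
    apply: cid.
    have [||y [Dy [q _ qy]]] := @dense_rat R
      (ball ((g x : 'rV[R]_n) ord0 i) k.+1%:R^-1).
    - by exists ((g x : 'rV[R]_n) ord0 i); exact: ballxx.
    - exact: ball_open.
    - by exists q; rewrite qy.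
  exists (\row_i projT1 (r i), k) => //; rewrite /W/=.
  case: asboolP => [_ i _ /=|abs].
    by rewrite !mxE; apply: ball_sym; exact: (projT2 (r i)).
  exfalso; apply: abs => y [_ cy]; apply: eU; split => // i j.
  rewrite (ord1 i) (splitr e); apply: (@ball_triangle _ _ (c (\row_i projT1 (r i)) ord0 j)).
    by rewrite !mxE; apply: le_ball (ltW ke) _ _; exact: (projT2 (r j)).
  by apply: le_ball (ltW ke) _ _; exact: cy.
apply: countable_bigcupT_measurable; first exact: countableP.
move=> p; rewrite /W; case: asboolP => // _.
apply: fin_bigcap_measurable; first exact: finite_finset.
move=> i _; rewrite -[X in measurable X]setTI; apply: mg => //.
exact: measurable_ball.
Qed.

(* (x, (x_1, ..., x_n)) |-> (x, x_1, ..., x_n) *)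
Definition cons_rV n (p : measurableTypeR R * Rn R n) : Rn R n.+1 :=
  row_mx (const_mx p.1 : 'rV[R]_1) (p.2 : 'rV[R]_n).

Lemma cons_rV0 n (p : measurableTypeR R * Rn R n) :
  (cons_rV p : 'rV[R]_n.+1) ord0 ord0 = p.1.
Proof.
rewrite /cons_rV (_ : ord0 = lshift n (ord0 : 'I_1)); last exact: val_inj.
by rewrite [LHS]row_mxEl mxE.
Qed.

Lemma cons_rVS n (p : measurableTypeR R * Rn R n) (i : 'I_n) :
  (cons_rV p : 'rV[R]_n.+1) ord0 (lift ord0 i) = (p.2 : 'rV[R]_n) ord0 i.
Proof.
rewrite /cons_rV (_ : lift ord0 i = rshift 1 i); last exact: val_inj.
by rewrite [LHS]row_mxEr.
Qed.

Lemma measurable_cons_rV n : measurable_fun setT (@cons_rV n).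
Proof.
apply: measurable_rV => i; case: (unliftP ord0 i) => [j|] ->.
  rewrite (_ : (fun _ => _) = (fun x : Rn R n => (x : 'rV[R]_n) ord0 j) \o snd).
    by apply: measurableT_comp; [exact: measurable_coord|exact: measurable_snd].
  by apply/funext => p; rewrite cons_rVS.
rewrite (_ : (fun _ => _) = fst); first exact: measurable_fst.
by apply/funext => p; rewrite cons_rV0.
Qed.

Definition uncons_rV n (v : Rn R n.+1) : measurableTypeR R * Rn R n :=
  ((v : 'rV[R]_n.+1) ord0 ord0,
   \row_i (v : 'rV[R]_n.+1) ord0 (lift ord0 i)).

Lemma cons_rVK n : cancel (@cons_rV n) (@uncons_rV n).
Proof.
move=> [x v]; rewrite /uncons_rV cons_rV0; congr pair.
by apply/rowP => i; rewrite mxE cons_rVS.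
Qed.

Lemma measurable_uncons_rV n : measurable_fun setT (@uncons_rV n).
Proof.
apply/measurable_fun_pairP; split; first exact: measurable_coord.
apply: measurable_rV => i; rewrite /uncons_rV /=.
rewrite (_ : (fun _ => _) =
  (fun v : Rn R n.+1 => (v : 'rV[R]_n.+1) ord0 (lift ord0 i))).
  exact: measurable_coord.
by apply/funext => v; rewrite mxE.
Qed.

Section lebesgue_cons.
Variables (n : nat) (mu : {sigma_finite_measure set (Rn R n) -> \bar R}).
Local Open Scope ereal_scope.

Definition lebesgue_cons : set (Rn R n.+1) -> \bar R :=
  pushforward (@lebesgue_measure R \x mu) (@cons_rV n).

Let mcons A : measurable A -> measurable (@cons_rV n @^-1` A).
Proof.
by move=> mA; rewrite -[X in measurable X]setTI; exact: measurable_cons_rV.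
Qed.

Let lebesgue_cons0 : lebesgue_cons set0 = 0.
Proof. by rewrite /lebesgue_cons /pushforward preimage_set0 measure0. Qed.

Let lebesgue_cons_ge0 A : 0 <= lebesgue_cons A.
Proof. by rewrite /lebesgue_cons /pushforward; exact: measure_ge0. Qed.

Let lebesgue_cons_sigma_additive : semi_sigma_additive lebesgue_cons.
Proof.
move=> F mF tF mUF; rewrite /lebesgue_cons /pushforward preimage_bigcup.
apply: measure_semi_sigma_additive.
- by move=> k; exact: mcons.
- apply/trivIsetP => /= i j _ _ ij; rewrite -preimage_setI.
  by move/trivIsetP : tF => ->//; rewrite preimage_set0.
- by rewrite -preimage_bigcup; exact: mcons.
Qed.

HB.instance Definition _ := isMeasure.Build _ _ _ lebesgue_cons
  lebesgue_cons0 lebesgue_cons_ge0 lebesgue_cons_sigma_additive.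

Let lebesgue_cons_sigma_finite : sigma_finite setT lebesgue_cons.
Proof.
have /sigma_finiteP[F [TF ndF Foo]] := sigma_finiteT (@lebesgue_measure R).
have /sigma_finiteP[G [TG ndG Goo]] := sigma_finiteT mu.
exists (fun k => @uncons_rV n @^-1` (F k `*` G k)).
  rewrite -preimage_bigcup -[LHS](preimage_setT (@uncons_rV n)).
  congr (_ @^-1` _); apply/seteqP; split => [[x v] _|//].
  have [k _ Fx] : (\bigcup_i F i) x by rewrite -TF.
  have [l _ Gv] : (\bigcup_i G i) v by rewrite -TG.
  exists (maxn k l) => //; split => /=.
  - by move: x Fx; exact/subsetPset/ndF/leq_maxl.
  - by move: v Gv; exact/subsetPset/ndG/leq_maxr.
move=> k; have [mF Fk] := Foo k; have [mG Gk] := Goo k; split.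
  rewrite -[X in measurable X]setTI; apply: measurable_uncons_rV => //.
  exact: measurableX.
rewrite /lebesgue_cons /pushforward -comp_preimage.
rewrite (_ : _ \o _ = id); last by apply/funext => p /=; exact: cons_rVK.
by rewrite preimage_id product_measure1E// lte_mul_pinfty// ge0_fin_numE.
Qed.

HB.instance Definition _ := Measure_isSigmaFinite.Build _ _ _ lebesgue_cons
  lebesgue_cons_sigma_finite.

End lebesgue_cons.

(* Lebesgue measure on R^n. *)
Fixpoint lebesgue_Rn n : {sigma_finite_measure set (Rn R n) -> \bar R} :=
  match n with
  | 0 => \d_((0 : 'rV[R]_0) : Rn R 0)
  | m.+1 => lebesgue_cons (lebesgue_Rn m)
  end.

Lemma lebesgue_Rn_box n (A : 'I_n -> set (measurableTypeR R)) :
  (forall i, measurable (A i)) ->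
  lebesgue_Rn n [set x : 'rV[R]_n | forall i, A i (x ord0 i)] =
  (\prod_(i < n) lebesgue_measure (A i))%E.
Proof.
elim: n A => [|n IHn] A mA.
  rewrite big_ord0 /= diracE mem_set//=; by case.
rewrite big_ord_recl /= /lebesgue_cons /pushforward.
rewrite (_ : _ @^-1` _ = A ord0 `*`
  [set x : Rn R n | forall i, A (lift ord0 i) ((x : 'rV[R]_n) ord0 i)]).
  rewrite product_measure1E//; last first.
    rewrite (_ : mkset _ = \bigcap_(i in [set: 'I_n])
      ((fun x : Rn R n => (x : 'rV[R]_n) ord0 i) @^-1` A (lift ord0 i))).
      apply: fin_bigcap_measurable; first exact: finite_finset.
      move=> i _; rewrite -[X in measurable X]setTI.
      by apply: measurable_coord => //; exact: mA.
    by apply/seteqP; split => x /= H i; [move=> _|]; exact: H.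
  by congr (_ * _)%E; exact: (IHn (fun i => A (lift ord0 i))).
apply/seteqP; split => [p /= H|p [/= Hx Hv] i].
  split => [|i]; first by rewrite -cons_rV0; exact: H.
  by rewrite -cons_rVS; exact: H.
by case: (unliftP ord0 i) => [j|] ->; rewrite ?cons_rVS ?cons_rV0.
Qed.

End borel_Rn.

Section schroedinger.
Context {R : realType} {n : nat}.
Implicit Types (f : 'rV[R]_n -> R[i]) (x y xi : 'rV[R]_n).

Definition dot x y : R := \sum_i x ord0 i * y ord0 i.

(* Euclidean norm; the library norm `|x| on 'rV[R]_n is the sup norm. *)
Definition enorm x : R := Num.sqrt (dot x x).

Definition eball x (rho : R) : set (Rn R n) := [set y | enorm (y - x) < rho].

(* Iterated partial derivative, along the coordinates listed in l. *)
Definition partials (l : seq 'I_n) (g : 'rV[R]_n -> R) : 'rV[R]_n -> R :=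
  foldr (fun i h => 'D_(delta_mx ord0 i) h) g l.

(* C^oo is expressed as Frechet differentiability of every iterated partial. *)
Definition schwartz_real (g : 'rV[R]_n -> R) : Prop :=
  forall l : seq 'I_n,
    (forall x, differentiable (partials l g) x) /\
    (forall k : nat, exists C : R,
       forall x, enorm x ^+ k * `|partials l g x| <= C).

Definition schwartz f : Prop :=
  schwartz_real (fun x => complex.Re (f x)) /\
  schwartz_real (fun x => complex.Im (f x)).

(* e^(i theta) *)
Definition cis (theta : R) : R[i] := (cos theta +i* sin theta)%C.

Definition cintegral (f : Rn R n -> R[i]) : R[i] :=
  ((\int[lebesgue_Rn n]_x complex.Re (f x))%R +i*
   (\int[lebesgue_Rn n]_x complex.Im (f x))%R)%C.

Definition fourier f xi : R[i] :=
  cintegral (fun x => f x * cis (- (2 * pi * dot x xi))).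

(* e^(it Delta) f (x) *)
Definition schroedinger (t : R) f x : R[i] :=
  cintegral (fun xi =>
    fourier f xi * cis (2 * pi * (dot x xi + t * enorm xi ^+ 2))).

Definition sobolev_norm2 (s : R) f : \bar R :=
  (\int[lebesgue_Rn n]_xi
     ((1 + enorm xi ^+ 2) `^ s * Normc.normc (fourier f xi) ^+ 2)%:E)%E.

(* mu is alpha-dimensional iff dim_bound alpha mu Cmu for some Cmu. *)
Definition dim_bound (alpha : R) (mu : {measure set (Rn R n) -> \bar R})
    (Cmu : R) : Prop :=
  forall x (rho : R), 0 < rho ->
    (mu (eball x rho) <= (Cmu * rho `^ alpha)%:E)%E.

End schroedinger.

Definition weak_lr (R : realType) (r : R) (t : nat -> R) : Prop :=
  (ereal_sup [set (delta `^ r)%:E * counting [set k | (delta <= `|t k|)%R]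
             | delta in [set delta : R | (0 < delta)%R]] < +oo)%E.

(* The implicit constant K may depend on t, but not on f, mu or C_mu; the bound
   for every admissible C_mu is the bound for the least one. *)
Definition fractal_maximal_estimate (R : realType) (n : nat)
    (alpha r s : R) : Prop :=
  forall t : nat -> R, weak_lr r t ->
  exists K : R, forall f : 'rV[R]_n -> R[i], schwartz f ->
  forall (mu : {measure set (Rn R n) -> \bar R}) (Cmu : R),
    dim_bound alpha mu Cmu ->
    (\int[mu]_(x in eball 0 1)
        ereal_sup (range (fun k =>
          (Normc.normc (schroedinger (t k) f x) ^+ 2)%:E))
      <= K%:E * Cmu%:E * sobolev_norm2 s f)%E.

Definition critical_exponent (R : realType) (n : nat) (alpha r : R) : \bar R :=
  ereal_inf [set s%:E | s in
    [set s : R | 0 <= s /\ fractal_maximal_estimate n alpha r s]].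

(* Main.v *)
Require Import Defs.
From mathcomp Require Import all_boot all_order all_algebra.
From mathcomp Require Import all_classical all_reals all_analysis.
From HB Require Import structures.
From mathcomp Require Import measurable_realfun complex.
From mathcomp Require Import ring lra zify.
From mathcomp Require finmap.
Set Implicit Arguments.
Unset Strict Implicit.
Unset Printing Implicit Defensive.
Import Order.TTheory GRing.Theory Num.Theory.
Import numFieldNormedType.Exports.
Local Open Scope classical_set_scope.
Local Open Scope ring_scope.

(** Write n = m + 1. At every large scale T = 2^j the maximal estimate is tested on
    a datum that focuses at many points during the time interval [0, 1 / T], and
    on a measure concentrated near these points.

    The datum is a tensor product. Its first factor is a Gaussian packet with
    frequency N = T^nu and frequency width W = T^(1/2). Each of the m others is a
    sum of M ~ N / D waves with unit frequency width, whose frequencies form a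
    progression of step D ~ T^((1+p)/2). The evolution acts on each factor
    separately. At a time k / D^2, with k an integer, the M waves in a transverse
    coordinate are all in phase at the points of a translate of the lattice of
    mesh 1 / D ([freqs], [wave_evolution_lower]). Shifting the progression in the
    j-th transverse coordinate by a multiple of q^(- j) makes the translate move
    with k, and it returns after q^j steps. Thus, up to corrections smaller than
    1 / (D q), the base q digits of k choose independently in the m coordinates
    among q translates, and during q^m successive times the waves focus on a
    product grid of the finer mesh 1 / (D q) ([peak_coordE]). In the first coordinate the packet travels along,
    so that successive blocks of q^m times occupy distinct places; q is chosen so
    that these places are just separated at the length 1 / W of the packet.

    Around each of these peaks there is a box of sides ~ 1 / W, 1 / N, ..., 1 / N on
    which the solution has size at least c W M^m ([datum_large_at_peak]). The
    measure mu is N^(n - alpha) times Lebesgue measure on the boxes. The squared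
    H^s norm of the datum is at most a constant times N^(2s) W M^m
    ([sobolev_wave_packet]), so that the estimate implies
    W M^m mu(boxes) <= C N^(2s). The number of peaks makes the left side at least
    c N^(n - alpha) T^p, and in powers of T this gives
    s >= (n - alpha) / 2 + p / (2 nu) ([exponent_lower_bound]).

    There are two constraints. First, about T^p times are used below 1 / T, so the
    union over all dyadic scales is a sequence in weak l^r as soon as p <= r
    ([weak_lr_blocks]). Second, mu has to be alpha-dimensional uniformly in T. A
    ball of radius rho meets a number of boxes that is counted separately in each
    coordinate ([sum_boxes_le_ball_bound]), and the bound C rho^alpha has to be
    checked only at a few critical radii, each of which gives a linear inequality
    between nu and p. For alpha >= n - 1 the critical radii come from the first
    coordinate ([ball_bound_high_dimension]); for alpha <= n - 1 it is the total
    mass that matters ([ball_bound_low_dimension]). In both cases nu <= 1 is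
    needed for the peaks to stay in the unit ball, and it permits
    p = (2 alpha - n) / (n + 1) with nu = 1. Taking p = min (r, (2 alpha - n) / (n + 1))
    and nu accordingly turns p / (2 nu) into the two expressions of the theorem. *)

(** * Gaussian integrals on the line *)

Section gaussian.
Context {R : realType}.
Implicit Types a b c x y : R.
Local Notation leb := (@lebesgue_measure R).

Definition gauss a x := expR (- (a * x ^+ 2)).

Lemma gauss_gt0 a x : 0 < gauss a x. Proof. exact: expR_gt0. Qed.
Lemma gauss_ge0 a x : 0 <= gauss a x. Proof. exact: expR_ge0. Qed.

Lemma is_derive_gauss a x : is_derive x 1 (gauss a) (- (2 * a * x) * gauss a x).
Proof.
rewrite /gauss.
have h : is_derive x 1 (fun y : R => - (a * y ^+ 2)) (- (2 * a * x)).
  rewrite (_ : (fun y => _) = - (a *: (id ^+ 2 : R -> R))); last first.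
    by apply/funext => y; rewrite !fctE.
  by apply: is_derive_eq; rewrite /GRing.scale /= expr1; ring.
have := @is_derive1_comp R expR (fun y : R => - (a * y ^+ 2)) x _ _ (is_derive_expR _) h.
by rewrite mulrC.
Qed.

Lemma continuous_gauss a : continuous (gauss a).
Proof.
move=> x; apply/differentiable_continuous/derivable1_diffP.
by have [] := is_derive_gauss a x.
Qed.

Lemma measurable_gauss a : measurable_fun setT (gauss a).
Proof. exact: (continuous_measurable_fun (@continuous_gauss a)). Qed.

Lemma integral_gauss_shift a c : 0 < a ->
  leb.-integrable setT (fun x => (gauss a (x - c))%:E) /\
  (\int[leb]_x (gauss a (x - c)))%R = Num.sqrt (pi / a).
Proof.
move=> a0; pose s := Num.sqrt (2 * a)^-1.
have ss : s ^+ 2 = (2 * a)^-1 by rewrite sqr_sqrtr// invr_ge0 mulr_ge0// ltW.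
have s0 : s != 0.
  by rewrite gt_eqF// sqrtr_gt0 invr_gt0 mulr_gt0.
have peak : normal_peak s = (Num.sqrt (pi / a))^-1.
  rewrite /normal_peak; congr (_ ^-1); congr Num.sqrt; rewrite ss.
  by field; rewrite gt_eqF.
have sq0 : 0 < Num.sqrt (pi / a) by rewrite sqrtr_gt0 divr_gt0 ?pi_gt0.
have E x : gauss a (x - c) = Num.sqrt (pi / a) * normal_pdf c s x.
  rewrite /normal_pdf (negbTE s0) peak mulrA divff ?gt_eqF// mul1r.
  rewrite /gauss /normal_fun ss; congr expR; field.
  by rewrite gt_eqF// invr_gt0 mulr_gt0.
have I : leb.-integrable setT (fun x => (normal_pdf c s x)%:E).
  exact: integrable_normal_pdf.
have J : leb.-integrable setT (fun x => (gauss a (x - c))%:E).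
  under eq_fun do rewrite E EFinM.
  exact: integrableZl.
split => //.
under eq_Rintegral do rewrite E.
rewrite RintegralZl//.
by rewrite /Rintegral integral_normal_pdf /= mulr1.
Qed.

Lemma integrable_gauss a : 0 < a -> leb.-integrable setT (EFin \o gauss a).
Proof.
move=> a0; have [+ _] := integral_gauss_shift 0 a0.
by under eq_fun do rewrite subr0.
Qed.

Lemma integral_gauss a : 0 < a -> (\int[leb]_x (gauss a x))%R = Num.sqrt (pi / a).
Proof.
move=> a0; have [_ <-] := integral_gauss_shift 0 a0.
by apply: eq_Rintegral => x _; rewrite subr0.
Qed.

(** This is y <= exp y at y = a x^2 / 2: a power is paid for by half of the
    exponent. *)
Lemma sqr_gauss_le a x : 0 < a -> x ^+ 2 * gauss a x <= 2 / a * gauss (a / 2) x.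
Proof.
move=> a0; have -> : gauss a x = gauss (a / 2) x * gauss (a / 2) x.
  by rewrite /gauss -expRD; congr expR; field.
rewrite mulrA ler_pM2r ?gauss_gt0// /gauss expRN.
rewrite ler_pdivrMr ?expR_gt0//.
rewrite -ler_pdivrMl ?divr_gt0// invf_div.
apply: le_trans (expR_ge1Dx _).
by rewrite mulrAC [_ * x ^+ 2]mulrC; lra.
Qed.

Lemma integrable_sqr_gauss a : 0 < a ->
  leb.-integrable setT (fun x => (x ^+ 2 * gauss a x)%:E).
Proof.
move=> a0; apply: (@le_integrable _ _ _ leb setT measurableT _ (fun x => (2 / a * gauss (a / 2) x)%:E)) => //.
- apply/measurable_EFinP; apply: measurable_funM; last exact: measurable_gauss.
  exact: measurable_funX.
- move=> x _ /=; rewrite lee_fin !ger0_norm.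
  + exact: sqr_gauss_le.
  + by rewrite mulr_ge0 ?gauss_ge0// divr_ge0// ltW.
  + by rewrite mulr_ge0 ?gauss_ge0// sqr_ge0.
- under eq_fun do rewrite EFinM.
  by apply: integrableZl => //; apply: integrable_gauss; rewrite divr_gt0.
Qed.

(** The bound 1 + x^2 is what a cosine and its derivative in the frequency
    both satisfy. *)
Lemma bounded_gauss_integrable a (h : R -> R) : 0 < a ->
  measurable_fun setT h -> (forall x, `|h x| <= 1 + x ^+ 2) ->
  leb.-integrable setT (fun x => (gauss a x * h x)%:E).
Proof.
move=> a0 mh hb.
apply: (@le_integrable _ _ _ leb setT measurableT _ (fun x => (gauss a x + x ^+ 2 * gauss a x)%:E)) => //.
- by apply/measurable_EFinP; apply: measurable_funM => //; exact: measurable_gauss.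
- move=> x _ /=; rewrite lee_fin normrM (ger0_norm (gauss_ge0 _ _)).
  rewrite [leRHS]ger0_norm ?(addr_ge0 (gauss_ge0 _ _) (mulr_ge0 (sqr_ge0 _) (gauss_ge0 _ _)))//.
  by rewrite -{2}[gauss a x]mul1r -mulrDl [leLHS]mulrC ler_wpM2r ?gauss_ge0.
- under eq_fun do rewrite EFinD.
  by apply: integrableD => //; [exact: integrable_gauss|exact: integrable_sqr_gauss].
Qed.

Lemma is_derive_affine b p x : is_derive x 1 (fun y : R => b * y + p) b.
Proof.
rewrite (_ : (fun y => _) = b *: (id : R -> R) + cst p)//.
by apply: is_derive_eq; rewrite /GRing.scale /= mulr1 addr0.
Qed.

Lemma is_derive_cosM b p x :
  is_derive x 1 (fun y : R => cos (b * y + p)) (- (b * sin (b * x + p))).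
Proof.
have := @is_derive1_comp R (@cos R) _ x _ _ (is_derive_cos _) (is_derive_affine b p x).
by rewrite mulNr [_ * b]mulrC.
Qed.

Lemma is_derive_sinM b p x :
  is_derive x 1 (fun y : R => sin (b * y + p)) (b * cos (b * x + p)).
Proof.
have := @is_derive1_comp R (@sin R) _ x _ _ (is_derive_sin _) (is_derive_affine b p x).
by rewrite [_ * b]mulrC.
Qed.

Lemma continuous_cosM b p : continuous (fun y : R => cos (b * y + p)).
Proof.
by move=> x; apply/differentiable_continuous/derivable1_diffP; have [] := is_derive_cosM b p x.
Qed.

Lemma continuous_sinM b p : continuous (fun y : R => sin (b * y + p)).
Proof.
by move=> x; apply/differentiable_continuous/derivable1_diffP; have [] := is_derive_sinM b p x.
Qed.

Lemma normr_cos_le1 x : `|cos x| <= 1.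
Proof. by rewrite ler_norml cos_geN1 cos_le1. Qed.

Lemma normr_sin_le1 x : `|sin x| <= 1.
Proof. by rewrite ler_norml sin_geN1 sin_le1. Qed.

Lemma normr_le_1Dsqr x : `|x| <= 1 + x ^+ 2.
Proof.
have [h|h] := lerP `|x| 1; first by rewrite (le_trans h)// lerDl sqr_ge0.
by rewrite -real_normK ?num_real// expr2; nra.
Qed.

(** The phase p lets one computation serve for the cosine and the sine
    transform. *)
Definition gcos a p b : R := (\int[leb]_y (gauss a y * cos (b * y + p)))%R.

Lemma integrable_gcos a p b : 0 < a ->
  leb.-integrable setT (fun y => (gauss a y * cos (b * y + p))%:E).
Proof.
move=> a0; apply: bounded_gauss_integrable => //; first exact: (continuous_measurable_fun (@continuous_cosM _ _)).
by move=> x; rewrite (le_trans (normr_cos_le1 _))// lerDl sqr_ge0.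
Qed.

Lemma integrable_gsin a p b : 0 < a ->
  leb.-integrable setT (fun y => (gauss a y * sin (b * y + p))%:E).
Proof.
move=> a0; apply: bounded_gauss_integrable => //; first exact: (continuous_measurable_fun (@continuous_sinM _ _)).
by move=> x; rewrite (le_trans (normr_sin_le1 _))// lerDl sqr_ge0.
Qed.

Lemma integrable_gsin_mom a p b : 0 < a ->
  leb.-integrable setT (fun y => (gauss a y * (y * sin (b * y + p)))%:E).
Proof.
move=> a0; apply: bounded_gauss_integrable => //.
  by apply: measurable_funM => //; exact: (continuous_measurable_fun (@continuous_sinM _ _)).
move=> x; rewrite normrM (le_trans _ (normr_le_1Dsqr x))//.
by rewrite ler_piMr// normr_sin_le1.
Qed.

Lemma is_derive_gcos a p b : 0 < a ->
  is_derive b 1 (gcos a p) (- (\int[leb]_y (gauss a y * (y * sin (b * y + p))))%R).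
Proof.
move=> a0.
pose f := fun (b y : R) => gauss a y * cos (b * y + p).
have df c y : is_derive c 1 (f ^~ y) (- (gauss a y * (y * sin (c * y + p)))).
  rewrite /f (_ : (fun _ => _) = gauss a y *: (fun c => cos (y * c + p))); last first.
    by apply/funext => z; rewrite fctE [y * z]mulrC.
  have h := is_derive_cosM y p c.
  by apply: is_derive_eq; rewrite /GRing.scale /= mulrN [y * c]mulrC.
have E c y : partial1of2 f c y = - (gauss a y * (y * sin (c * y + p))).
  by rewrite partial1of2E; have [_ ->] := df c y.
have ub c y : `|partial1of2 f c y| <= gauss a y * (1 + y ^+ 2).
  rewrite E normrN normrM (ger0_norm (gauss_ge0 _ _)) ler_wpM2l ?gauss_ge0//.
  rewrite normrM (le_trans _ (normr_le_1Dsqr y))//.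
  by rewrite ler_piMr// normr_sin_le1.
have iG : leb.-integrable setT (fun y => (gauss a y * (1 + y ^+ 2))%:E).
  apply: bounded_gauss_integrable => //.
    by apply: measurable_funD => //; exact: measurable_funX.
  by move=> x; rewrite ger0_norm// addr_ge0// sqr_ge0.
have bI : `]b - 1, b + 1[%classic b by rewrite /= in_itv/=; lra.
have Gge0 y : 0 <= gauss a y * (1 + y ^+ 2).
  by rewrite mulr_ge0 ?gauss_ge0// addr_ge0// sqr_ge0.
have intf c : `]b - 1, b + 1[%classic c -> leb.-integrable setT (EFin \o f c).
  by move=> _; exact: integrable_gcos.
have dd c y : `]b - 1, b + 1[%classic c -> [set: R] y -> derivable (f ^~ y) c 1.
  by move=> _ _; have [] := df c y.
have D := @derivable_under_integral R _ _ leb f setT measurableT b _ _ bI intf dd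
  _ Gge0 iG (fun c y _ _ => ub c y).
split; first exact: D.
rewrite -derive1E.
rewrite (@differentiation_under_integral R _ _ leb f setT measurableT b _ _ bI intf dd
  _ Gge0 iG (fun c y _ _ => ub c y)).
under eq_Rintegral do rewrite E -mulN1r.
by rewrite RintegralZl// ?mulN1r//; exact: integrable_gsin_mom.
Qed.

(** The fundamental theorem on [- n, n] and dominated convergence; used as
    integration by parts on the whole line. *)
Lemma integral_derivative_eq0 (F f : R -> R) :
  (forall x, is_derive x 1 F (f x)) -> continuous f ->
  leb.-integrable setT (EFin \o f) ->
  F n.+1%:R @[n --> \oo] --> (0 : R) -> F (- n.+1%:R) @[n --> \oo] --> (0 : R) ->
  (\int[leb]_y (f y))%R = 0.
Proof.
move=> dF cf If Fp Fn.
pose In (n : nat) : set R := `[- n.+1%:R, n.+1%:R]%classic.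
pose fn (n : nat) (x : R) : \bar R := (EFin \o f \_ (In n)) x.
have cF x : {for x, continuous F}.
  by apply/differentiable_continuous/derivable1_diffP; have [] := dF x.
have intE n : (\int[leb]_x fn n x = (F n.+1%:R - F (- n.+1%:R))%:E)%E.
  rewrite /fn -restrict_EFin -integral_mkcond EFinB; apply: continuous_FTC2.
  - by rewrite gtrN.
  - exact: continuous_subspaceT.
  - split => [x _||]; first by have [] := dF x.
      exact/cvg_at_right_filter/cF.
    exact/cvg_at_left_filter/cF.
  - by move=> x _; rewrite derive1E; have [_ ->] := dF x.
have [] := @dominated_convergence _ _ _ leb setT measurableT fn (EFin \o f) (abse \o (EFin \o f)).
- move=> n; apply/measurable_EFinP.
  apply/(measurable_restrictT f (measurable_itv `[- n.+1%:R, n.+1%:R])).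
  by apply: measurable_funTS; exact: (continuous_measurable_fun cf).
- exact: (measurable_int leb).
- apply/aeW => x _; apply: cvg_near_cst; near=> n.
  rewrite /fn /= patchE mem_set// /In /= in_itv/= -ler_norml.
  apply: (@le_trans _ _ n%:R); last by rewrite ler_nat.
  by near: n; apply: nbhs_infty_ger; exact: num_real.
- exact: integrable_abse.
- apply/aeW => x n _; rewrite /fn /= patchE; case: ifP => _ //=.
  by rewrite normr0 lee_fin.
move=> _ _ C.
have C2 : (F n.+1%:R - F (- n.+1%:R))%:E @[n --> \oo] --> (0 - 0)%:E.
  by apply: cvg_EFin; [exact: nearW|exact: cvgB].
rewrite /Rintegral.
rewrite (_ : (fun n => (F n.+1%:R - F (- n.+1%:R))%:E) = (fun n => \int[leb]_x fn n x)%E) in C2; last first.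
  by apply/funext => n; rewrite intE.
have -> : (\int[leb]_x (f x)%:E = (0 - 0)%:E)%E .
  exact: (cvg_unique _ C C2).
by rewrite subr0.
Unshelve. all: end_near. Qed.

Lemma cvg_gauss0 a : 0 < a -> gauss a n.+1%:R @[n --> \oo] --> (0 : R).
Proof.
move=> a0.
apply: (@squeeze_cvgr _ _ _ _ (cst 0) (fun n => a^-1 * harmonic n)).
- apply: nearW => n; rewrite /= gauss_ge0/= /gauss expRN /harmonic /= -invfM.
  rewrite lef_pV2 ?posrE ?expR_gt0 ?mulr_gt0//.
  apply: le_trans (expR_ge1Dx _); rewrite ler_wpDl// ler_wpM2l ?(ltW a0)//.
  by rewrite expr2 ler_peMl// ler1n.
- exact: cvg_cst.
- by rewrite -[X in _ --> X](mulr0 a^-1); apply: cvgMr; exact: cvg_harmonic.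
Qed.

(** Integration by parts against the Gaussian. With [is_derive_gcos] it says
    that G = gcos a p solves 2 a G' = - b G, which determines the Fourier
    transform of a Gaussian up to a constant. *)
Lemma gcos_ode a p b : 0 < a ->
  2 * a * (\int[leb]_y (gauss a y * (y * sin (b * y + p))))%R = b * gcos a p b.
Proof.
move=> a0.
pose F (y : R) := gauss a y * sin (b * y + p).
pose f (y : R) := b * (gauss a y * cos (b * y + p)) - 2 * a * (gauss a y * (y * sin (b * y + p))).
have dF x : is_derive x 1 F (f x).
  have h1 := is_derive_gauss a x; have h2 := is_derive_sinM b p x.
  by apply: is_derive_eq; rewrite /f /GRing.scale /=; ring.
have cf : continuous f.
  move=> x; apply: cvgB.
    by apply: cvgM; [exact: cvg_cst|apply: cvgM; [exact: continuous_gauss|exact: continuous_cosM]].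
  apply: cvgM; [exact: cvg_cst|apply: cvgM; [exact: continuous_gauss|]].
  by apply: cvgM; [exact: cvg_id|exact: continuous_sinM].
have I1 := integrable_gcos p b a0; have I2 := integrable_gsin_mom p b a0.
have J1 : leb.-integrable setT (EFin \o (fun y => b * (gauss a y * cos (b * y + p)))).
  by rewrite /comp; under eq_fun do rewrite EFinM; exact: integrableZl.
have J2 : leb.-integrable setT (EFin \o (fun y => 2 * a * (gauss a y * (y * sin (b * y + p))))).
  by rewrite /comp; under eq_fun do rewrite EFinM; exact: integrableZl.
have If : leb.-integrable setT (EFin \o f).
  by rewrite /comp /f; under eq_fun do rewrite EFinB; exact: integrableB.
have g0 := cvg_gauss0 a0.
have := integral_derivative_eq0 dF cf If.
have bd : forall (u : nat -> R), (forall n, `|u n| <= gauss a n.+1%:R) -> u @ \oo --> (0 : R).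
  move=> u ub; apply/norm_cvg0P.
  apply: (@squeeze_cvgr _ _ _ _ (cst 0) (fun n => gauss a n.+1%:R)) => //.
    by apply: nearW => n; rewrite /= normr_ge0 ub.
  exact: cvg_cst.
have -> : (\int[leb]_y f y)%R = b * gcos a p b - 2 * a * (\int[leb]_y (gauss a y * (y * sin (b * y + p))))%R.
  by rewrite /f RintegralB// !RintegralZl.
move=> H; apply/eqP; rewrite eq_sym -subr_eq0; apply/eqP; apply: H; apply: bd => n.
  by rewrite normrM (ger0_norm (gauss_ge0 _ _)) ler_piMr ?gauss_ge0 ?normr_sin_le1.
rewrite normrM (ger0_norm (gauss_ge0 _ _)) {1}/gauss sqrrN.
by rewrite ler_piMr ?gauss_ge0 ?normr_sin_le1.
Qed.

(** By [gcos_ode] the product of G with exp (b^2 / 4a) has zero derivative. *)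
Lemma gcosE a p b : 0 < a ->
  gcos a p b = cos p * Num.sqrt (pi / a) * expR (- (b ^+ 2 / (4 * a))).
Proof.
move=> a0.
have d x : is_derive x 1 (fun b => gcos a p b * gauss (- (4 * a)^-1) b) 0.
  have h1 := is_derive_gcos p x a0; have h2 := is_derive_gauss (- (4 * a)^-1) x.
  apply: is_derive_eq; rewrite /GRing.scale /=.
  have := gcos_ode p x a0; set J := Rintegral _ _ _ => e.
  have -> : gcos a p x * (- (2 * - (4 * a)^-1 * x) * gauss (- (4 * a)^-1) x) =
      (x * gcos a p x) / (2 * a) * gauss (- (4 * a)^-1) x by field; rewrite gt_eqF.
  by rewrite -e; field; rewrite gt_eqF.
have := is_derive_0_is_cst b 0 d.
rewrite {2}/gauss expr0n mulr0 oppr0 expR0 mulr1.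
have -> : gcos a p 0 = cos p * Num.sqrt (pi / a).
  rewrite /gcos; under eq_Rintegral do rewrite mul0r add0r.
  by rewrite RintegralZr ?integral_gauss//; [rewrite mulrC|exact: integrable_gauss].
move=> <-; rewrite /gauss -mulrA -expRD.
rewrite [X in expR X](_ : _ = 0) ?expR0 ?mulr1//.
by field; rewrite gt_eqF.
Qed.

Lemma integral_gauss_cos (w b : R) : 0 < w ->
  (\int[leb]_y (w * gauss (pi * w ^+ 2) y * cos (2 * pi * b * y)))%R =
  gauss (pi / w ^+ 2) b.
Proof.
move=> w0; have a0 : 0 < pi * w ^+ 2 by rewrite mulr_gt0 ?pi_gt0// exprn_gt0.
have pi0 : pi != 0 :> R by rewrite gt_eqF// pi_gt0.
have wn0 : w != 0 by rewrite gt_eqF.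
under eq_Rintegral do rewrite -mulrA -[X in cos X]addr0.
rewrite RintegralZl//; last exact: integrable_gcos.
rewrite -/(gcos _ _ _) gcosE// cos0 mul1r.
have e1 (P : R) : P != 0 -> P / (P * w ^+ 2) = (w^-1) ^+ 2.
  by move=> P0; field; rewrite wn0 P0.
have e2 (P : R) : P != 0 -> (2 * P * b) ^+ 2 / (4 * (P * w ^+ 2)) = P / w ^+ 2 * b ^+ 2.
  by move=> P0; field; rewrite wn0 P0.
rewrite e1// e2//.
by rewrite sqrtr_sqr ger0_norm ?invr_ge0 ?ltW// mulrA divff// mul1r.
Qed.

Lemma integral_gauss_sin (w b : R) : 0 < w ->
  (\int[leb]_y (w * gauss (pi * w ^+ 2) y * sin (2 * pi * b * y)))%R = 0.
Proof.
move=> w0; have a0 : 0 < pi * w ^+ 2 by rewrite mulr_gt0 ?pi_gt0// exprn_gt0.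
have E y : sin (2 * pi * b * y) = cos (2 * pi * b * y + - (pi / 2)).
  by rewrite -cosBpihalf.
under eq_Rintegral do rewrite -mulrA E.
rewrite RintegralZl//; last exact: integrable_gcos.
by rewrite -/(gcos _ _ _) gcosE// cosN cos_pihalf !mul0r mulr0.
Qed.

End gaussian.

(** * Integrals of tensor products *)

Section product_integral.
Context {R : realType}.
Local Notation leb := (@lebesgue_measure R).

Lemma integrable_measurable d (T : measurableType d)
    (m : {measure set T -> \bar R}) (F : T -> R) :
  m.-integrable setT (EFin \o F) -> measurable_fun setT F.
Proof. by move=> iF; exact/measurable_EFinP/(measurable_int m). Qed.

Lemma integral_prod2 d1 d2 (T1 : measurableType d1) (T2 : measurableType d2)
    (m1 : {sigma_finite_measure set T1 -> \bar R})
    (m2 : {sigma_finite_measure set T2 -> \bar R}) (F : T1 -> R) (G : T2 -> R) :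
  m1.-integrable setT (EFin \o F) -> m2.-integrable setT (EFin \o G) ->
  (m1 \x m2)%E.-integrable setT (fun z => (F z.1 * G z.2)%:E) /\
  (\int[(m1 \x m2)%E]_z (F z.1 * G z.2) =
   (\int[m1]_x F x) * (\int[m2]_y G y))%R.
Proof.
move=> iF iG.
have mF : measurable_fun setT F by exact: integrable_measurable iF.
have mG : measurable_fun setT G by exact: integrable_measurable iG.
have mFG : measurable_fun setT (fun z : T1 * T2 => (F z.1 * G z.2)%:E).
  by apply/measurable_EFinP; apply: measurable_funM; apply: measurableT_comp.
have iFG : (m1 \x m2)%E.-integrable setT (fun z => (F z.1 * G z.2)%:E).
  apply/integrable12ltyP => //=.
  under eq_integral => x _.
    under eq_integral => y _ do rewrite normrM EFinM.
    rewrite integralZl//; last exact: integrable_norm.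
    over.
  have fG : (\int[m2]_y `|G y|%:E)%E \is a fin_num.
    exact/integrable_fin_num/integrable_norm.
  rewrite -(fineK fG) integralZr//; last exact: integrable_norm.
  have fF : (\int[m1]_y `|F y|%:E)%E \is a fin_num.
    exact/integrable_fin_num/integrable_norm.
  by rewrite -(fineK fF) -EFinM ltry.
split => //.
rewrite /Rintegral -integral12_prod_meas1//.
rewrite [X in fine X = _](_ : _ = \int[m1]_x ((F x)%:E * \int[m2]_y (G y)%:E))%E; last first.
  apply: eq_integral => x _; rewrite /fubini_F /=.
  under eq_integral => y _ do rewrite EFinM.
  by rewrite integralZl.
have fG : (\int[m2]_y (G y)%:E)%E \is a fin_num by exact: integrable_fin_num.
have fF : (\int[m1]_y (F y)%:E)%E \is a fin_num by exact: integrable_fin_num.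
by rewrite -(fineK fG) integralZr//= -(fineK fF).
Qed.

Definition tailR n (x : 'rV[R]_n.+1) : 'rV[R]_n := \row_i x ord0 (lift ord0 i).

Lemma measurable_tailR n :
  measurable_fun [set: Rn R n.+1] (@tailR n : Rn R n.+1 -> Rn R n).
Proof.
apply: measurable_rV => i.
rewrite (_ : (fun _ => _) = (fun v : Rn R n.+1 => (v : 'rV[R]_n.+1) ord0 (lift ord0 i))).
  exact: measurable_coord.
by apply/funext => v; rewrite mxE.
Qed.

(** Lebesgue measure on the (n+1)-dimensional space is an image of a product
    measure, so the product formula is transported by a pushforward. *)
Lemma integral_cons n (F : R -> R) (G : Rn R n -> R) :
  leb.-integrable setT (EFin \o F) ->
  (lebesgue_Rn n).-integrable setT (EFin \o G) ->
  (lebesgue_Rn n.+1).-integrable setT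
    (fun x : Rn R n.+1 => (F ((x : 'rV[R]_n.+1) ord0 ord0) * G (tailR x))%:E) /\
  (\int[lebesgue_Rn n.+1]_x (F ((x : 'rV[R]_n.+1) ord0 ord0) * G (tailR x)) =
   (\int[leb]_x F x) * (\int[lebesgue_Rn n]_y G y))%R.
Proof.
move=> iF iG; have [iFG eFG] := integral_prod2 iF iG.
have mF : measurable_fun [set: measurableTypeR R] F by exact: integrable_measurable iF.
have mG : measurable_fun [set: Rn R n] G by exact: integrable_measurable iG.
pose H (x : Rn R n.+1) := (F ((x : 'rV[R]_n.+1) ord0 ord0) * G (tailR x))%:E.
have mH : measurable_fun setT H.
  apply/measurable_EFinP; apply: measurable_funM.
    exact: (measurableT_comp mF (measurable_coord ord0)).
  exact: (measurableT_comp mG (@measurable_tailR n)).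
have HE : H \o @cons_rV R n = (fun z => (F z.1 * G z.2)%:E).
  apply/funext => z; rewrite /H /=; congr (_ * _)%:E.
    by rewrite cons_rV0.
  by congr G; apply/rowP => i; rewrite mxE cons_rVS.
have iH : (leb \x lebesgue_Rn n)%E.-integrable (@cons_rV R n @^-1` setT) (H \o @cons_rV R n).
  by rewrite preimage_setT HE.
split.
  exact: (integrable_pushforward (@measurable_cons_rV R n) mH iH measurableT).
rewrite -eFG /Rintegral; congr fine.
rewrite -HE -(preimage_setT (@cons_rV R n)).
exact: (integral_pushforward (@measurable_cons_rV R n) mH iH measurableT).
Qed.

Lemma integral_prod n (h : 'I_n -> R -> R) :
  (forall i, leb.-integrable setT (EFin \o h i)) ->
  (lebesgue_Rn n).-integrable setT
    (fun x : Rn R n => (\prod_i h i ((x : 'rV[R]_n) ord0 i))%:E) /\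
  (\int[lebesgue_Rn n]_x (\prod_i h i ((x : 'rV[R]_n) ord0 i)) =
   \prod_i (\int[leb]_x h i x))%R.
Proof.
elim: n h => [|n IHn] h ih.
  under eq_fun do rewrite big_ord0.
  under eq_Rintegral do rewrite big_ord0.
  rewrite big_ord0 /=; split.
    by apply: finite_measure_integrable_cst.
  by rewrite Rintegral_cst//= indicE in_setT mulr1.
have [iP eP] := IHn (fun i => h (lift ord0 i)) (fun i => ih _).
have [iQ eQ] := integral_cons (ih ord0) iP.
have E (x : Rn R n.+1) : \prod_i h i ((x : 'rV[R]_n.+1) ord0 i) =
   h ord0 ((x : 'rV[R]_n.+1) ord0 ord0) *
   \prod_i h (lift ord0 i) ((tailR x) ord0 i).
  by rewrite big_ord_recl; congr (_ * _); apply: eq_bigr => i _; rewrite mxE.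
split; first by under eq_fun do rewrite E.
under eq_Rintegral do rewrite E.
by rewrite eQ eP big_ord_recl.
Qed.

Definition cint1 (h : R -> R[i]) : R[i] :=
  ((\int[leb]_x complex.Re (h x))%R +i* (\int[leb]_x complex.Im (h x))%R)%C.

Definition cintegrable1 (h : R -> R[i]) :=
  leb.-integrable setT (EFin \o (fun x => complex.Re (h x))) /\
  leb.-integrable setT (EFin \o (fun x => complex.Im (h x))).

(** Expanding one factor at a time, the real and imaginary parts of the product
    are sums of products of real functions, to which [integral_cons] applies. *)
Lemma cintegral_prod n (h : 'I_n -> R -> R[i]) :
  (forall i, cintegrable1 (h i)) ->
  let P := (fun x : Rn R n => \prod_i h i ((x : 'rV[R]_n) ord0 i)) in
  [/\ (lebesgue_Rn n).-integrable setT (EFin \o (fun x => complex.Re (P x))),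
      (lebesgue_Rn n).-integrable setT (EFin \o (fun x => complex.Im (P x))) &
      cintegral P = \prod_i cint1 (h i)].
Proof.
elim: n h => [|n IHn] h ih /=.
  rewrite /cintegral.
  rewrite (_ : (fun x : Rn R 0 => complex.Re _) = cst 1); last first.
    by apply/funext => x; rewrite big_ord0.
  rewrite (_ : (fun x : Rn R 0 => complex.Im _) = cst 0); last first.
    by apply/funext => x; rewrite big_ord0.
  rewrite big_ord0; split.
  - exact: finite_measure_integrable_cst.
  - exact: finite_measure_integrable_cst.
  - by rewrite !Rintegral_cst//= indicE in_setT mulr1 mul0r.
have [iR iI eP] := IHn (fun i => h (lift ord0 i)) (fun i => ih _).
pose P := (fun x : Rn R n => \prod_i h (lift ord0 i) ((x : 'rV[R]_n) ord0 i)).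
rewrite -/P in iR iI eP.
have [i0R i0I] := ih ord0.
have [j1 e1] := integral_cons i0R iR; have [j2 e2] := integral_cons i0I iI.
have [j3 e3] := integral_cons i0R iI; have [j4 e4] := integral_cons i0I iR.
pose z (x : Rn R n.+1) := h ord0 ((x : 'rV[R]_n.+1) ord0 ord0).
have E (x : Rn R n.+1) : \prod_i h i ((x : 'rV[R]_n.+1) ord0 i) = z x * P (tailR x).
  by rewrite big_ord_recl; congr (_ * _); apply: eq_bigr => i _; rewrite mxE.
have ER : (fun x : Rn R n.+1 => complex.Re (\prod_i h i ((x : 'rV[R]_n.+1) ord0 i))) =
  (fun x => complex.Re (z x) * complex.Re (P (tailR x)) -
            complex.Im (z x) * complex.Im (P (tailR x))).
  by apply/funext => x; rewrite E; case: (z x) => a b; case: (P _).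
have EI : (fun x : Rn R n.+1 => complex.Im (\prod_i h i ((x : 'rV[R]_n.+1) ord0 i))) =
  (fun x => complex.Re (z x) * complex.Im (P (tailR x)) +
            complex.Im (z x) * complex.Re (P (tailR x))).
  by apply/funext => x; rewrite E; case: (z x) => a b; case: (P _).
rewrite /cintegral ER EI; split.
- rewrite (_ : _ \o _ = (fun x => (complex.Re (z x) * complex.Re (P (tailR x)))%:E) \-
      (fun x => (complex.Im (z x) * complex.Im (P (tailR x)))%:E))%E//.
  exact: integrableB.
- rewrite (_ : _ \o _ = (fun x => (complex.Re (z x) * complex.Im (P (tailR x)))%:E) \+
      (fun x => (complex.Im (z x) * complex.Re (P (tailR x)))%:E))%E//.
  exact: integrableD.
rewrite RintegralB// RintegralD// e1 e2 e3 e4 big_ord_recl -eP /cint1 /cintegral.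
by [].
Qed.

End product_integral.

(** * Sums of modulated Gaussians on the line *)

Section polar_form.
Context {R : realType}.

Definition polar (r th : R) : R[i] := (r * cos th +i* (r * sin th))%C.

Lemma polarM r s a b : polar r a * polar s b = polar (r * s) (a + b).
Proof. by congr Complex; rewrite ?cosD ?sinD; ring. Qed.

Lemma cisE (th : R) : cis th = polar 1 th.
Proof. by rewrite /cis /polar !mul1r. Qed.

Lemma polar_cis r a b : polar r a * cis b = polar r (a + b).
Proof. by rewrite cisE polarM mulr1. Qed.

Lemma prod_cis I (s : seq I) (th : I -> R) :
  \prod_(i <- s) cis (th i) = cis (\sum_(i <- s) th i).
Proof.
elim/big_rec2: _ => [|i y z _ ->]; first by rewrite /cis cos0 sin0.
by rewrite !cisE polarM mulr1.
Qed.

Lemma Re_sum I (s : seq I) (z : I -> R[i]) :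
  complex.Re (\sum_(i <- s) z i) = \sum_(i <- s) complex.Re (z i).
Proof. by elim/big_rec2: _ => // i x y _ <-; case: (z i); case: y. Qed.

Lemma Im_sum I (s : seq I) (z : I -> R[i]) :
  complex.Im (\sum_(i <- s) z i) = \sum_(i <- s) complex.Im (z i).
Proof. by elim/big_rec2: _ => // i x y _ <-; case: (z i); case: y. Qed.

Lemma normc_prod I (s : seq I) (z : I -> R[i]) :
  Normc.normc (\prod_(i <- s) z i) = \prod_(i <- s) Normc.normc (z i).
Proof. by elim/big_rec2: _ => [|i y x _ <-]; rewrite ?Normc.normc1 ?Normc.normcM. Qed.

Lemma normc_real (x : R) : 0 <= x -> Normc.normc x%:C%C = x.
Proof. by move=> x0; rewrite /= expr0n addr0 sqrtr_sqr ger0_norm. Qed.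

(** Moduli of oscillatory integrals are bounded below through this lemma: rotate
    by the common phase and keep the real part, which is a real integral. *)
Lemma Re_rot_le_normc (z : R[i]) a :
  complex.Re z * cos a + complex.Im z * sin a <= Normc.normc z.
Proof.
case: z => x y /=; rewrite (le_trans (ler_norm _))//.
rewrite -sqrtr_sqr ler_sqrt ?addr_ge0 ?sqr_ge0//.
have e := cos2Dsin2 a; set c := cos a in e *; set s := sin a in e *.
have : 0 <= (x * s - y * c) ^+ 2 by rewrite sqr_ge0.
have -> : x ^+ 2 + y ^+ 2 = (x ^+ 2 + y ^+ 2) * (c ^+ 2 + s ^+ 2) by rewrite e mulr1.
nra.
Qed.

End polar_form.

Section wave.
Context {R : realType}.
Local Notation leb := (@lebesgue_measure R).

Lemma integrable_bigsum I (s : seq I) (f : I -> R -> R) :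
  (forall i, leb.-integrable setT (EFin \o f i)) ->
  leb.-integrable setT (EFin \o (fun x => \sum_(i <- s) f i x)).
Proof.
move=> fi; rewrite /comp; under eq_fun do rewrite -sumEFin.
by apply: integrable_sum => // i _; exact: fi.
Qed.

Lemma Rintegral_bigsum I (s : seq I) (f : I -> R -> R) :
  (forall i, leb.-integrable setT (EFin \o f i)) ->
  (\int[leb]_x (\sum_(i <- s) f i x))%R = \sum_(i <- s) (\int[leb]_x f i x)%R.
Proof.
move=> fi; elim: s => [|i s IH].
  under eq_Rintegral do rewrite big_nil.
  by rewrite big_nil Rintegral_cst// mul0r.
under eq_Rintegral do rewrite big_cons.
rewrite big_cons RintegralD//; first by rewrite IH.
exact: integrable_bigsum.
Qed.

Variables (w : R) (M : nat) (lam : nat -> R).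
Hypothesis w0 : 0 < w.

(** The factor w makes each bump of the Fourier transform [wave_hat] have height
    one and width w. *)
Definition wave (x : R) : R[i] :=
  \sum_(m < M) polar (w * gauss (pi * w ^+ 2) x) (2 * pi * lam m * x).

Definition wave_hat (xi : R) : R := \sum_(m < M) gauss (pi / w ^+ 2) (xi - lam m).

Lemma wave_hat_ge0 xi : 0 <= wave_hat xi.
Proof. by apply: sumr_ge0 => m _; exact: gauss_ge0. Qed.

Let a0 : 0 < pi * w ^+ 2 :> R.
Proof. by rewrite mulr_gt0 ?pi_gt0// exprn_gt0. Qed.

Let aw0 : 0 < pi / w ^+ 2 :> R.
Proof. by rewrite divr_gt0 ?pi_gt0// exprn_gt0. Qed.

Lemma integrable_wave_hat : leb.-integrable setT (EFin \o wave_hat).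
Proof.
apply: integrable_bigsum => m.
by have [] := integral_gauss_shift (lam m) aw0.
Qed.

Lemma wave_fourier xi :
  let h := (fun x => wave x * cis (- (2 * pi * (x * xi)))) in
  cintegrable1 h /\ cint1 h = (wave_hat xi)%:C%C.
Proof.
move=> h.
have hE x : h x = \sum_(m < M) polar (w * gauss (pi * w ^+ 2) x) (2 * pi * (lam m - xi) * x).
  rewrite /h /wave mulr_suml; apply: eq_bigr => m _.
  by rewrite polar_cis; congr polar; ring.
have Ic b : leb.-integrable setT (EFin \o (fun x => w * gauss (pi * w ^+ 2) x * cos (2 * pi * b * x))).
  rewrite /comp; under eq_fun do rewrite -mulrA -[X in cos X]addr0 EFinM.
  by apply: integrableZl => //; exact: integrable_gcos.
have Is b : leb.-integrable setT (EFin \o (fun x => w * gauss (pi * w ^+ 2) x * sin (2 * pi * b * x))).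
  rewrite /comp; under eq_fun do rewrite -mulrA -[X in sin X]addr0 EFinM.
  by apply: integrableZl => //; exact: integrable_gsin.
have hR : (fun x => complex.Re (h x)) =
  (fun x => \sum_(m < M) (w * gauss (pi * w ^+ 2) x * cos (2 * pi * (lam m - xi) * x))).
  by apply/funext => x; rewrite hE Re_sum.
have hI : (fun x => complex.Im (h x)) =
  (fun x => \sum_(m < M) (w * gauss (pi * w ^+ 2) x * sin (2 * pi * (lam m - xi) * x))).
  by apply/funext => x; rewrite hE Im_sum.
split; first by split; rewrite ?hR ?hI; apply: integrable_bigsum => m.
rewrite /cint1 hR hI; congr Complex.
  rewrite Rintegral_bigsum => [|m]; last exact: Ic.
  apply: eq_bigr => m _; rewrite integral_gauss_cos//.
  by rewrite /gauss -(sqrrN (lam m - xi)) opprB.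
rewrite Rintegral_bigsum => [|m]; last exact: Is.
by rewrite big1// => m _; rewrite integral_gauss_sin.
Qed.

End wave.

Section coherent.
Context {R : realType}.
Local Notation leb := (@lebesgue_measure R).

Lemma cos_ge_1Bnorm (y : R) : 1 - `|y| <= cos y.
Proof.
have -> : cos y = cos `|y| by have [_|_] := ger0P y; rewrite ?cosN.
have dc (x : R) : x \in `]0, `|y|[ -> is_derive x 1 (@cos R) (- sin x).
  by move=> _; exact: is_derive_cos.
have cc : {within `[0, `|y|], continuous (@cos R)}.
  by apply: continuous_subspaceT => x; exact: continuous_cos.
have [c _ e] := MVT_segment (normr_ge0 y) dc cc.
rewrite cos0 subr0 in e.
have : - sin c * `|y| >= - `|y|.
  by rewrite mulNr lerN2 ler_piMl// sin_le1.
by rewrite -e; lra.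
Qed.

Lemma cos_shift_int (k : int) (y : R) : cos (2 * pi * (k%:~R + y)) = cos (2 * pi * y).
Proof.
have posn (m : nat) (z : R) : cos (2 * pi * (m%:R + z)) = cos (2 * pi * z).
  rewrite -(periodicn (@cosD2pi R) m (2 * pi * z)); congr cos.
  by rewrite -(mulr_natr _ m) -(mulr_natr pi 2); ring.
case: k => m; first exact: posn.
rewrite NegzE -{2}(subrK m.+1%:R y) [y - _ + _]addrC posn; congr cos.
by rewrite mulrNz addrC.
Qed.

(** The phase is small where the Gaussian lives. Its quadratic growth away from
    there is absorbed by widening the Gaussian, through [sqr_gauss_le]. *)
Lemma gauss_cos_lower (w e b t eta eps : R) :
  0 < w -> 0 <= eps -> `|e| <= eps -> `|b| * w <= eps -> `|t| * w ^+ 2 <= eps ->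
  (1 - 16 * eps) * gauss (pi / w ^+ 2) eta - 16 * eps * gauss (pi / w ^+ 2 / 2) eta <=
  gauss (pi / w ^+ 2) eta * cos (2 * pi * (e + b * eta + t * eta ^+ 2)).
Proof.
move=> w0 eps0 he hb ht; set a := pi / w ^+ 2.
have a0 : 0 < a by rewrite divr_gt0 ?pi_gt0// exprn_gt0.
have pi4 : pi < 4 :> R by have := @pihalf_lt2 R; lra.
set er := e + _ + _.
have ber : `|er| <= eps * (2 + 2 * (eta / w) ^+ 2).
  have b1 : `|b * eta| <= eps * `|eta / w|.
    rewrite normrM normrM normfV (gtr0_norm w0) mulrA ler_pdivlMr// mulrAC.
    by rewrite ler_wpM2r.
  have b2 : `|t * eta ^+ 2| <= eps * (eta / w) ^+ 2.
    rewrite normrM [X in _ * X]ger0_norm ?sqr_ge0// expr_div_n [leRHS]mulrA.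
    by rewrite ler_pdivlMr ?exprn_gt0// mulrAC ler_wpM2r ?sqr_ge0.
  have b3 := normr_le_1Dsqr (eta / w).
  have b4 := ler_wpM2l eps0 b3.
  have := ler_normD (e + b * eta) (t * eta ^+ 2).
  have := ler_normD e (b * eta).
  by rewrite -/er; lra.
have c1 := cos_ge_1Bnorm (2 * pi * er).
rewrite normrM ger0_norm in c1; last by rewrite mulr_ge0// pi_ge0.
have c2 : 2 * pi * `|er| <= 8 * (eps * (2 + 2 * (eta / w) ^+ 2)).
  by rewrite ler_pM// ?mulr_ge0 ?pi_ge0//; lra.
have G0 := gauss_ge0 a eta.
have c3 : gauss a eta * (1 - 16 * eps - 16 * eps * (eta / w) ^+ 2) <= gauss a eta * cos (2 * pi * er).
  by rewrite ler_wpM2l//; lra.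
apply: le_trans c3.
have S' : (eta / w) ^+ 2 * gauss a eta <= 2 / pi * gauss (a / 2) eta.
  rewrite expr_div_n mulrAC ler_pdivrMr ?exprn_gt0//.
  apply: le_trans (sqr_gauss_le eta a0) _.
  have -> : 2 / a = 2 / pi * w ^+ 2 by rewrite /a invf_div [LHS]mulrA [LHS]mulrAC.
  by rewrite mulrAC.
have p2 : 2 / pi <= 1 :> R by rewrite ler_pdivrMr ?pi_gt0// mul1r pi_ge2.
have S'' : (eta / w) ^+ 2 * gauss a eta <= gauss (a / 2) eta.
  by apply: le_trans S' _; rewrite ler_piMl ?gauss_ge0.
have : eps * ((eta / w) ^+ 2 * gauss a eta) <= eps * gauss (a / 2) eta by rewrite ler_wpM2l.
by lra.
Qed.

(** Expand the phase around the m-th frequency: its value there is th0 up to an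
    integer and an error eps, the linear coefficient is x + 2 t (lam m) and the
    quadratic one is t. If all of these are small on the scale w of one bump,
    then all M bumps contribute with the same sign after rotation by th0. *)
Lemma wave_evolution_lower (w : R) M (lam : nat -> R) (x t th0 eps : R) :
  0 < w -> 0 <= eps ->
  (forall m, (m < M)%N -> exists (k : int) (e : R),
     x * lam m + t * lam m ^+ 2 = th0 + k%:~R + e /\ `|e| <= eps) ->
  (forall m, (m < M)%N -> `|x + 2 * t * lam m| * w <= eps) ->
  `|t| * w ^+ 2 <= eps ->
  let h := fun xi => polar (wave_hat w M lam xi) (2 * pi * (x * xi + t * xi ^+ 2)) in
  cintegrable1 h /\ (1 - 40 * eps) * (M%:R * w) <= Normc.normc (cint1 h).
Proof.
move=> w0 eps0 ph1 ph2 ph3 h.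
pose a := pi / w ^+ 2 : R.
have a0 : 0 < a by rewrite divr_gt0 ?pi_gt0// exprn_gt0.
pose phi (xi : R) := 2 * pi * (x * xi + t * xi ^+ 2).
have cphi : continuous phi.
  move=> z; apply: cvgM; first exact: cvg_cst.
  apply: cvgD; apply: cvgM; try exact: cvg_cst; first exact: cvg_id.
  exact: exprn_continuous.
have mcos b : measurable_fun setT (fun xi => cos (phi xi - b)).
  apply: (@continuous_measurable_fun R (fun xi => cos (phi xi - b))) => z.
  apply: (@continuous_comp _ _ _ (fun xi => phi xi - b) (@cos R)); last exact: continuous_cos.
  by apply: cvgB; [exact: cphi|exact: cvg_cst].
have Ih b : leb.-integrable setT (EFin \o (fun xi => wave_hat w M lam xi * cos (phi xi - b))).
  apply: (@le_integrable _ _ _ leb setT measurableT _ (EFin \o wave_hat w M lam)).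
  - apply/measurable_EFinP; apply: measurable_funM; last exact: mcos.
    exact: (integrable_measurable (integrable_wave_hat M lam w0)).
  - move=> xi _ /=; rewrite lee_fin normrM ler_piMr//.
    exact: normr_cos_le1.
  - exact: integrable_wave_hat.
have hR : (fun xi => complex.Re (h xi)) = (fun xi => wave_hat w M lam xi * cos (phi xi - 0)).
  by apply/funext => xi; rewrite subr0.
have hI : (fun xi => complex.Im (h xi)) = (fun xi => wave_hat w M lam xi * cos (phi xi - pi / 2)).
  by apply/funext => xi; rewrite cosBpihalf.
split; first by split; rewrite ?hR ?hI; exact: Ih.
apply: le_trans (Re_rot_le_normc _ (2 * pi * th0)); rewrite /= hR hI.
rewrite -!RintegralZr//.
rewrite -RintegralD//; last 2 first.
- by rewrite /comp; under eq_fun do rewrite EFinM; apply: integrableZr => //; exact: Ih.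
- by rewrite /comp; under eq_fun do rewrite EFinM; apply: integrableZr => //; exact: Ih.
have E xi : wave_hat w M lam xi * cos (phi xi - 0) * cos (2 * pi * th0) +
    wave_hat w M lam xi * cos (phi xi - pi / 2) * sin (2 * pi * th0) =
    wave_hat w M lam xi * cos (phi xi - 2 * pi * th0).
  by rewrite subr0 cosBpihalf cosB; ring.
under eq_Rintegral do rewrite E.
pose g m (xi : R) := (1 - 16 * eps) * gauss a (xi - lam m) - 16 * eps * gauss (a / 2) (xi - lam m).
have a20 : 0 < a / 2 by rewrite divr_gt0.
have J c b m : 0 < b -> leb.-integrable setT (EFin \o (fun xi => c * gauss b (xi - lam m))).
  move=> b0; rewrite /comp; under eq_fun do rewrite EFinM.
  by apply: integrableZl => //; have [] := integral_gauss_shift (lam m) b0.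
have Ig m : leb.-integrable setT (EFin \o g m).
  rewrite (_ : _ \o _ = (fun xi => ((1 - 16 * eps) * gauss a (xi - lam m))%:E) \-
    (fun xi => (16 * eps * gauss (a / 2) (xi - lam m))%:E))%E//.
  by apply: integrableB => //; exact: J.
have pi4 : pi < 4 :> R by have := @pihalf_lt2 R; lra.
have eg m : (\int[leb]_xi g m xi)%R >= (1 - 40 * eps) * w.
  rewrite RintegralB//; [|exact: J|exact: J].
  have [i1 e1] := integral_gauss_shift (lam m) a0.
  have [i2 e2] := integral_gauss_shift (lam m) a20.
  rewrite !RintegralZl// e1 e2.
  have -> : pi / a = w ^+ 2 by rewrite /a invf_div mulrCA divff ?mulr1// gt_eqF// pi_gt0.
  have -> : pi / (a / 2) = 2 * w ^+ 2.
    by rewrite invf_div mulrCA /a invf_div [pi * _]mulrC divfK// gt_eqF// pi_gt0.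
  rewrite (@sqrtrM _ 2 (w ^+ 2))// sqrtr_sqr (ger0_norm (ltW w0)).
  have s2 : Num.sqrt 2 <= 3 / 2 :> R.
    rewrite -[3 / 2]ger0_norm// -sqrtr_sqr ler_sqrt ?sqr_ge0// expr_div_n; lra.
  have : eps * w * Num.sqrt 2 <= eps * w * (3 / 2) by rewrite ler_wpM2l// mulr_ge0// ltW.
  by lra.
have -> : (1 - 40 * eps) * (M%:R * w) = \sum_(m < M) (1 - 40 * eps) * w.
  by rewrite sumr_const card_ord -mulr_natl; ring.
apply: (@le_trans _ _ (\sum_(m < M) (\int[leb]_xi g m xi)%R)).
  by apply: ler_sum => m _; exact: eg.
rewrite -Rintegral_bigsum => [|m]; last exact: Ig.
apply: le_Rintegral => //.
  by apply: integrable_bigsum => m; exact: Ig.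
move=> xi _; rewrite mulr_suml; apply: ler_sum => m _.
set eta := xi - lam m.
have [k [e [he1 he2]]] := ph1 m (ltn_ord m).
have -> : phi xi - 2 * pi * th0 =
    2 * pi * (k%:~R + (e + (x + 2 * t * lam m) * eta + t * eta ^+ 2)).
  have -> : th0 = x * lam m + t * lam m ^+ 2 - k%:~R - e by rewrite he1; ring.
  by rewrite /phi /eta; ring.
rewrite cos_shift_int.
exact: gauss_cos_lower (ph2 _ (ltn_ord m)) ph3.
Qed.

End coherent.

Section wave_energy.
Context {R : realType}.
Local Notation leb := (@lebesgue_measure R).

Lemma sum_geometric_le (rho : R) n : 0 <= rho < 1 ->
  \sum_(i < n) rho ^+ i <= (1 - rho)^-1.
Proof.
move=> /andP[r0 r1]; rewrite -[leRHS]mul1r ler_pdivlMr ?subr_gt0//.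
rewrite mulrC -opprB mulNr -subrX1 opprB gerBl exprn_ge0//.
Qed.

Lemma sum_geometric_dist_le (rho : R) n m : 0 <= rho < 1 ->
  \sum_(j < n) rho ^+ ((m - j) + (j - m)) <= 2 / (1 - rho).
Proof.
move=> r01; have [r0 r1] := andP r01.
have H : \sum_(j < n) rho ^+ ((m - j) + (j - m)) <= \sum_(0 <= j < m + n) rho ^+ ((m - j) + (j - m)).
  rewrite -(big_mkord xpredT (fun j => rho ^+ ((m - j) + (j - m)))).
  rewrite [leRHS](big_cat_nat _ (n := n)) ?leq_addl//=.
  by rewrite lerDl; apply: sumr_ge0 => j _; rewrite exprn_ge0.
apply: le_trans H _.
rewrite (big_cat_nat _ (n := m)) ?leq_addr//= mulr_natl mulr2n.
apply: lerD.
  rewrite big_nat_rev /= add0n big_mkord.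
  apply: le_trans (sum_geometric_le m r01); apply: ler_sum => i _.
  have im := ltn_ord i.
  rewrite (_ : (_ + _)%N = i.+1); last by lia.
  by rewrite exprS ler_piMl ?exprn_ge0// ltW.
rewrite -{1}(add0n m) big_addn addKn big_mkord.
apply: le_trans (sum_geometric_le n r01); apply: ler_sum => i _.
by rewrite (_ : (_ + _)%N = i)//; lia.
Qed.

(** The geometric series in exp (- pi / 8) sums the interactions between bumps. *)
Definition energy_const (s : R) : R :=
  4 * expR (2 * s) / (1 - expR (- (pi / 8))) .

(** Two bumps at distance d overlap by a factor exponentially small in d / w, so
    the square of the sum behaves like the sum of the squares. The weight
    exp (s (xi / N)^2) replaces (1 + |xi|^2)^s because it splits into a product
    over coordinates; since w is small compared with N, it costs only part of
    the Gaussian decay. *)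
Lemma wave_hat_energy (w : R) M (lam : nat -> R) (N s : R) :
  0 < w -> 0 < N -> 0 <= s -> (forall m, (m < M)%N -> `|lam m| <= N) ->
  (forall m k, (m < M)%N -> (k < M)%N ->
     w * ((m - k) + (k - m))%N%:R <= `|lam m - lam k|) ->
  4 * s * w ^+ 2 <= pi * N ^+ 2 ->
  leb.-integrable setT
    (EFin \o (fun xi => expR (s * (xi / N) ^+ 2) * wave_hat w M lam xi ^+ 2)) /\
  (\int[leb]_xi (expR (s * (xi / N) ^+ 2) * wave_hat w M lam xi ^+ 2) <=
   energy_const s * (M%:R * w))%R.
Proof.
move=> w0 N0 s0 lamN sep sw.
pose a := pi / w ^+ 2 : R; pose rho := expR (- (pi / 8)) : R.
have a0 : 0 < a by rewrite divr_gt0 ?pi_gt0// exprn_gt0.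
have r01 : 0 <= rho < 1.
  by rewrite expR_ge0/= expR_lt1 oppr_lt0 divr_gt0 ?pi_gt0.
have [r0 r1] := andP r01.
have sa : s / N ^+ 2 <= a / 4.
  rewrite ler_pdivrMr ?exprn_gt0// /a mulrAC -mulrA mulrAC.
  by rewrite ler_pdivlMr ?exprn_gt0//; lra.
pose G xi := expR (2 * s) * (2 / (1 - rho)) * \sum_(m < M) gauss (a / 4) (xi - lam m).
have pt (xi : R) : expR (s * (xi / N) ^+ 2) * wave_hat w M lam xi ^+ 2 <= G xi.
  rewrite [wave_hat _ _ _ _ ^+ 2]expr2 /wave_hat mulr_suml mulr_sumr /G mulr_sumr.
  apply: ler_sum => m _; rewrite !mulr_sumr.
  apply: (@le_trans _ _ (\sum_(k < M) expR (2 * s) * gauss (a / 4) (xi - lam m) *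
      rho ^+ ((m - k) + (k - m)))); last first.
    rewrite -mulr_sumr [leRHS]mulrAC ler_wpM2l ?mulr_ge0 ?expR_ge0//.
    exact: sum_geometric_dist_le.
  apply: ler_sum => k _; rewrite /rho -expRM_natl /gauss -!expRD ler_expR -/a.
  have [mM kM] := (ltn_ord m, ltn_ord k).
  set d := ((m - k) + (k - m))%N.
  set u := xi - lam m; set v := xi - lam k.
  have h1 : s * (xi / N) ^+ 2 <= 2 * s + a / 2 * u ^+ 2.
    have -> : xi = lam m + u by rewrite /u; ring.
    rewrite expr_div_n mulrCA mulrC.
    have l2 : (lam m) ^+ 2 <= N ^+ 2.
      by rewrite -(real_normK (num_real (lam m))) lerXn2r ?nnegrE ?normr_ge0 ?lamN// ltW.
    apply: (@le_trans _ _ (s / N ^+ 2 * (2 * N ^+ 2 + 2 * u ^+ 2))).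
      rewrite ler_wpM2l ?divr_ge0 ?sqr_ge0//.
      have : 0 <= (lam m - u) ^+ 2 by rewrite sqr_ge0.
      by nra.
    rewrite mulrDr lerD//.
      by rewrite mulrCA divfK ?gt_eqF ?exprn_gt0// lexx.
    by rewrite mulrA ler_wpM2r ?sqr_ge0//; lra.
  have h2 : pi / 8 * d%:R <= a / 8 * (u - v) ^+ 2.
    have dd : d%:R <= d%:R ^+ 2 :> R by rewrite -natrX ler_nat; case: (d) => // e; rewrite expnS expn1 leq_pmulr.
    have hs := sep m k mM kM.
    have e : (u - v) ^+ 2 = `|lam m - lam k| ^+ 2.
      by rewrite real_normK ?num_real// -sqrrN /u /v; congr (_ ^+ 2); ring.
    have h3 : w ^+ 2 * d%:R <= (u - v) ^+ 2.
      rewrite e; apply: (@le_trans _ _ ((w * d%:R) ^+ 2)).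
        by rewrite exprMn ler_wpM2l ?sqr_ge0.
      by rewrite lerXn2r ?nnegrE ?normr_ge0 ?mulr_ge0 ?ler0n ?(ltW w0).
    have -> : pi / 8 * d%:R = a / 8 * (w ^+ 2 * d%:R).
      by rewrite /a; field; rewrite gt_eqF.
    by rewrite ler_wpM2l// divr_ge0// ltW.
  have h4 : a / 8 * (u - v) ^+ 2 <= a / 4 * (u ^+ 2 + v ^+ 2).
    have -> : a / 4 * (u ^+ 2 + v ^+ 2) = a / 8 * (u - v) ^+ 2 + a / 8 * (u + v) ^+ 2 by field.
    by rewrite lerDl mulr_ge0 ?sqr_ge0// divr_ge0// ltW.
  have h5 : 0 <= a * v ^+ 2 by rewrite mulr_ge0 ?sqr_ge0// ltW.
  by lra.
have IG : leb.-integrable setT (EFin \o G).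
  rewrite /comp /G; under eq_fun do rewrite EFinM.
  apply: integrableZl => //; apply: integrable_bigsum => m.
  by have [] := integral_gauss_shift (lam m) (divr_gt0 a0 (ltr0n _ 4)).
have I : leb.-integrable setT
    (EFin \o (fun xi => expR (s * (xi / N) ^+ 2) * wave_hat w M lam xi ^+ 2)).
  apply: (@le_integrable _ _ _ leb setT measurableT _ (EFin \o G)) => //.
    apply/measurable_EFinP; apply: measurable_funM.
      rewrite (_ : (fun xi => _) = gauss (- (s / N ^+ 2))); first exact: measurable_gauss.
      by apply/funext => xi; rewrite /gauss expr_div_n; congr expR; ring.
    apply: measurable_funX.
    exact: (integrable_measurable (integrable_wave_hat M lam w0)).
  move=> xi _ /=; rewrite lee_fin [leLHS]ger0_norm ?(mulr_ge0 (expR_ge0 _) (sqr_ge0 _))//.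
  by apply: le_trans (pt xi) (ler_norm _).
split => //.
apply: (@le_trans _ _ (\int[leb]_xi G xi)%R).
  by apply: le_Rintegral => // xi _; exact: pt.
rewrite /G RintegralZl//; last first.
  apply: integrable_bigsum => m.
  by have [] := integral_gauss_shift (lam m) (divr_gt0 a0 (ltr0n _ 4)).
rewrite Rintegral_bigsum => [|m]; last first.
  by have [] := integral_gauss_shift (lam m) (divr_gt0 a0 (ltr0n _ 4)).
have e (m : nat) : (\int[leb]_xi gauss (a / 4) (xi - lam m))%R = 2 * w.
  have [_ ->] := integral_gauss_shift (lam m) (divr_gt0 a0 (ltr0n _ 4)).
  have -> : pi / (a / 4) = (2 * w) ^+ 2.
    rewrite invf_div mulrCA /a invf_div [pi * _]mulrC divfK ?gt_eqF ?pi_gt0//.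
    by ring.
  by rewrite sqrtr_sqr ger0_norm// mulr_ge0// ltW.
under eq_bigr do rewrite e.
rewrite sumr_const card_ord -(mulr_natl (2 * w)) /energy_const -/rho.
rewrite le_eqVlt; apply/orP; left; apply/eqP; ring.
Qed.

End wave_energy.

(** * A class of Schwartz functions *)

Section schwartz_class.
Context {R : realType} {n : nat}.
Implicit Types (g h : 'rV[R]_n -> R) (u : R -> R) (x : 'rV[R]_n).

Lemma coord_comp_derive u (du : R -> R) (i j : 'I_n) x :
  (forall y : R, is_derive y 1 u (du y)) ->
  differentiable (fun x => u (x ord0 i)) x /\
  'D_(delta_mx ord0 j) (fun x => u (x ord0 i)) x = du (x ord0 i) * (i == j)%:R.
Proof.
move=> hu.
have dc : differentiable (fun x : 'rV[R]_n => x ord0 i) x by exact: differentiable_coord.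
have dux : differentiable u (x ord0 i).
  by apply/derivable1_diffP; have [] := hu (x ord0 i).
have dd : differentiable (u \o (fun x : 'rV[R]_n => x ord0 i)) x.
  exact: differentiable_comp.
split; first exact: dd.
rewrite -[fun _ => _]/(u \o (fun x : 'rV[R]_n => x ord0 i)) deriveE// diff_comp//=.
rewrite diff1E// derive1E; have [_ ->] := hu (x ord0 i).
rewrite -deriveE//.
suff -> : 'D_(delta_mx ord0 j) (fun x : 'rV[R]_n => x ord0 i) x = (i == j)%:R.
  by rewrite /GRing.scale /= mulrC.
rewrite /derive.
rewrite (_ : (fun _ => _) = (fun h : R => h^-1 * (h * (i == j)%:R))); last first.
  by apply/funext => h; rewrite /= !mxE eqxx /= addrK.
apply/cvg_lim => //; apply: cvg_near_cst.
by near=> h; rewrite mulKf//; near: h; exact: nbhs_dnbhs_neq.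
Unshelve. all: end_near. Qed.

(** Contains the factors of the test data other than the Gaussian and is closed
    under partial derivatives; an induction over it replaces formulas for the
    iterated derivatives. *)
Inductive trigpoly : ('rV[R]_n -> R) -> Prop :=
| trigpoly_cst c : trigpoly (fun => c)
| trigpoly_coord i : trigpoly (fun x => x ord0 i)
| trigpoly_cos b p i : trigpoly (fun x => cos (b * x ord0 i + p))
| trigpolyD g h : trigpoly g -> trigpoly h -> trigpoly (g + h)
| trigpolyM g h : trigpoly g -> trigpoly h -> trigpoly (g * h).

Lemma trigpoly_differentiable g : trigpoly g -> forall x, differentiable g x.
Proof.
elim=> {g} [c|i|b p i|g h _ dg _ dh|g h _ dg _ dh] x.
- exact: differentiable_cst.
- exact: differentiable_coord.
- by have [] := coord_comp_derive i i x (is_derive_cosM b p).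
- exact: differentiableD.
- exact: differentiableM.
Qed.

Lemma trigpoly_derive g (j : 'I_n) : trigpoly g ->
  trigpoly (fun x => 'D_(delta_mx ord0 j) g x).
Proof.
have sum2 := trigpolyD; have mul2 := trigpolyM.
elim=> {g} [c|i|b p i|g h tg dg th dh|g h tg dg th dh].
- rewrite [X in trigpoly X](_ : _ = (fun=> 0)); first exact: trigpoly_cst.
  by apply/funext => x; rewrite derive_cst.
- rewrite [X in trigpoly X](_ : _ = (fun=> (i == j)%:R)); first exact: trigpoly_cst.
  apply/funext => x.
  by have [_ ->] := @coord_comp_derive id (cst 1) i j x (fun y => is_derive_id y 1); rewrite mul1r.
- rewrite [X in trigpoly X](_ : _ = (fun=> - b * (i == j)%:R) * (fun x => cos (b * x ord0 i + (p - pi / 2)))).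
    by apply: trigpolyM; [exact: trigpoly_cst|exact: trigpoly_cos].
  apply/funext => x; have [_ ->] := coord_comp_derive i j x (is_derive_cosM b p).
  by rewrite fctE addrA cosBpihalf; ring.
- rewrite [X in trigpoly X](_ : _ = (fun x => 'D_(delta_mx ord0 j) g x) + (fun x => 'D_(delta_mx ord0 j) h x)).
    exact: trigpolyD.
  by apply/funext => x; rewrite deriveD//; apply: diff_derivable; exact: trigpoly_differentiable.
- rewrite [X in trigpoly X](_ : _ = g * (fun x => 'D_(delta_mx ord0 j) h x) + h * (fun x => 'D_(delta_mx ord0 j) g x)).
    by apply: trigpolyD; apply: trigpolyM.
  by apply/funext => x; rewrite deriveM//; apply: diff_derivable; exact: trigpoly_differentiable.
Qed.

Lemma dot_ge0 x : 0 <= dot x x.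
Proof. by apply: sumr_ge0 => i _; rewrite -expr2 sqr_ge0. Qed.

Lemma enorm_ge0 x : 0 <= enorm x. Proof. exact: sqrtr_ge0. Qed.

Lemma enorm_sqr x : enorm x ^+ 2 = \sum_i x ord0 i ^+ 2.
Proof. by rewrite sqr_sqrtr ?dot_ge0//; apply: eq_bigr => i _; rewrite expr2. Qed.

Lemma coord_le_enorm x i : `|x ord0 i| <= enorm x.
Proof.
rewrite -sqrtr_sqr ler_sqrt ?dot_ge0// /dot (bigD1 i)//= -expr2 lerDl.
by apply: sumr_ge0 => k _; rewrite -expr2 sqr_ge0.
Qed.

Lemma trigpoly_bound g : trigpoly g ->
  exists (C : R) (k : nat), 0 <= C /\ forall x, `|g x| <= C * (1 + enorm x) ^+ k.
Proof.
have e1 x : 1 <= 1 + enorm x by rewrite lerDl enorm_ge0.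
have e0 x : 0 <= 1 + enorm x by rewrite addr_ge0 ?enorm_ge0.
elim=> {g} [c|i|b p i|g h _ [C [k [C0 HC]]] _ [D [l [D0 HD]]]|g h _ [C [k [C0 HC]]] _ [D [l [D0 HD]]]].
- by exists `|c|, 0%N; split => // x; rewrite expr0 mulr1.
- exists 1, 1%N; split => // x; rewrite mul1r expr1.
  by rewrite (le_trans (coord_le_enorm x i))// lerDr.
- by exists 1, 0%N; split => // x; rewrite expr0 mulr1 normr_cos_le1.
- exists (C + D), (k + l)%N; split; first exact: addr_ge0.
  move=> x; rewrite (le_trans (ler_normD _ _))// mulrDl lerD//.
    by rewrite (le_trans (HC x))// ler_wpM2l// ler_weXn2l// leq_addr.
  by rewrite (le_trans (HD x))// ler_wpM2l// ler_weXn2l// leq_addl.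
- exists (C * D), (k + l)%N; split; first exact: mulr_ge0.
  move=> x; rewrite normrM exprD.
  by rewrite (le_trans (ler_pM _ _ (HC x) (HD x)))// mulrACA.
Qed.

Variable a : 'I_n -> R.
Hypothesis a0 : forall i, 0 < a i.

Definition gaussn x : R := \prod_i gauss (a i) (x ord0 i).

Lemma gaussn_differentiable x : differentiable gaussn x.
Proof.
rewrite (_ : gaussn = \prod_i (fun x => gauss (a i) (x ord0 i))); last first.
  by apply/funext => y; rewrite fct_prodE.
elim/big_ind: _ => [|g h dg dh|i _]; first exact: differentiable_cst.
  exact: differentiableM.
by have [] := coord_comp_derive i i x (is_derive_gauss (a i)).
Qed.

Lemma gaussn_derive (j : 'I_n) x :
  'D_(delta_mx ord0 j) gaussn x = - (2 * a j * x ord0 j) * gaussn x.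
Proof.
pose c i := (fun x : 'rV[R]_n => gauss (a i) (x ord0 i)).
have dfc i : differentiable (c i) x by have [] := coord_comp_derive i i x (is_derive_gauss (a i)).
rewrite (_ : gaussn = c j * \prod_(i | i != j) c i); last first.
  by apply/funext => y; rewrite /gaussn fctE fct_prodE (bigD1 j).
have dP : differentiable (\prod_(i | i != j) c i) x.
  elim/big_ind: _ => [|g h dg dh|i _]; [exact: differentiable_cst|exact: differentiableM|exact: dfc].
rewrite deriveM; [|exact: diff_derivable|exact: diff_derivable].
have -> : 'D_(delta_mx ord0 j) (\prod_(i | i != j) c i) x = 0.
  suff [] : differentiable (\prod_(i | i != j) c i) x /\
    'D_(delta_mx ord0 j) (\prod_(i | i != j) c i) x = 0 by [].
  elim/big_ind: _ => [|g h [dg eg] [dh eh]|i ij].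
  - by split; [exact: differentiable_cst|rewrite derive_cst].
  - split; first exact: differentiableM.
    by rewrite deriveM ?eg ?eh ?scaler0 ?addr0//; exact: diff_derivable.
  - split; first exact: dfc.
    by have [_ ->] := coord_comp_derive i j x (is_derive_gauss (a i)); rewrite (negbTE ij) mulr0.
have [_ ->] := coord_comp_derive j j x (is_derive_gauss (a j)).
rewrite eqxx scaler0 add0r mulr1 /GRing.scale /= fctE /c; ring.
Qed.

(** A partial derivative of a product g * gaussn is again such a product, since
    the logarithmic derivative of the Gaussian is a multiple of a coordinate. *)
Lemma partials_trigpoly_gaussn (l : seq 'I_n) g : trigpoly g ->
  exists2 h, trigpoly h & partials l (fun x => g x * gaussn x) = (fun x => h x * gaussn x).
Proof.
move=> tg; elim: l => [|j l [h th IH]]; first by exists g.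
exists ((fun x => 'D_(delta_mx ord0 j) h x) +
  (fun=> - (2 * a j)) * (fun x => x ord0 j) * h).
  apply: trigpolyD; first exact: trigpoly_derive.
  by apply: trigpolyM => //; apply: trigpolyM; [exact: trigpoly_cst|exact: trigpoly_coord].
rewrite /= IH; apply/funext => x.
rewrite -[fun x => _]/(h * gaussn) deriveM; last 2 first.
- exact/diff_derivable/trigpoly_differentiable.
- exact/diff_derivable/gaussn_differentiable.
by rewrite gaussn_derive /GRing.scale /= !fctE; ring.
Qed.

(** Completing the square in k |x| - c |x|^2, where c is the least of the a i. *)
Lemma gaussn_decay k : exists C : R, forall x, (1 + enorm x) ^+ k * gaussn x <= C.
Proof.
have [c c0 ca] : exists2 c : R, 0 < c & forall i, c <= a i.
  exists (\big[Num.min/1]_i a i).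
    by elim/big_ind: _ => // u v u0 v0; rewrite lt_min u0.
  by move=> i; rewrite (bigminD1 i)// ge_min lexx.
have gx x : gaussn x <= expR (- (c * enorm x ^+ 2)).
  rewrite /gaussn /gauss -expR_sum ler_expR enorm_sqr mulr_sumr -sumrN.
  by apply: ler_sum => i _; rewrite lerN2 ler_wpM2r ?sqr_ge0.
pose D : R := k%:R ^+ 2 / (4 * c).
exists (expR D).
move=> x; have y0 := enorm_ge0 x.
have h1 : (1 + enorm x) ^+ k <= expR (k%:R * enorm x).
  rewrite expRM_natl lerXn2r ?nnegrE ?expR_ge0 ?addr_ge0//; exact: expR_ge1Dx.
apply: (@le_trans _ _ (expR (k%:R * enorm x) * expR (- (c * enorm x ^+ 2)))).
  apply: ler_pM => //; first by rewrite exprn_ge0// addr_ge0.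
  by rewrite /gaussn prodr_ge0// => i _; exact: gauss_ge0.
rewrite -expRD ler_expR /D ler_pdivlMr ?mulr_gt0//.
have : 0 <= (2 * c * enorm x - k%:R) ^+ 2 by rewrite sqr_ge0.
by lra.
Qed.

Lemma schwartz_trigpoly_gaussn g : trigpoly g -> schwartz_real (fun x => g x * gaussn x).
Proof.
move=> tg l; have [h th ->] := partials_trigpoly_gaussn l tg.
split=> [x|k].
  rewrite -[fun x => _]/(h * gaussn).
  by apply: differentiableM; [exact: trigpoly_differentiable|exact: gaussn_differentiable].
have [C [m [C0 HC]]] := trigpoly_bound th.
have [D HD] := gaussn_decay (k + m).
exists (C * D) => x.
have g0 : 0 <= gaussn x by rewrite /gaussn prodr_ge0// => i _; exact: gauss_ge0.
rewrite normrM (ger0_norm g0).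
apply: (@le_trans _ _ ((1 + enorm x) ^+ k * (C * (1 + enorm x) ^+ m * gaussn x))).
  apply: ler_pM; rewrite ?exprn_ge0 ?enorm_ge0 ?mulr_ge0//.
    by rewrite lerXn2r ?nnegrE ?addr_ge0 ?enorm_ge0// lerDr.
  by rewrite ler_wpM2r.
rewrite [leLHS](_ : _ = C * ((1 + enorm x) ^+ (k + m) * gaussn x)); last by rewrite exprD; ring.
by rewrite ler_wpM2l.
Qed.

End schwartz_class.

(** * Tensor products of waves *)

Section wave_packet.
Context {R : realType} {n : nat}.
Local Notation leb := (@lebesgue_measure R).
Variables (w : 'I_n -> R) (M : 'I_n -> nat) (lam : 'I_n -> nat -> R).
Hypothesis w0 : forall i, 0 < w i.

Definition wave_packet (x : 'rV[R]_n) : R[i] :=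
  \prod_i wave (w i) (M i) (lam i) (x ord0 i).

Definition ctrigpoly (z : 'rV[R]_n -> R[i]) :=
  trigpoly (fun x => complex.Re (z x)) /\ trigpoly (fun x => complex.Im (z x)).

Lemma ctrigpolyM y z : ctrigpoly y -> ctrigpoly z -> ctrigpoly (fun x => y x * z x).
Proof.
move=> [yR yI] [zR zI]; split.
- rewrite [X in trigpoly X](_ : _ = (fun x => complex.Re (y x)) * (fun x => complex.Re (z x)) +
      (fun=> -1) * ((fun x => complex.Im (y x)) * (fun x => complex.Im (z x)))).
    by apply: trigpolyD; do ?apply: trigpolyM => //; exact: trigpoly_cst.
  by apply/funext => x; rewrite !fctE mulN1r; case: (y x); case: (z x).
- rewrite [X in trigpoly X](_ : _ = (fun x => complex.Re (y x)) * (fun x => complex.Im (z x)) +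
      (fun x => complex.Im (y x)) * (fun x => complex.Re (z x))).
    by apply: trigpolyD; do ?apply: trigpolyM.
  by apply/funext => x; rewrite !fctE; case: (y x); case: (z x).
Qed.

Lemma trigpoly_sum I (s : seq I) (g : I -> 'rV[R]_n -> R) :
  (forall i, trigpoly (g i)) -> trigpoly (fun x => \sum_(i <- s) g i x).
Proof.
move=> tg; elim: s => [|i s IH].
  rewrite [X in trigpoly X](_ : _ = (fun=> 0)); first exact: trigpoly_cst.
  by apply/funext => x; rewrite big_nil.
rewrite [X in trigpoly X](_ : _ = g i + (fun x => \sum_(i <- s) g i x)).
  exact: trigpolyD.
by apply/funext => x; rewrite big_cons.
Qed.

Lemma wave_packet_schwartz : schwartz wave_packet.
Proof.
pose c i (x : 'rV[R]_n) : R[i] := \sum_(m < M i) polar (w i) (2 * pi * lam i m * x ord0 i).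
have tc i : ctrigpoly (c i).
  split.
    rewrite [X in trigpoly X](_ : _ = (fun x : 'rV[R]_n => \sum_(m < M i)
        ((fun=> w i) * (fun x : 'rV[R]_n => cos (2 * pi * lam i m * x ord0 i + 0))) x)).
      by apply: trigpoly_sum => m; apply: trigpolyM; [exact: trigpoly_cst|exact: trigpoly_cos].
    by apply/funext => x; rewrite Re_sum; apply: eq_bigr => m _; rewrite fctE addr0.
  rewrite [X in trigpoly X](_ : _ = (fun x : 'rV[R]_n => \sum_(m < M i)
      ((fun=> w i) * (fun x : 'rV[R]_n => cos (2 * pi * lam i m * x ord0 i + - (pi / 2)))) x)).
    by apply: trigpoly_sum => m; apply: trigpolyM; [exact: trigpoly_cst|exact: trigpoly_cos].
  by apply/funext => x; rewrite Im_sum; apply: eq_bigr => m _; rewrite fctE cosBpihalf.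
have tP : ctrigpoly (fun x => \prod_i c i x).
  elim: (index_enum _) => [|i s IH].
    rewrite (_ : (fun x => _) = (fun=> 1)); last first.
      by apply/funext => x; rewrite big_nil.
    by split; exact: trigpoly_cst.
  rewrite (_ : (fun x => _) = (fun x => c i x * \prod_(i <- s) c i x)).
    exact: ctrigpolyM.
  by apply/funext => x; rewrite big_cons.
pose a i := pi * w i ^+ 2.
have a0 i : 0 < a i by rewrite mulr_gt0 ?pi_gt0// exprn_gt0.
have rM (r : R) (z : R[i]) : r%:C%C * z = ((r * complex.Re z) +i* (r * complex.Im z))%C.
  by case: z => p q; congr Complex; rewrite mul0r ?subr0 ?addr0.
have E x : wave_packet x = (gaussn a x)%:C%C * \prod_i c i x.
  rewrite /wave_packet /gaussn rmorph_prod -big_split/=; apply: eq_bigr => i _.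
  rewrite /wave mulr_sumr; apply: eq_bigr => m _.
  by rewrite rM /polar /=; congr Complex; rewrite [w i * _]mulrC mulrA.
have [tR tI] := tP.
split.
  rewrite (_ : (fun x => _) = (fun x => complex.Re (\prod_i c i x) * gaussn a x)).
    exact: schwartz_trigpoly_gaussn.
  by apply/funext => x; rewrite E rM /= mulrC.
rewrite (_ : (fun x => _) = (fun x => complex.Im (\prod_i c i x) * gaussn a x)).
  exact: schwartz_trigpoly_gaussn.
by apply/funext => x; rewrite E rM /= mulrC.
Qed.

Lemma wave_packet_fourier xi :
  fourier wave_packet xi = (\prod_i wave_hat (w i) (M i) (lam i) (xi ord0 i))%:C%C.
Proof.
rewrite /fourier.
pose h i (y : R) := wave (w i) (M i) (lam i) y * cis (- (2 * pi * (y * xi ord0 i))).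
rewrite (_ : (fun x => _) = (fun x : Rn R n => \prod_i h i ((x : 'rV[R]_n) ord0 i))); last first.
  apply/funext => x; rewrite big_split /=; congr (_ * _).
  by rewrite prod_cis /dot mulr_sumr -sumrN.
have H i := wave_fourier (M i) (lam i) (w0 i) (xi ord0 i).
have [_ _ ->] := cintegral_prod (fun i => (H i).1).
by rewrite rmorph_prod; apply: eq_bigr => i _; rewrite (H i).2.
Qed.

(** Both x . xi and |xi|^2 are sums over the coordinates, so the evolution of a
    tensor product is the tensor product of one-dimensional evolutions. *)
Lemma wave_packet_schroedinger (t : R) (x : 'rV[R]_n) :
  let h i (xi : R) := polar (wave_hat (w i) (M i) (lam i) xi)
                        (2 * pi * (x ord0 i * xi + t * xi ^+ 2)) in
  (forall i, cintegrable1 (h i)) ->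
  schroedinger t wave_packet x = \prod_i cint1 (h i).
Proof.
move=> h H; have [_ _ <-] := cintegral_prod H.
rewrite /schroedinger; congr cintegral; apply/funext => xi.
rewrite wave_packet_fourier.
rewrite (_ : dot x xi + _ = \sum_i (x ord0 i * xi ord0 i + t * xi ord0 i ^+ 2)); last first.
  by rewrite big_split /= enorm_sqr mulr_sumr.
rewrite mulr_sumr -prod_cis rmorph_prod -big_split/=; apply: eq_bigr => i _.
rewrite /h -[X in X * cis _](_ : polar (wave_hat (w i) (M i) (lam i) (xi ord0 i)) 0 = _).
  by rewrite polar_cis add0r.
by rewrite /polar cos0 sin0 mulr1 mulr0.
Qed.

(** The integral of a nonnegative function is a supremum over the simple
    functions below it, so the maximal function can be compared with an indicator
    function without a discussion of its measurability. *)
Lemma ge0_integral_mono d (T : measurableType d) (mu : {measure set T -> \bar R})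
    (f g : T -> \bar R) :
  (forall x, 0 <= f x)%E -> (forall x, f x <= g x)%E ->
  (\int[mu]_x f x <= \int[mu]_x g x)%E.
Proof.
move=> f0 fg; have g0 x : (0 <= g x)%E := le_trans (f0 x) (fg x).
rewrite !ge0_integralTE//; apply: le_ereal_sup => _ [h hf <-].
by exists h => // x; exact: le_trans (hf x) (fg x).
Qed.

(** From 1 + |xi|^2 <= N^2 (1 + |xi / N|^2) <= N^2 exp (|xi / N|^2), whose right
    side is a product over the coordinates. *)
Lemma sobolev_wave_packet (s N : R) :
  0 <= s -> 1 <= N -> 
  (forall i m, (m < M i)%N -> `|lam i m| <= N) ->
  (forall i m k, (m < M i)%N -> (k < M i)%N ->
     w i * ((m - k) + (k - m))%N%:R <= `|lam i m - lam i k|) ->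
  (forall i, 4 * s * w i ^+ 2 <= pi * N ^+ 2) ->
  (sobolev_norm2 s wave_packet <=
   (N `^ (2 * s) * \prod_i (energy_const s * ((M i)%:R * w i)))%:E)%E.
Proof.
move=> s0 N1 lamN sep ws; have N0 : 0 < N by exact: lt_le_trans N1.
pose e i (y : R) := expR (s * (y / N) ^+ 2) * wave_hat (w i) (M i) (lam i) y ^+ 2.
have He i := wave_hat_energy (w0 i) N0 s0 (lamN i) (sep i) (ws i).
have [Ie ee] := integral_prod (fun i => (He i).1).
apply: (@le_trans _ _ (\int[lebesgue_Rn n]_xi (N `^ (2 * s) * \prod_i e i ((xi : 'rV[R]_n) ord0 i))%:E)%E).
  apply: ge0_integral_mono => xi.
    by rewrite lee_fin mulr_ge0 ?powR_ge0// sqr_ge0.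
  rewrite lee_fin wave_packet_fourier normc_real; last first.
    by apply: prodr_ge0 => i _; exact: wave_hat_ge0.
  rewrite /e big_split /= [leRHS]mulrA -prodrXl ler_wpM2r//.
    by apply: prodr_ge0 => i _; exact: sqr_ge0.
  rewrite -expR_sum -mulr_sumr.
  set y := \sum_i _; have y0 : 0 <= y by apply: sumr_ge0 => i _; exact: sqr_ge0.
  have -> : N `^ (2 * s) * expR (s * y) = (N ^+ 2 * expR y) `^ s.
    rewrite powRM ?sqr_ge0 ?expR_ge0// -expRM [y * s]mulrC -powR_mulrn ?(ltW N0)//.
    by rewrite -powRrM.
  apply: ge0_ler_powR => //.
  - by rewrite nnegrE (addr_ge0 ler01 (sqr_ge0 _)).
  - by rewrite nnegrE (mulr_ge0 (sqr_ge0 _) (expR_ge0 _)).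
  apply: (@le_trans _ _ (N ^+ 2 * (1 + y))); last first.
    by rewrite ler_wpM2l ?sqr_ge0// expR_ge1Dx.
  have -> : enorm xi ^+ 2 = N ^+ 2 * y.
    rewrite enorm_sqr /y mulr_sumr; apply: eq_bigr => i _.
    by rewrite expr_div_n mulrCA divff ?mulr1// gt_eqF// exprn_gt0.
  by rewrite mulrDr mulr1 lerD2r expr_ge1// ltW.
under eq_integral do rewrite EFinM.
rewrite integralZl//=.
have fI := integrable_fin_num measurableT Ie.
rewrite -(fineK fI) -EFinM lee_fin ler_wpM2l ?powR_ge0//.
rewrite -[leLHS]/(Rintegral _ _ _) ee; apply: ler_prod => i _.
rewrite (He i).2 andbT; apply: Rintegral_ge0 => y _.
by rewrite mulr_ge0 ?expR_ge0 ?sqr_ge0.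
Qed.

End wave_packet.

(** * Digits, lattice points and boxes *)

Section digits.

(** The digits are reduced modulo q here, so that p may be any sequence of
    positions on a grid. *)
Fixpoint from_digits (q m : nat) (p : nat -> nat) : nat :=
  if m is m'.+1 then (from_digits q m' p + p m' %% q * q ^ m')%N else 0%N.

Lemma from_digits_lt q m p : (0 < q)%N -> (from_digits q m p < q ^ m)%N.
Proof.
move=> q0; elim: m => [|m IH] //=.
have := ltn_pmod (p m) q0; rewrite expnS; nia.
Qed.

Lemma from_digitsE q m p a j : (0 < q)%N -> (j < m)%N ->
  ((from_digits q m p + a * q ^ m) %/ q ^ j = p j %[mod q])%N.
Proof.
move=> q0; elim: m a => // m IH a; rewrite ltnS leq_eqVlt => /orP[/eqP->|jm] /=.
  rewrite -addnA expnS mulnA -mulnDl divnDMl ?expn_gt0 ?q0//.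
  by rewrite divn_small ?from_digits_lt// add0n addnC modnMDl modn_mod.
by rewrite -addnA expnS mulnA -mulnDl IH.
Qed.

End digits.

Section counting.
Context {R : realType}.

(** The integers within L of X lie in a window of length 2 L, so they inject into
    an interval of integers starting at the least of them. *)
Lemma count_near (K : nat) (X L : R) : 0 <= L ->
  \sum_(k < K) ((`|X - k%:R| <= L)%R%:R : R) <= Num.min K%:R (2 * L + 1).
Proof.
move=> L0; rewrite le_min; apply/andP; split.
  apply: (@le_trans _ _ (\sum_(k < K) 1)); last by rewrite sumr_const card_ord.
  by apply: ler_sum => k _; rewrite lern1 leq_b1.
pose S := [set k : 'I_K | `|X - k%:R| <= L]%SET.
have -> : \sum_(k < K) ((`|X - k%:R| <= L)%R%:R : R) = #|S|%:R.
  rewrite -sum1_card natr_sum [RHS]big_mkcond /=; apply: eq_bigr => k _.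
  by rewrite inE; case: (_ <= _).
have [/eqP S0|[k0 k0S]] := set_0Vmem S.
  by rewrite (eqP S0) cards0; lra.
have [k kS kmin] := arg_minnP (fun k : 'I_K => k : nat) k0S.
have key (i : 'I_K) : i \in S -> (i - k <= Num.truncn (2 * L))%N.
  move=> iS; rewrite truncn_ge_nat ?mulr_ge0// natrB ?kmin//.
  move: iS (kS : k \in S); rewrite !inE !ler_norml => /andP[a b] /andP[c d]; lra.
have inj : {in S &, injective (fun i : 'I_K => inord (i - k) : 'I_(Num.truncn (2 * L)).+1)}.
  move=> i j iS jS /(congr1 val); rewrite /= !inordK ?ltnS ?key// => e.
  by apply/val_inj => /=; have := kmin _ iS; have := kmin _ jS; move=> /= h1 h2; lia.
have := max_card (mem ((fun i : 'I_K => inord (i - k) : 'I_(Num.truncn (2 * L)).+1) @: S)).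
rewrite card_in_imset// card_ord => h.
apply: (@le_trans _ _ ((Num.truncn (2 * L)).+1)%:R); first by rewrite ler_nat.
by rewrite -natr1 lerD2r truncn_le mulr_ge0.
Qed.

End counting.

Section boxes.
Context {R : realType} {n : nat}.
Implicit Types (c h x : 'rV[R]_n) (hs : 'I_n -> R).

Definition box c (hs : 'I_n -> R) : set (Rn R n) :=
  [set y | forall i, `|(y : 'rV[R]_n) ord0 i - c ord0 i| <= hs i].

Definition around (c0 h0 : R) : set (measurableTypeR R) :=
  [set` `[c0 - h0, c0 + h0]].

Lemma aroundE (c0 h0 y : R) : around c0 h0 y <-> `|y - c0| <= h0.
Proof.
by rewrite /around /= in_itv/= ler_norml; split => /andP[H1 H2]; apply/andP; split; lra.
Qed.

Lemma boxE c hs : box c hs = [set y : 'rV[R]_n | forall i, around (c ord0 i) (hs i) (y ord0 i)].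
Proof.
by apply/seteqP; split => y /= H i; apply/aroundE; exact: H.
Qed.

Lemma measurable_box c hs : measurable (box c hs).
Proof.
rewrite (_ : box c hs = \bigcap_(i in [set: 'I_n])
  ((fun x : Rn R n => (x : 'rV[R]_n) ord0 i) @^-1` around (c ord0 i) (hs i))).
  apply: fin_bigcap_measurable; first exact: finite_finset.
  move=> i _; rewrite -[X in measurable X]setTI.
  by apply: measurable_coord => //; exact: measurable_itv.
by rewrite boxE; apply/seteqP; split => x /= H i; [move=> _|]; exact: H.
Qed.

Lemma measurable_eball x (rho : R) : measurable (eball x rho).
Proof.
have [r0|r0] := leP rho 0.
  rewrite (_ : eball x rho = set0)//; apply/seteqP; split => // y /=.
  by move=> /(le_lt_trans (enorm_ge0 _)) /lt_le_trans /(_ r0); rewrite ltxx.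
pose f (y : Rn R n) : measurableTypeR R := \sum_i ((y : 'rV[R]_n) ord0 i - x ord0 i) ^+ 2.
have mf : measurable_fun setT f.
  apply: measurable_sum => i; apply: measurable_funX; apply: measurable_funB => //.
  exact: measurable_coord.
rewrite (_ : eball x rho = f @^-1` [set` `]-oo, (rho ^+ 2)[]).
  by rewrite -[X in measurable X]setTI; apply: mf => //; exact: measurable_itv.
apply/seteqP; split => y /=; rewrite in_itv/= => H.
  rewrite (_ : f y = enorm ((y : 'rV[R]_n) - x) ^+ 2).
    by rewrite ltrXn2r// ?nnegrE ?enorm_ge0// ltW.
  by rewrite enorm_sqr; apply: eq_bigr => i _; rewrite !mxE.
rewrite /eball /= -(@ltr_pXn2r _ 2)// ?nnegrE ?enorm_ge0 ?(ltW r0)//.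
rewrite (_ : enorm _ ^+ 2 = f y)// enorm_sqr.
by apply: eq_bigr => i _; rewrite !mxE.
Qed.

Lemma eball_subset_box x (rho : R) : eball x rho `<=` box x (fun=> rho).
Proof.
move=> y /= yx i; apply: le_trans (ltW yx).
by have := coord_le_enorm ((y : 'rV[R]_n) - x) i; rewrite !mxE.
Qed.

Lemma lebesgue_around_setI (c0 h0 c1 h1 : R) : 0 <= h0 -> 0 <= h1 ->
  (lebesgue_measure (around c0 h0 `&` around c1 h1) <=
   (2 * Num.min h0 h1 * (`|c0 - c1| <= h0 + h1)%R%:R)%:E)%E.
Proof.
move=> h00 h10.
have lm (c h : R) : 0 <= h -> lebesgue_measure (around c h) = (2 * h)%:E.
  move=> hh; rewrite /around lebesgue_measure_itv/= lte_fin.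
  case: ifPn => [_|]; first by rewrite -EFinB; congr _%:E; ring.
  by rewrite -leNgt => H; congr _%:E; lra.
have ma (c h : R) : measurable (around c h) by exact: measurable_itv.
case: (boolP (`|c0 - c1| <= h0 + h1)) => [_|far].
  rewrite mulr1; have [h01|h10'] := leP h0 h1.
    rewrite -(lm c0)//; apply: le_measure; rewrite ?inE//; exact: measurableI.
  rewrite -(lm c1)//; apply: le_measure; rewrite ?inE//; exact: measurableI.
rewrite (_ : _ `&` _ = set0) ?measure0 ?mulr0//.
apply/seteqP; split => // y [/aroundE a /aroundE b]; exfalso; move/negP: far; apply.
have -> : c0 - c1 = (y - c1) - (y - c0) by ring.
by rewrite (le_trans (ler_normB _ _))// addrC lerD.
Qed.

Lemma lebesgue_box c hs : (forall i, 0 <= hs i) ->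
  lebesgue_Rn n (box c hs) = (\prod_i (2 * hs i))%:E.
Proof.
move=> h0; rewrite boxE.
have := @lebesgue_Rn_box R n (fun i => around (c ord0 i) (hs i)).
move=> ->; last by move=> i; exact: measurable_itv.
rewrite -prodEFin; apply: eq_bigr => i _.
rewrite /around lebesgue_measure_itv/= lte_fin.
have hi := h0 i.
case: ifPn => [_|]; first by rewrite -EFinB; congr _%:E; ring.
by rewrite -leNgt => H; congr _%:E; lra.
Qed.

Lemma lee_prod_nneg I (s : seq I) (F G : I -> \bar R) :
  (forall i, 0 <= F i <= G i)%E ->
  (\prod_(i <- s) F i <= \prod_(i <- s) G i)%E.
Proof.
move=> FG; suff /andP[] : (0 <= \prod_(i <- s) F i <= \prod_(i <- s) G i)%E by [].
elim/big_ind2: _ => [|x1 x2 y1 y2 /andP[a b] /andP[c d]|i _]; first by rewrite lee01 lexx.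
  by rewrite mule_ge0//= lee_pmul.
exact: FG.
Qed.

Lemma lebesgue_eball_box x (rho : R) c hs : 0 <= rho -> (forall i, 0 <= hs i) ->
  (lebesgue_Rn n (eball x rho `&` box c hs) <=
   (\prod_i (2 * Num.min rho (hs i) * (`|x ord0 i - c ord0 i| <= rho + hs i)%R%:R))%:E)%E.
Proof.
move=> r0 h0.
pose A i := around (x ord0 i) rho `&` around (c ord0 i) (hs i).
have mA i : measurable (A i) by apply: measurableI; exact: measurable_itv.
apply: (@le_trans _ _ (lebesgue_Rn n [set y : 'rV[R]_n | forall i, A i (y ord0 i)])).
  apply: le_measure; rewrite ?inE.
  - by apply: measurableI; [exact: measurable_eball|exact: measurable_box].
  - rewrite (_ : mkset _ = box x (fun=> rho) `&` box c hs).
      by apply: measurableI; exact: measurable_box.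
    rewrite !boxE; apply/seteqP; split => y /=; first by move=> H; split => i; have [] := H i.
    by move=> [H1 H2] i; split; [exact: H1|exact: H2].
  - move=> y [/eball_subset_box]; rewrite !boxE => H1 H2 i.
    by split; [exact: H1|exact: H2].
rewrite (lebesgue_Rn_box mA) -prodEFin; apply: lee_prod_nneg => i.
by rewrite measure_ge0/=; exact: lebesgue_around_setI.
Qed.

(** Boxes may overlap, and then count with multiplicity: this keeps upper bounds
    for the measure a plain sum over the boxes. *)
Lemma box_measure (I : finType) (d : R) (ctr : I -> 'rV[R]_n) hs : 0 <= d ->
  exists mu : {measure set (Rn R n) -> \bar R}, forall A,
    mu A = (\sum_i d%:E * lebesgue_Rn n (A `&` box (ctr i) hs))%E.
Proof.
move=> d0.
pose m_ (k : nat) : {measure set (Rn R n) -> \bar R} :=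
  if insub k is Some j then
    mscale (NngNum d0) (mrestr (lebesgue_Rn n) (measurable_box (ctr (enum_val (j : 'I_#|I|))) hs))
  else mzero.
exists (msum m_ #|I|) => A; rewrite /msum.
rewrite (reindex (@enum_val _ I)) /=; last exact/onW_bij/enum_val_bij.
by apply: eq_bigr => k _; rewrite /m_ valK.
Qed.

End boxes.

(** * Focusing data *)

Definition coord_cons T m (a : T) (b : 'I_m -> T) (i : 'I_m.+1) : T :=
  if unlift ord0 i is Some j then b j else a.

Lemma coord_cons0 T m (a : T) (b : 'I_m -> T) : coord_cons a b ord0 = a.
Proof. by rewrite /coord_cons unlift_none. Qed.

Lemma coord_consS T m (a : T) (b : 'I_m -> T) j : coord_cons a b (lift ord0 j) = b j.
Proof. by rewrite /coord_cons liftK. Qed.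

Lemma forall_ord_cons m (Q : 'I_m.+1 -> Prop) :
  Q ord0 -> (forall j, Q (lift ord0 j)) -> forall i, Q i.
Proof. by move=> Q0 QS i; case: (unliftP ord0 i) => [j ->|->]. Qed.

Section construction.
Context {R : realType}.
Variables (m q K P M : nat) (D N W dl : R).
Hypotheses (q0 : (0 < q)%N) (D1 : 1 <= D) (N1 : 1 <= N) (W1 : 1 <= W) (dl0 : 0 < dl).

Let D0 : 0 < D. Proof. exact: lt_le_trans D1. Qed.
Let N0 : 0 < N. Proof. exact: lt_le_trans N1. Qed.
Let W0 : 0 < W. Proof. exact: lt_le_trans W1. Qed.
Let qR0 : 0 < q%:R :> R. Proof. by rewrite ltr0n. Qed.

(** A peak is given by the number of a block of q^m successive times and by a
    position on a grid in each of the m transverse coordinates. *)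
Definition peak : finType := ('I_K * {ffun 'I_m -> 'I_P})%type.

Definition digit (z : peak) (j : nat) : nat :=
  if insub j is Some i then z.2 i : nat else 0%N.

(** The first m digits of the tick in base q are the grid positions modulo q, and
    the number of the block is the part above them. Every combination of a block
    with grid positions is therefore realised at one of K q^m times. *)
Definition tick (z : peak) : nat := (from_digits q m (digit z) + z.1 * q ^ m)%N.

Definition peak_time (z : peak) : R := (tick z)%:R / D ^+ 2.

(** The grid has mesh 1 / (D q). The correction by the lower digits of the tick is
    less than one mesh; it makes D times the coordinate congruent to
    tick * velocity modulo 1, see [peak_coordE]. *)
Definition peak_coord (z : peak) (j : 'I_m) : R :=
  ((z.2 j)%:R + (tick z %% q ^ j)%N%:R / (q ^ j)%:R) / (D * q%:R).

(** In the first coordinate the datum is a single packet, which travels with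
    velocity - 2 N. *)
Definition peak_center (z : peak) : 'rV[R]_m.+1 :=
  \row_i coord_cons (- (2 * N * peak_time z)) (peak_coord z) i.

Definition peak_size : 'I_m.+1 -> R := coord_cons (dl / W) (fun=> dl / N).

Definition widths : 'I_m.+1 -> R := coord_cons W (fun=> 1).
Definition numbers : 'I_m.+1 -> nat := coord_cons 1%N (fun=> M).
Definition velocity (j : 'I_m) : R := (q ^ j.+1)%:R^-1.

(** In a transverse coordinate the frequencies form a progression of step D,
    shifted by half the velocity so that the square in the phase is completed:
    at time k / D^2 and position x = (k0 + k v) / D, the frequency
    lam = D (l - v / 2) has phase
    x lam + t lam^2 = k0 l + k l^2 - (k0 v / 2 + k v^2 / 4),
    which modulo 1 does not depend on l. *)
Definition freqs : 'I_m.+1 -> nat -> R :=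
  coord_cons (fun=> N) (fun j l => D * (l%:R - velocity j / 2)).

Definition datum := wave_packet widths numbers freqs.

Lemma digit_ord z (j : 'I_m) : digit z j = z.2 j :> nat.
Proof. by rewrite /digit insubT //= => h; congr (_ (z.2 _)); exact: val_inj. Qed.

Lemma tick_lt z : (tick z < K * q ^ m)%N.
Proof.
apply: (@leq_trans (z.1.+1 * q ^ m)%N); last by rewrite leq_mul2r ltn_ord orbT.
by rewrite mulSn ltn_add2r from_digits_lt.
Qed.

(** Modulo 1, tick * velocity is determined by the lowest j + 1 digits of the
    tick. The digit at place j is the grid position modulo q, by [from_digitsE],
    and the lower ones make up the correction in [peak_coord]. *)
Lemma peak_coordE z (j : 'I_m) : exists k : int,
  D * peak_coord z j = k%:~R + (tick z)%:R * velocity j.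
Proof.
have qj0 : (q ^ j)%:R != 0 :> R by rewrite pnatr_eq0 -lt0n expn_gt0 q0.
have qn0 : q%:R != 0 :> R by rewrite gt_eqF.
have Dn0 : D != 0 by rewrite gt_eqF.
have e := from_digitsE (digit z) z.1 q0 (ltn_ord j).
rewrite -/(tick z) digit_ord in e.
set k := tick z in e *; set d := (k %/ q ^ j)%N in e.
exists ((z.2 j %/ q)%N%:Z - (d %/ q)%N%:Z).
have E1 : (z.2 j : nat)%:R = (z.2 j %/ q)%N%:R * q%:R + (d %% q)%N%:R :> R.
  by rewrite e -natrM -natrD -divn_eq.
have E2 : k%:R = ((d %/ q)%N%:R * q%:R + (d %% q)%N%:R) * (q ^ j)%:R + (k %% q ^ j)%N%:R :> R.
  by rewrite -natrM -natrD -divn_eq -natrM -natrD -divn_eq.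
rewrite /peak_coord /velocity -/k E1 [in RHS]E2 expnS natrM rmorphB /=.
by rewrite -!pmulrn; field; rewrite Dn0 qn0 qj0.
Qed.

Lemma velocity01 j : 0 <= velocity j <= 1.
Proof.
rewrite /velocity invr_ge0 ler0n/= invf_le1 ?ltr0n ?expn_gt0 ?q0//.
by rewrite ler1n expn_gt0 q0.
Qed.

Lemma freqs_le : (D * M%:R <= N) ->
  forall i l, (l < numbers i)%N -> `|freqs i l| <= N.
Proof.
move=> DM; apply: forall_ord_cons => [l _|j l].
  by rewrite /freqs coord_cons0 ger0_norm// ltW.
rewrite /numbers /freqs !coord_consS => lM.
have /andP[v0 v1] := velocity01 j.
apply: le_trans DM; rewrite normrM (gtr0_norm D0) ler_pM2l//.
have : l.+1%:R <= M%:R :> R by rewrite ler_nat.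
rewrite -natr1 => lM'; have l0 : 0 <= l%:R :> R by [].
by rewrite ler_norml; lra.
Qed.

Lemma freqs_sep i l k : (l < numbers i)%N -> (k < numbers i)%N ->
  widths i * ((l - k) + (k - l))%N%:R <= `|freqs i l - freqs i k|.
Proof.
move: i l k; apply: forall_ord_cons => [l k|j l k].
  rewrite /numbers coord_cons0 !ltnS !leqn0 => /eqP-> /eqP->.
  by rewrite subnn addn0 mulr0.
rewrite /widths /freqs !coord_consS mul1r => _ _.
have -> : D * (l%:R - velocity j / 2) - D * (k%:R - velocity j / 2) = D * (l%:R - k%:R) by ring.
rewrite normrM (gtr0_norm D0).
have -> : ((l - k) + (k - l))%N%:R = `|l%:R - k%:R| :> R.
  have [lk|kl] := leqP l k.
    have -> : (l - k)%N = 0%N by apply/eqP; rewrite subn_eq0.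
    by rewrite add0n natrB// distrC ger0_norm// subr_ge0 ler_nat.
  have -> : (k - l)%N = 0%N by apply/eqP; rewrite subn_eq0 ltnW.
  by rewrite addn0 natrB ?(ltnW kl)// ger0_norm// subr_ge0 ler_nat ltnW.
by rewrite ler_peMl.
Qed.

Hypothesis DM : D * M%:R <= N.
Hypothesis time_le : (K * q ^ m)%:R * (N + W ^+ 2) <= dl * D ^+ 2.
Hypothesis space_le : P%:R <= dl * (D * q%:R).

Lemma peak_time_ge0 z : 0 <= peak_time z.
Proof. by rewrite divr_ge0// sqr_ge0. Qed.

Lemma peak_time_le z : peak_time z * (N + W ^+ 2) <= dl.
Proof.
rewrite /peak_time mulrAC ler_pdivrMr ?exprn_gt0//; apply: le_trans time_le.
by rewrite ler_wpM2r ?addr_ge0 ?sqr_ge0 ?(ltW N0)// ler_nat ltnW// tick_lt.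
Qed.

Lemma peak_coord_bound z j : 0 <= peak_coord z j <= dl.
Proof.
have DqK : 0 < D * q%:R by rewrite mulr_gt0.
rewrite /peak_coord; apply/andP; split.
  by rewrite divr_ge0 ?(ltW DqK)// addr_ge0// divr_ge0.
rewrite ler_pdivrMr//; apply: le_trans space_le.
apply: (@le_trans _ _ ((z.2 j).+1)%:R); last by rewrite ler_nat.
rewrite -natr1 lerD2l ler_pdivrMr ?mul1r ?ltr0n ?expn_gt0 ?q0//.
by rewrite ler_nat ltnW// ltn_pmod// expn_gt0 q0.
Qed.

Lemma box_peak_le z (x : 'rV[R]_m.+1) :
  box (peak_center z) peak_size x -> forall i, `|x ord0 i| <= 3 * dl.
Proof.
have := peak_time_le z; have t0 := peak_time_ge0 z.
rewrite mulrDr => tl; have tW : 0 <= peak_time z * W ^+ 2 by rewrite mulr_ge0// sqr_ge0.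
move=> H; apply: forall_ord_cons => [|j].
  have := H ord0; rewrite !mxE /peak_size !coord_cons0.
  have dW : dl / W <= dl by rewrite ler_pdivrMr// ler_peMr// ltW.
  have tN : 0 <= peak_time z * N by rewrite mulr_ge0// ltW.
  have -> : 2 * N * peak_time z = 2 * (peak_time z * N) by ring.
  by rewrite !ler_norml => /andP[h1 h2]; apply/andP; split; lra.
have := H (lift ord0 j); rewrite !mxE /peak_size !coord_consS.
have /andP[c0 c1] := peak_coord_bound z j.
have dN : dl / N <= dl by rewrite ler_pdivrMr// ler_peMr// ltW.
by rewrite !ler_norml => /andP[h1 h2]; apply/andP; split; lra.
Qed.

(** At the centre of the box all the waves are in phase; on the box the phases
    move by O(dl), so [wave_evolution_lower] applies in every coordinate. *)
Lemma datum_large_at_peak z (x : 'rV[R]_m.+1) : 160 * dl <= 1 / 2 ->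
  box (peak_center z) peak_size x ->
  2^-1 ^+ m.+1 * (W * M%:R ^+ m) <= Normc.normc (schroedinger (peak_time z) datum x).
Proof.
move=> dlsmall xz.
set t := peak_time z.
have t0 : 0 <= t by exact: peak_time_ge0.
have tl : t * (N + W ^+ 2) <= dl by exact: peak_time_le.
have tN : t * N <= dl.
  by apply: le_trans tl; rewrite mulrDr lerDl mulr_ge0 ?sqr_ge0.
have tW : t * W ^+ 2 <= dl.
  by apply: le_trans tl; rewrite mulrDr lerDr mulr_ge0// ltW.
have t1 : t <= dl by apply: le_trans tN; rewrite ler_peMr.
have dN : dl / N <= dl by rewrite ler_pdivrMr// ler_peMr// ltW.
have lamN := freqs_le DM.
have w0 i : 0 < widths i.
  by move: i; apply: forall_ord_cons => [|j]; rewrite /widths ?coord_cons0 ?coord_consS.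
have eps0 : 0 <= 4 * dl by rewrite mulr_ge0// ltW.
have H i : let h := fun xi => polar (wave_hat (widths i) (numbers i) (freqs i) xi)
      (2 * pi * (x ord0 i * xi + t * xi ^+ 2)) in
   cintegrable1 h /\ (1 - 40 * (4 * dl)) * ((numbers i)%:R * widths i) <= Normc.normc (cint1 h).
  move: i; apply: forall_ord_cons => [|j].
    have := xz ord0; rewrite !mxE /peak_size !coord_cons0 opprK => x0.
    rewrite /widths /numbers /freqs !coord_cons0.
    apply: (@wave_evolution_lower _ W 1 (fun=> N) (x ord0 ord0) t
      (x ord0 ord0 * N + t * N ^+ 2)) => //.
    - by move=> l _; exists 0, 0; rewrite normr0 !addr0.
    - move=> l _; rewrite -ler_pdivlMr// [2 * t * N]mulrAC; apply: le_trans x0 _.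
      by rewrite ler_wpM2r ?invr_ge0 ?(ltW W0)//; lra.
    - by rewrite ger0_norm//; lra.
  have := xz (lift ord0 j); rewrite !mxE /peak_size !coord_consS => xj.
  have lj := lamN (lift ord0 j).
  rewrite /widths /numbers /freqs !coord_consS in lj *.
  have /andP[c0 c1] := peak_coord_bound z j.
  have [k0 ek] := peak_coordE z j.
  set y := x ord0 (lift ord0 j) in xj *; set c := peak_coord z j in xj c0 c1 ek.
  set k := tick z in ek; set v := velocity j in ek lj *.
  apply: (@wave_evolution_lower _ 1 M _ y t (- (k0%:~R * v / 2) - k%:R * v ^+ 2 / 4)) => //.
  - move=> l lM; exists (l%:Z * k0 + k%:Z * (l%:Z * l%:Z)), ((y - c) * (D * (l%:R - v / 2))); split.
      have -> : t = k%:R / D ^+ 2 by [].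
      have ec : c = (k0%:~R + k%:R * v) / D by rewrite -ek mulrAC divff ?mul1r// gt_eqF.
      rewrite intrD !intrM -!pmulrn ec.
      by field; rewrite gt_eqF.
    rewrite normrM; apply: le_trans (ler_pM _ _ xj (lj _ lM)) _ => //.
    by rewrite divfK ?gt_eqF//; lra.
  - move=> l lM; rewrite mulr1.
    have h1 : `|2 * t * (D * (l%:R - v / 2))| <= 2 * dl.
      have t20 : 0 <= 2 * t by exact: mulr_ge0.
      rewrite normrM (ger0_norm t20).
      apply: (@le_trans _ _ (2 * t * N)); last by rewrite -mulrA ler_wpM2l.
      by apply: ler_wpM2l; [exact: t20|exact: lj].
    apply: le_trans (ler_normD _ _) _.
    have h2 : `|y| <= 2 * dl.
      by move: xj; rewrite !ler_norml => /andP[a b]; apply/andP; split; lra.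
    by lra.
  - by rewrite expr1n mulr1 ger0_norm//; lra.
rewrite /datum wave_packet_schroedinger//; last by move=> i; exact: (H i).1.
rewrite normc_prod.
have -> : 2^-1 ^+ m.+1 * (W * M%:R ^+ m) = \prod_i (2^-1 * ((numbers i)%:R * widths i)) :> R.
  rewrite big_ord_recl /numbers /widths !coord_cons0.
  under eq_bigr do rewrite !coord_consS mulr1.
  by rewrite prodr_const card_ord exprMn exprS mul1r; ring.
apply: ler_prod => i _; apply/andP; split.
  by rewrite mulr_ge0 ?invr_ge0// mulr_ge0// ltW.
apply: le_trans (H i).2; rewrite ler_wpM2r ?mulr_ge0 ?(ltW (w0 i))//; lra.
Qed.

Lemma box_peak_in_ball z : m.+1%:R * (9 * dl ^+ 2) < 1 ->
  box (peak_center z) peak_size `<=` eball 0 1.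
Proof.
move=> small x xz; rewrite /eball /= subr0 -(@ltr_pXn2r _ 2)// ?nnegrE ?enorm_ge0//.
rewrite expr1n enorm_sqr; apply: le_lt_trans small.
rewrite mulr_natl -[X in _ *+ X]card_ord -sumr_const; apply: ler_sum => i _.
have -> : 9 * dl ^+ 2 = (3 * dl) ^+ 2 by ring.
rewrite -(real_normK (num_real _)) lerXn2r ?nnegrE ?mulr_ge0 ?(ltW dl0)//.
exact: box_peak_le xz i.
Qed.

(** The factors are: the density; the volume of the part of one box that a ball
    of radius rho can contain; the number of blocks that the ball can meet,
    consecutive blocks being 2 N q^m / D^2 apart in the first coordinate; the
    number of grid positions that it can meet in each transverse coordinate. *)
Definition ball_bound (d rho : R) : R :=
  d * (2 * Num.min rho (dl / W)) * (2 * Num.min rho (dl / N)) ^+ m *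
  Num.min K%:R (2 * ((rho + dl / W) / (2 * N * (q ^ m)%:R / D ^+ 2) + 1) + 1) *
  Num.min P%:R (2 * (D * q%:R * (rho + dl / N) + 1) + 1) ^+ m.

Lemma peak_size_ge0 i : 0 <= peak_size i.
Proof.
by move: i; apply: forall_ord_cons => [|j]; rewrite /peak_size ?coord_cons0 ?coord_consS divr_ge0 ?ltW.
Qed.

(** Meeting the ball is a condition on each coordinate of the centre. The first
    one restricts only the block and the others only one grid position each, up
    to errors of one unit, so the number of boxes met factors. *)
Lemma sum_boxes_le_ball_bound (d rho : R) (x : 'rV[R]_m.+1) : 0 <= d -> 0 < rho ->
  (\sum_z d%:E * lebesgue_Rn m.+1 (eball x rho `&` box (peak_center z) peak_size) <=
   (ball_bound d rho)%:E)%E.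
Proof.
move=> d0 rho0.
pose S := 2 * N * (q ^ m)%:R / D ^+ 2.
have qm0 : 0 < (q ^ m)%:R :> R by rewrite ltr0n expn_gt0 q0.
have S0 : 0 < S by rewrite divr_gt0 ?exprn_gt0// mulr_gt0// mulr_gt0.
have Dq0 : 0 < D * q%:R by rewrite mulr_gt0.
pose L0 := (rho + dl / W) / S + 1; pose L1 := D * q%:R * (rho + dl / N) + 1.
have dW0 : 0 <= dl / W by rewrite divr_ge0 ?ltW.
have dN0 : 0 <= dl / N by rewrite divr_ge0 ?ltW.
have L00 : 0 <= L0 by rewrite addr_ge0// divr_ge0 ?(ltW S0)// addr_ge0// ltW.
have L10 : 0 <= L1 by rewrite addr_ge0// mulr_ge0 ?(ltW Dq0)// addr_ge0// ltW.
pose X0 := - (x ord0 ord0 / S); pose X1 (j : 'I_m) := D * q%:R * x ord0 (lift ord0 j).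
pose B := (2 * Num.min rho (dl / W)) * (2 * Num.min rho (dl / N)) ^+ m.
have B0 : 0 <= B.
  by rewrite mulr_ge0 ?exprn_ge0// mulr_ge0// le_min (ltW rho0).
pose F (k : 'I_K) : R := (`|X0 - k%:R| <= L0)%R%:R.
pose G (j : 'I_m) (p : 'I_P) : R := (`|X1 j - p%:R| <= L1)%R%:R.
have term z : (lebesgue_Rn m.+1 (eball x rho `&` box (peak_center z) peak_size) <=
   (B * (F z.1 * \prod_j G j (z.2 j)))%:E)%E.
  apply: le_trans (lebesgue_eball_box _ _ (ltW rho0) peak_size_ge0) _.
  rewrite lee_fin big_split /= [leLHS]mulrC big_ord_recl [X in _ * X]big_ord_recl.
  under [X in _ * (_ * X)]eq_bigr do rewrite /peak_size coord_consS.
  rewrite prodr_const card_ord /peak_size coord_cons0 -/B [leLHS]mulrC ler_wpM2l//.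
  have indle (b c : bool) : (b -> c) -> b%:R <= c%:R :> R.
    by case: b c => [] [] // /(_ isT).
  apply: ler_pM; rewrite ?ler0n ?prodr_ge0//.
    apply: indle; rewrite mxE coord_cons0 opprK => h.
    have e : peak_time z * (2 * N) = S * (z.1%:R + (from_digits q m (digit z))%:R / (q ^ m)%:R).
      rewrite /peak_time /tick natrD natrM /S; field.
      by rewrite (gt_eqF qm0) gt_eqF.
    have -> : X0 - z.1%:R = - (x ord0 ord0 + 2 * N * peak_time z) / S +
        (from_digits q m (digit z))%:R / (q ^ m)%:R.
      rewrite [2 * N * _]mulrC e /X0; field; by rewrite (gt_eqF qm0) (gt_eqF S0).
    rewrite (le_trans (ler_normD _ _))// /L0 lerD//.
      rewrite mulNr normrN normrM normfV (gtr0_norm S0) ler_pM2r ?invr_gt0//.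
    rewrite ger0_norm ?divr_ge0// ler_pdivrMr// mul1r ler_nat ltnW//.
    exact: from_digits_lt.
  apply: ler_prod => j _; rewrite ler0n /=.
  apply: indle; rewrite mxE !coord_consS => h.
  have qj0 : 0 < (q ^ j)%:R :> R by rewrite ltr0n expn_gt0 q0.
  have -> : X1 j - (z.2 j)%:R = D * q%:R * (x ord0 (lift ord0 j) - peak_coord z j) +
      (tick z %% q ^ j)%N%:R / (q ^ j)%:R.
    rewrite /X1 /peak_coord; field.
    by rewrite (gt_eqF qj0) (gt_eqF qR0) (gt_eqF D0).
  rewrite (le_trans (ler_normD _ _))// /L1 lerD//.
    by rewrite normrM (gtr0_norm Dq0) ler_pM2l.
  rewrite ger0_norm ?divr_ge0// ler_pdivrMr// mul1r ler_nat ltnW// ltn_pmod//.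
  by rewrite expn_gt0 q0.
apply: (@le_trans _ _ (\sum_(z : peak) (d * (B * (F z.1 * \prod_j G j (z.2 j))))%:E)%E).
  by apply: lee_sum => z _; rewrite EFinM; apply: lee_wpmul2l; [rewrite lee_fin|exact: term].
rewrite sumEFin lee_fin -!mulr_sumr.
have -> : \sum_(z : peak) F z.1 * \prod_j G j (z.2 j) =
    (\sum_k F k) * \prod_j \sum_p G j p.
  by rewrite bigA_distr_bigA big_distrlr pair_bigA.
rewrite /ball_bound -/S -/L0 -/L1.
rewrite -[d * _ * _]mulrA -/B -[leRHS]mulrA -[leRHS]mulrA.
do 2 rewrite ler_wpM2l//.
apply: ler_pM.
- by apply: sumr_ge0 => k _; rewrite /F ler0n.
- by apply: prodr_ge0 => j _; apply: sumr_ge0 => k _; rewrite /G ler0n.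
- exact: count_near.
- rewrite -[X in _ ^+ X]card_ord -prodr_const; apply: ler_prod => j _.
  rewrite count_near// andbT.
  by apply: sumr_ge0 => k _; rewrite /G ler0n.
Qed.

(** The estimate is tested on the datum and on d times Lebesgue measure on the
    boxes, counted with multiplicity. The left side is the square of the lower
    bound for the solution times the total mass; on the right stand the
    dimension constant of the measure and the Sobolev norm of the datum. *)
Lemma one_scale_inequality (alpha s C d Kc : R) (t : nat -> R) :
  160 * dl <= 1 / 2 -> m.+1%:R * (9 * dl ^+ 2) < 1 ->
  0 <= s -> 4 * s * W ^+ 2 <= pi * N ^+ 2 ->
  (forall z, exists k, t k = peak_time z) ->
  0 <= d -> 0 <= C -> (forall rho, 0 < rho -> ball_bound d rho <= C * rho `^ alpha) ->
  (forall f : 'rV[R]_m.+1 -> R[i], schwartz f ->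
   forall (mu : {measure set (Rn R m.+1) -> \bar R}) (Cmu : R),
    dim_bound alpha mu Cmu ->
    (\int[mu]_(x in eball 0 1)
        ereal_sup (range (fun k =>
          (Normc.normc (schroedinger (t k) f x) ^+ 2)%:E))
      <= Kc%:E * Cmu%:E * sobolev_norm2 s f)%E) ->
  (2^-1 ^+ m.+1 * (W * M%:R ^+ m)) ^+ 2 *
    (d * (2 * (dl / W)) * (2 * (dl / N)) ^+ m * (K%:R * P%:R ^+ m)) <=
  `|Kc| * C * (N `^ (2 * s) * (energy_const s ^+ m.+1 * (W * M%:R ^+ m))).
Proof.
move=> dl1 dl2 s0 sW ht d0 C0 HC est.
have [mu muE] := box_measure peak_center peak_size d0.
have dimb : dim_bound alpha mu C.
  move=> x rho rho0; rewrite muE.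
  by apply: le_trans (sum_boxes_le_ball_bound x d0 rho0) _; rewrite lee_fin HC.
have w0 i : 0 < widths i.
  by move: i; apply: forall_ord_cons => [|j]; rewrite /widths ?coord_cons0 ?coord_consS.
have fS : schwartz datum by exact: wave_packet_schwartz.
have := est _ fS _ _ dimb.
have ws i : 4 * s * widths i ^+ 2 <= pi * N ^+ 2.
  move: i; apply: forall_ord_cons => [|j]; rewrite /widths ?coord_cons0 ?coord_consS//.
  apply: le_trans sW; rewrite ler_wpM2l ?mulr_ge0// lerXn2r ?nnegrE// ltW//.
have sob := sobolev_wave_packet w0 s0 N1 (freqs_le DM) (fun i l k => @freqs_sep i l k) ws.
set A := 2^-1 ^+ m.+1 * (W * M%:R ^+ m).
have A0 : 0 <= A by rewrite mulr_ge0 ?exprn_ge0 ?invr_ge0// mulr_ge0 ?exprn_ge0 ?(ltW W0).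
pose E : set (Rn R m.+1) := \bigcup_(z in [set: peak]) box (peak_center z) peak_size.
have mE : measurable E.
  by apply: fin_bigcup_measurable => [|z _]; [exact: finite_finset|exact: measurable_box].
have low : ((A ^+ 2)%:E * mu E <= \int[mu]_(x in eball 0 1)
        ereal_sup (range (fun k =>
          (Normc.normc (schroedinger (t k) datum x) ^+ 2)%:E)))%E.
  rewrite integral_mkcond.
  have <- : (\int[mu]_x (A ^+ 2 * \1_E x)%:E = (A ^+ 2)%:E * mu E)%E.
    under eq_integral do rewrite EFinM.
    rewrite ge0_integralZl_EFin ?sqr_ge0//; first by rewrite integral_indic// setIT.
    exact/measurable_EFinP/measurable_indic.
  apply: ge0_integral_mono => x; first by rewrite lee_fin mulr_ge0// sqr_ge0.
  have nneg (y : Rn R m.+1) : (0 <= ereal_sup (range (fun k =>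
          (Normc.normc (schroedinger (t k) datum y) ^+ 2)%:E)))%E.
    apply: (@le_trans _ _ (Normc.normc (schroedinger (t 0%N) datum y) ^+ 2)%:E).
      by rewrite lee_fin sqr_ge0.
    by apply: ereal_sup_ubound; exists 0%N.
  rewrite patchE indicE; case: (boolP (x \in E)) => [/set_mem[z _ xz]|xE]; last first.
    by rewrite mulr0; case: ifP.
  rewrite mulr1 mem_set; last exact: box_peak_in_ball xz.
  have [k tk] := ht z.
  apply: (@le_trans _ _ (Normc.normc (schroedinger (t k) datum x) ^+ 2)%:E); last first.
    by apply: ereal_sup_ubound; exists k.
  have H := datum_large_at_peak dl1 xz.
  by rewrite lee_fin tk lerXn2r// nnegrE// (le_trans A0 H).
move=> up; have {}up := le_trans low up.
have muEE : mu E = (d * (2 * (dl / W)) * (2 * (dl / N)) ^+ m * (K%:R * P%:R ^+ m))%:E.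
  rewrite muE.
  have -> : (d * (2 * (dl / W)) * (2 * (dl / N)) ^+ m * (K%:R * P%:R ^+ m))%:E =
     (\sum_(z : peak) (d * ((2 * (dl / W)) * (2 * (dl / N)) ^+ m))%:E)%E.
    rewrite sumEFin sumr_const card_prod card_ffun !card_ord -(mulr_natr _ (K * P ^ m)) natrM natrX; congr _%:E; ring.
  apply: eq_bigr => z _; rewrite EFinM; congr (_ * _)%E.
  rewrite (setIidr (bigcup_sup _))// lebesgue_box; last exact: peak_size_ge0.
  rewrite big_ord_recl /peak_size coord_cons0; under eq_bigr do rewrite coord_consS.
  by rewrite prodr_const card_ord.
rewrite muEE -EFinM in up; rewrite -lee_fin; apply: le_trans up _.
rewrite -EFinM; apply: (@le_trans _ _ ((`|Kc| * C)%:E * sobolev_norm2 s datum)%E).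
  apply: lee_wpmul2r; last by rewrite lee_fin ler_wpM2r// ler_norm.
  by apply: integral_ge0 => xi _; rewrite lee_fin mulr_ge0 ?powR_ge0 ?sqr_ge0.
rewrite [leRHS]EFinM; apply: lee_wpmul2l; first by rewrite lee_fin mulr_ge0.
apply: le_trans sob _; rewrite lee_fin ler_wpM2l ?powR_ge0//.
rewrite big_ord_recl /numbers /widths !coord_cons0.
under eq_bigr do rewrite !coord_consS.
by rewrite prodr_const card_ord mul1r mulr1 exprMn exprS le_eqVlt; apply/orP; left; apply/eqP; ring.
Qed.

End construction.

(** * The dimension of the measure *)

Section dimension.
Context {R : realType}.

Lemma expr1D_le (x : R) m : 0 <= x -> (1 + x) ^+ m <= 2 ^+ m * (1 + x ^+ m).
Proof.
move=> x0; have xm : 0 <= x ^+ m by rewrite exprn_ge0.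
have [x1|x1] := lerP x 1.
  apply: (@le_trans _ _ (2 ^+ m)).
    by rewrite lerXn2r ?nnegrE ?addr_ge0//; lra.
  by rewrite ler_peMr ?exprn_ge0// lerDl.
apply: (@le_trans _ _ ((2 * x) ^+ m)).
  by rewrite lerXn2r ?nnegrE ?addr_ge0 ?mulr_ge0//; lra.
by rewrite exprMn ler_wpM2l ?exprn_ge0// lerDr.
Qed.

Lemma powR_le_id (x e : R) : 0 <= x -> x <= 1 -> 0 <= e -> x `^ e <= 1.
Proof.
move=> x0 x1 e0; have <- : 1 `^ e = 1 :> R by rewrite powR1.
by apply: ge0_ler_powR => //; rewrite nnegrE.
Qed.

Lemma powR_nonpos_le (x y e : R) : 0 < x -> x <= y -> e <= 0 -> y `^ e <= x `^ e.
Proof.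
move=> x0 xy e0; have y0 : 0 < y by apply: lt_le_trans xy.
rewrite -(opprK e) !(powRN _ (- e)) lef_pV2 ?posrE ?powR_gt0//.
by apply: ge0_ler_powR; rewrite ?nnegrE ?(ltW x0) ?(ltW y0)// oppr_ge0.
Qed.

Variables (m q K P : nat) (D N W dl T alpha : R).
Hypotheses (q0 : (0 < q)%N) (D1 : 1 <= D) (W1 : 1 <= W) (WN : W <= N) (T0 : 0 < T).
Hypotheses (dl0 : 0 < dl) (dl1 : dl <= 1).
Hypotheses (alpha1 : 1 <= alpha) (alphan : alpha <= m.+1%:R).
Hypothesis qlow : D ^+ 2 <= N * W * (q ^ m)%:R.
Hypothesis Kup : K%:R * (q ^ m)%:R * T <= D ^+ 2.
Hypothesis Pup : P%:R <= D * q%:R.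
Hypothesis K1 : (0 < K)%N.

Let N1 : 1 <= N. Proof. exact: le_trans WN. Qed.
Let D0 : 0 < D. Proof. exact: lt_le_trans D1. Qed.
Let N0 : 0 < N. Proof. exact: lt_le_trans N1. Qed.
Let W0 : 0 < W. Proof. exact: lt_le_trans W1. Qed.
Let qR0 : 0 < q%:R :> R. Proof. by rewrite ltr0n. Qed.
Let qm0 : 0 < (q ^ m)%:R :> R. Proof. by rewrite ltr0n expn_gt0 q0. Qed.

(** The distance between consecutive blocks in the first coordinate. By [WS] it is
    at least the length 1 / W of a box there. *)
Let S := 2 * N * (q ^ m)%:R / D ^+ 2.

Let S0 : 0 < S.
Proof. by rewrite divr_gt0 ?exprn_gt0// mulr_gt0// mulr_gt0. Qed.

Let WS : 2 <= W * S.
Proof.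
rewrite /S mulrA ler_pdivlMr ?exprn_gt0//.
by have := qlow; lra.
Qed.

Let d := N `^ (m.+1%:R - alpha).

(** Up to constants, the length of the intersection of an interval of length rho
    with the union of the intervals that the blocks occupy. *)
Let H rho := Num.min rho (dl / W) * (Num.min K%:R (2 * rho / S) + 4).

Let hW0 : 0 <= dl / W. Proof. exact: divr_ge0 (ltW dl0) (ltW W0). Qed.

Let u_ge0 (rho : R) : 0 < rho -> 0 <= Num.min K%:R (2 * rho / S).
Proof.
move=> r0; rewrite le_min ler0n/=.
by apply: divr_ge0; [apply: mulr_ge0 => //; exact: ltW|exact: ltW].
Qed.

Let m1_ge0 (rho : R) : 0 < rho -> 0 <= Num.min rho (dl / W).
Proof. by move=> r0; rewrite le_min (ltW r0)/=. Qed.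

Let H_ge0 (rho : R) : 0 < rho -> 0 <= H rho.
Proof.
move=> r0; apply: mulr_ge0; first exact: m1_ge0.
by apply: addr_ge0 => //; exact: u_ge0.
Qed.

Let dW_le : dl / W <= W^-1.
Proof. by rewrite ler_piMl ?invr_ge0// ltW. Qed.

Let H_le_rho (rho : R) : 0 < rho -> H rho <= 5 * rho.
Proof.
move=> r0; rewrite /H mulrDr.
have a1 : Num.min rho (dl / W) * 4 <= rho * 4 by rewrite ler_wpM2r// ge_min lexx.
suff a2 : Num.min rho (dl / W) * Num.min K%:R (2 * rho / S) <= rho by lra.
apply: (@le_trans _ _ (W^-1 * (2 * rho / S))).
  apply: ler_pM; [exact: m1_ge0|exact: u_ge0| |].
    by rewrite ge_min dW_le orbT.
  by rewrite ge_min lexx orbT.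
have gen (s : R) : 0 < s -> 2 <= W * s -> W^-1 * (2 * rho / s) <= rho.
  move=> s0 Ws; have -> : W^-1 * (2 * rho / s) = rho * 2 / (W * s).
    by field; rewrite (gt_eqF W0) (gt_eqF s0).
  by rewrite ler_pdivrMr ?mulr_gt0// ler_wpM2l// ltW.
exact: gen S0 WS.
Qed.

Let ball_bound_le_H (rho : R) : dl / N <= rho ->
  ball_bound m q K P D N W dl d rho <=
  2 * 16 ^+ m * (N `^ (1 - alpha) * H rho * (1 + (D * q%:R * Num.min rho 1) ^+ m)).
Proof.
move=> hr; have r0 : 0 < rho by apply: lt_le_trans hr; rewrite divr_gt0.
have Dq0 : 0 < D * q%:R by rewrite mulr_gt0.
set sg := Num.min rho 1.
have sg0 : 0 <= sg by rewrite le_min (ltW r0)/=.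
have F1 : Num.min P%:R (2 * (D * q%:R * (rho + dl / N) + 1) + 1) <= 4 * (1 + D * q%:R * sg).
  have [rl|rl] := lerP rho 1.
    rewrite ge_min; apply/orP; right.
    have -> : sg = rho by rewrite /sg min_l.
    have : D * q%:R * (rho + dl / N) <= D * q%:R * (2 * rho) by rewrite ler_pM2l//; lra.
    by lra.
  rewrite ge_min; apply/orP; left.
  have -> : sg = 1 by rewrite /sg min_r// ltW.
  by apply: le_trans Pup _; lra.
have F0 : Num.min rho (dl / W) *
    Num.min K%:R (2 * ((rho + dl / W) / S + 1) + 1) <= H rho.
  rewrite /H; apply: ler_wpM2l; first exact: m1_ge0.
  have h2 : dl / W / S <= 1 / 2.
    have gen (s : R) : 0 < s -> 2 <= W * s -> dl / W / s <= 1 / 2.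
      move=> s0 Ws; have -> : dl / W / s = dl / (W * s).
        by field; rewrite (gt_eqF W0) (gt_eqF s0).
      have Ws0 : 0 < W * s by rewrite mulr_gt0.
      rewrite ler_pdivrMr//; apply: le_trans dl1 _.
      by rewrite div1r ler_pdivlMl// mulr1.
    exact: gen S0 WS.
  have h3 : 2 * ((rho + dl / W) / S + 1) + 1 <= 2 * rho / S + 4.
    by rewrite mulrDl; lra.
  rewrite ge_min; have [lr|lr] := lerP K%:R (2 * rho / S).
    by apply/orP; left; lra.
  by apply/orP; right.
have m2 : (2 * Num.min rho (dl / N)) ^+ m <= 2 ^+ m * (N ^+ m)^-1.
  rewrite -exprVn -exprMn lerXn2r ?nnegrE ?mulr_ge0 ?le_min ?(ltW r0) ?divr_ge0 ?invr_ge0 ?(ltW dl0) ?(ltW N0)//.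
  rewrite ler_wpM2l// ge_min; apply/orP; right.
  by rewrite ler_piMl ?invr_ge0// ltW.
have dN : d * (N ^+ m)^-1 = N `^ (1 - alpha).
  rewrite /d (_ : m.+1%:R - alpha = 1 - alpha + m%:R); last by rewrite -natr1; ring.
  rewrite powRD; last by apply/implyP => _; rewrite gt_eqF.
  by rewrite powR_mulrn ?(ltW N0)// mulfK// gt_eqF// exprn_gt0.
have d0 : 0 <= d by exact: powR_ge0.
have F1m : Num.min P%:R (2 * (D * q%:R * (rho + dl / N) + 1) + 1) ^+ m <= 8 ^+ m * (1 + (D * q%:R * sg) ^+ m).
  apply: (@le_trans _ _ ((4 * (1 + D * q%:R * sg)) ^+ m)).
    rewrite lerXn2r ?nnegrE//.
      rewrite le_min ler0n/=; apply: addr_ge0 => //; apply: mulr_ge0 => //; apply: addr_ge0 => //.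
      by apply: mulr_ge0; [exact: ltW|apply: addr_ge0; [exact: ltW|exact: divr_ge0 (ltW dl0) (ltW N0)]].
    by rewrite mulr_ge0// addr_ge0// mulr_ge0// ltW.
  have -> : 8 = 4 * 2 :> R by ring.
  have y0 : 0 <= D * q%:R * sg by rewrite mulr_ge0// ltW.
  set y := D * q%:R * sg in y0 *.
  rewrite [(4 * (1 + y)) ^+ m]exprMn [(4 * 2) ^+ m]exprMn -mulrA.
  by apply: ler_wpM2l; [exact: exprn_ge0|exact: expr1D_le].
rewrite /ball_bound -/S.
set m1 := Num.min rho (dl / W) in F0 *; set f0 := Num.min K%:R _ in F0 *.
set f1 := Num.min P%:R _ ^+ m in F1m *; set mm := _ ^+ m in m2 *.
have m10 : 0 <= m1 by rewrite le_min (ltW r0)/= divr_ge0 ?ltW.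
have f00 : 0 <= f0.
  rewrite le_min ler0n/=; apply: addr_ge0 => //; apply: mulr_ge0 => //; apply: addr_ge0 => //.
  by apply: divr_ge0; [apply: addr_ge0; [exact: ltW|exact: divr_ge0 (ltW dl0) (ltW W0)]|exact: ltW].
have mm0 : 0 <= mm.
  by rewrite exprn_ge0// mulr_ge0// le_min (ltW r0)/= divr_ge0 ?ltW.
have f10 : 0 <= f1.
  rewrite exprn_ge0// le_min ler0n/=; apply: addr_ge0 => //; apply: mulr_ge0 => //; apply: addr_ge0 => //.
  by apply: mulr_ge0; [exact: ltW|apply: addr_ge0; [exact: ltW|exact: divr_ge0 (ltW dl0) (ltW N0)]].
rewrite [leLHS](_ : _ = 2 * ((d * mm) * (m1 * f0) * f1)); last by ring.
rewrite -[leRHS]mulrA ler_wpM2l//.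
have -> : 16 = 2 * 8 :> R by ring.
rewrite [X in X * (_ * _)]exprMn.
rewrite [leRHS](_ : _ = (2 ^+ m * N `^ (1 - alpha)) * H rho * (8 ^+ m * (1 + (D * q%:R * sg) ^+ m))); last by ring.
apply: ler_pM => //; first by rewrite !mulr_ge0.
apply: ler_pM => //; first by rewrite mulr_ge0.
  by rewrite mulr_ge0.
by rewrite -dN mulrCA ler_wpM2l.
Qed.

(** The case of a ball meeting a bounded number of grid positions. There
    [H_le_rho] suffices, as N^(1 - alpha) <= C rho^(alpha - 1) for rho >= dl / N. *)
Let point_term (rho : R) : dl / N <= rho ->
  N `^ (1 - alpha) * H rho <= 5 * dl `^ (1 - alpha) * rho `^ alpha.
Proof.
move=> hr; have r0 : 0 < rho by apply: lt_le_trans hr; rewrite divr_gt0.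
apply: (@le_trans _ _ (N `^ (1 - alpha) * (5 * rho))).
  by rewrite ler_wpM2l ?powR_ge0// H_le_rho.
have e : rho `^ (1 - alpha) * rho `^ alpha = rho.
  rewrite -powRD; first by rewrite subrK powRr1// ltW.
  by apply/implyP => _; rewrite gt_eqF.
rewrite -{1}e mulrCA -[leRHS]mulrA ler_wpM2l// mulrA ler_wpM2r ?powR_ge0//.
rewrite -(powRM _ (ltW N0) (ltW r0)); apply: powR_nonpos_le => //; last by rewrite subr_le0.
by rewrite mulrC -ler_pdivrMr.
Qed.

Let inequality_from_pieces (CB rho : R) : dl / N <= rho ->
  N `^ (1 - alpha) * H rho * (D * q%:R * Num.min rho 1) ^+ m <= CB * rho `^ alpha ->
  ball_bound m q K P D N W dl d rho <=
  2 * 16 ^+ m * (5 * dl `^ (1 - alpha) + CB) * rho `^ alpha.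
Proof.
move=> hr hB; apply: le_trans (ball_bound_le_H hr) _.
rewrite -[leRHS]mulrA ler_wpM2l ?mulr_ge0 ?exprn_ge0//.
by rewrite mulrDr mulr1 mulrDl lerD// point_term.
Qed.

(** Below the finest scale the bound is that of a multiple of Lebesgue measure,
    and scales like rho^(m+1), which decays at least as fast as rho^alpha. *)
Let small_radius (C : R) : 0 <= C ->
  (forall rho, dl / N <= rho -> ball_bound m q K P D N W dl d rho <= C * rho `^ alpha) ->
  forall rho, 0 < rho -> ball_bound m q K P D N W dl d rho <= C * rho `^ alpha.
Proof.
move=> C0 HC rho r0; have [lr|rl] := leP (dl / N) rho; first exact: HC.
set h := dl / N in rl *.
have h0 : 0 < h by rewrite divr_gt0.
have hW : h <= dl / W by rewrite /h ler_pM2l// lef_pV2 ?posrE.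
have d0 : 0 <= d by exact: powR_ge0.
have Dq0 : 0 < D * q%:R by rewrite mulr_gt0.
have B1 : ball_bound m q K P D N W dl d rho <=
    (rho / h) ^+ m.+1 * ball_bound m q K P D N W dl d h.
  rewrite /ball_bound -/S -/h !(min_l hW) !(min_l (ltW rl)) minxx.
  rewrite (min_l (ltW (lt_le_trans rl hW))).
  have -> : d * (2 * rho) * (2 * rho) ^+ m = (rho / h) ^+ m.+1 * (d * (2 * h) * (2 * h) ^+ m).
    have -> : 2 * rho = (rho / h) * (2 * h) by rewrite mulrCA divfK// gt_eqF.
    by rewrite exprMn exprS; ring.
  have minle (k a b : R) : a <= b -> Num.min k a <= Num.min k b.
    by move=> ab; rewrite le_min !ge_min lexx ab orbT.
  set f0 := Num.min K%:R _; set f1 := Num.min P%:R _ ^+ m.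
  have f00 : 0 <= f0.
    rewrite le_min ler0n/=; apply: addr_ge0 => //; apply: mulr_ge0 => //; apply: addr_ge0 => //.
    by apply: divr_ge0; [apply: addr_ge0 => //; exact: ltW|exact: ltW].
  have p0 : 0 <= Num.min P%:R (2 * (D * q%:R * (rho + h) + 1) + 1).
    rewrite le_min ler0n/=; apply: addr_ge0 => //; apply: mulr_ge0 => //; apply: addr_ge0 => //.
    by apply: mulr_ge0; [exact: ltW|apply: addr_ge0; exact: ltW].
  have c0 : 0 <= (rho / h) ^+ m.+1 * (d * (2 * h) * (2 * h) ^+ m).
    apply: mulr_ge0; first by apply/exprn_ge0/divr_ge0; exact: ltW.
    apply: mulr_ge0; first by apply: mulr_ge0 => //; apply: mulr_ge0 => //; exact: ltW.
    by apply: exprn_ge0; apply: mulr_ge0 => //; exact: ltW.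
  rewrite !mulrA -mulrA -[leRHS]mulrA; rewrite !mulrA in c0.
  apply: ler_wpM2l => //; apply: ler_pM => //; first exact: exprn_ge0.
    apply: minle; rewrite lerD2r ler_pM2l// lerD2r ler_pM2r ?invr_gt0// lerD2r; exact: ltW.
  rewrite lerXn2r ?nnegrE// ; last first.
    by apply: minle; rewrite lerD2r ler_pM2l// lerD2r ler_pM2l// lerD2r; exact: ltW.
  by apply: (le_trans p0); apply: minle; rewrite lerD2r ler_pM2l// lerD2r ler_pM2l// lerD2r; exact: ltW.
apply: le_trans B1 _.
have rh : 0 < rho / h <= 1.
  by rewrite divr_gt0// ler_pdivrMr// mul1r ltW.
have [rh0 rh1] := andP rh.
apply: (@le_trans _ _ ((rho / h) ^+ m.+1 * (C * h `^ alpha))).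
  by apply: ler_wpM2l; [apply/exprn_ge0/ltW|exact: HC].
rewrite mulrCA; apply: ler_wpM2l => //.
have -> : rho `^ alpha = (rho / h) `^ alpha * h `^ alpha.
  by rewrite -powRM ?(ltW rh0) ?(ltW h0)// divfK// gt_eqF.
rewrite ler_wpM2r ?powR_ge0// -powR_mulrn ?(ltW rh0)//.
exact: ger_powR.
Qed.

(** The first summand is the contribution of [point_term], and CB bounds that of
    the balls meeting many grid positions. *)
Definition dimension_const (CB : R) : R := 2 * 16 ^+ m * (5 * dl `^ (1 - alpha) + CB).

Let dimension_const_ge0 (CB : R) : 0 <= CB -> 0 <= dimension_const CB.
Proof.
move=> h; rewrite /dimension_const mulr_ge0 ?mulr_ge0 ?exprn_ge0// addr_ge0//.
by rewrite mulr_ge0// powR_ge0.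
Qed.

(** For alpha <= m, balls of radius one are the worst ones among those meeting
    many grid positions, and the hypothesis is the bound for the total mass. *)
Lemma ball_bound_low_dimension (C3 : R) : alpha <= m%:R ->
  N `^ (1 - alpha) * D ^+ m.+2 / (T * W) <= C3 ->
  0 <= dimension_const (5 * C3) /\
  forall rho, 0 < rho -> ball_bound m q K P D N W dl d rho <= dimension_const (5 * C3) * rho `^ alpha.
Proof.
move=> alpham hC3.
have C30 : 0 <= C3.
  apply: le_trans hC3; apply: divr_ge0; last by rewrite mulr_ge0// ltW.
  by apply: mulr_ge0; [exact: powR_ge0|apply/exprn_ge0/ltW].
have cc := dimension_const_ge0 (mulr_ge0 (ler0n _ 5) C30); split => //.
apply: small_radius => // rho hr; have r0 : 0 < rho by apply: lt_le_trans hr; rewrite divr_gt0.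
apply: inequality_from_pieces => //.
set sg := Num.min rho 1.
have sg0 : 0 < sg by rewrite lt_min r0/=.
have sg1 : sg <= 1 by rewrite ge_min lexx orbT.
have sgr : sg <= rho by rewrite ge_min lexx.
have sgm : sg ^+ m <= rho `^ alpha.
  apply: (@le_trans _ _ (sg `^ alpha)).
    by rewrite -powR_mulrn ?(ltW sg0)//; apply: ger_powR => //; rewrite sg0.
  apply: ge0_ler_powR; rewrite ?nnegrE ?(ltW sg0) ?(ltW r0)//.
  exact: le_trans alpha1.
have HK : H rho <= 5 * (K%:R * W^-1).
  have KR : 1 <= K%:R :> R by rewrite ler1n.
  have u1 : Num.min K%:R (2 * rho / S) + 4 <= 5 * K%:R.
    have : Num.min K%:R (2 * rho / S) <= K%:R by rewrite ge_min lexx.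
    by lra.
  have m1W : Num.min rho (dl / W) <= W^-1 by rewrite ge_min dW_le orbT.
  have u0 : 0 <= Num.min K%:R (2 * rho / S) + 4 by apply: addr_ge0 => //; exact: u_ge0.
  apply: le_trans (ler_pM (m1_ge0 r0) u0 m1W u1) _.
  by rewrite mulrCA [W^-1 * _]mulrC.
have Wi0 : 0 <= W^-1 by rewrite invr_ge0 ltW.
have key : N `^ (1 - alpha) * (K%:R * W^-1) * (D * q%:R) ^+ m <= C3.
  apply: le_trans hC3.
  rewrite [leLHS](_ : _ = N `^ (1 - alpha) * W^-1 * D ^+ m * (K%:R * (q ^ m)%:R)); last first.
    by rewrite exprMn natrX; ring.
  rewrite [leRHS](_ : _ = N `^ (1 - alpha) * W^-1 * D ^+ m * (D ^+ 2 / T)); last first.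
    by rewrite -addn2 exprD; field; rewrite (gt_eqF T0) (gt_eqF W0).
  apply: ler_wpM2l; last by rewrite ler_pdivlMr.
  by apply: mulr_ge0; [apply: mulr_ge0 => //; exact: powR_ge0|apply/exprn_ge0/ltW].
have Dqm : 0 <= (D * q%:R) ^+ m by apply/exprn_ge0/mulr_ge0 => //; exact: ltW.
rewrite exprMn.
apply: (@le_trans _ _ (N `^ (1 - alpha) * (5 * (K%:R * W^-1)) * ((D * q%:R) ^+ m * rho `^ alpha))).
  apply: ler_pM.
  - by apply: mulr_ge0; [exact: powR_ge0|exact: H_ge0].
  - by apply: mulr_ge0 => //; apply/exprn_ge0/ltW.
  - by apply: ler_wpM2l => //; exact: powR_ge0.
  - exact: ler_wpM2l.
rewrite [leLHS](_ : _ = 5 * (N `^ (1 - alpha) * (K%:R * W^-1) * (D * q%:R) ^+ m) * rho `^ alpha); last by ring.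
by rewrite ler_wpM2r ?powR_ge0// ler_wpM2l.
Qed.

(** For m <= alpha the transverse grid contributes rho^m, and a power alpha - m
    is left for the first coordinate. It is worst at the two lengths that occur
    there: the length 1 / W of one box and the length N / T of the region that
    the peaks travel through. The constants C1 and C2 bound what happens at these
    lengths. *)
Lemma ball_bound_high_dimension (c C1 C2 : R) : m%:R <= alpha ->
  (D * q%:R) ^+ m <= c * (D ^+ m * (1 + D ^+ 2 / (N * W))) -> 0 <= c ->
  W^-1 <= N / T ->
  N `^ (1 - alpha) * D ^+ m * W^-1 `^ (m.+1%:R - alpha) <= C1 ->
  N `^ (1 - alpha) * D ^+ m.+2 / (N * W) * (N / T) `^ (m.+1%:R - alpha) <= C2 ->
  0 <= dimension_const (4 * c * (C1 + C2) + C2) /\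
  forall rho, 0 < rho -> ball_bound m q K P D N W dl d rho <=
    dimension_const (4 * c * (C1 + C2) + C2) * rho `^ alpha.
Proof.
move=> malpha hq c0 hW hC1 hC2.
have NT0 : 0 < N / T by rewrite divr_gt0.
have Wi0 : 0 < W^-1 by rewrite invr_gt0.
have na : 0 <= m.+1%:R - alpha by rewrite subr_ge0.
have Dm0 k : 0 <= D ^+ k by apply/exprn_ge0/ltW.
have Na0 : 0 <= N `^ (1 - alpha) by exact: powR_ge0.
have C10 : 0 <= C1.
  by apply: le_trans hC1; apply: mulr_ge0; [exact: mulr_ge0|exact: powR_ge0].
have C20 : 0 <= C2.
  apply: le_trans hC2; apply: mulr_ge0; last exact: powR_ge0.
  by apply: divr_ge0; [exact: mulr_ge0|apply: mulr_ge0; exact: ltW].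
have CB0 : 0 <= 4 * c * (C1 + C2) + C2.
  by apply: addr_ge0 => //; apply: mulr_ge0; [exact: mulr_ge0|exact: addr_ge0].
have cc := dimension_const_ge0 CB0; split => //.
apply: small_radius => // rho hr; have r0 : 0 < rho by apply: lt_le_trans hr; rewrite divr_gt0.
apply: inequality_from_pieces => //.
set sg := Num.min rho 1.
have sg0 : 0 < sg by rewrite lt_min r0/=.
have sgr : sg <= rho by rewrite ge_min lexx.
have sgm : sg ^+ m <= rho ^+ m by rewrite lerXn2r ?nnegrE ?(ltW sg0) ?(ltW r0).
(* x = x^(n - alpha) x^(alpha - m), then each factor is bounded separately *)
have split1 (x : R) : 0 <= x -> x = x `^ (m.+1%:R - alpha) * x `^ (alpha - m%:R).
  move=> x0; rewrite -powRD; last first.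
    apply/implyP => /eqP e; exfalso; move: e; rewrite -natr1.
    by rewrite (_ : _ + _ = 1); [move/eqP; rewrite oner_eq0|ring].
  by rewrite -natr1 (_ : _ + _ = 1) ?powRr1//; ring.
have ram : rho `^ (alpha - m%:R) * rho ^+ m = rho `^ alpha.
  rewrite -powR_mulrn ?(ltW r0)// -powRD ?subrK//.
  by apply/implyP => _; rewrite gt_eqF.
have am : 0 <= alpha - m%:R by rewrite subr_ge0.
have m10 := m1_ge0 r0.
set m1 := Num.min rho (dl / W) in m10 *.
have m1W : m1 <= W^-1 by rewrite ge_min dW_le orbT.
have m1r : m1 <= rho by rewrite ge_min lexx.
have u0 := u_ge0 r0; set u := Num.min K%:R (2 * rho / S) in u0 *.
have uK : u <= K%:R by rewrite ge_min lexx.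
have uS : u <= 2 / S * rho by rewrite ge_min mulrAC lexx orbT.
have piece1 : m1 * rho ^+ m <= W^-1 `^ (m.+1%:R - alpha) * rho `^ alpha.
  rewrite (split1 _ m10) -ram mulrA; apply: ler_wpM2r; first exact/exprn_ge0/ltW.
  apply: ler_pM; rewrite ?powR_ge0//.
    by apply: ge0_ler_powR; rewrite ?nnegrE ?(ltW Wi0).
  by apply: ge0_ler_powR; rewrite ?nnegrE ?(ltW r0).
have S2 : 2 / S = D ^+ 2 / (N * (q ^ m)%:R).
  rewrite /S; field.
  by rewrite (gt_eqF qm0) (gt_eqF N0) (gt_eqF D0).
have S20 : 0 < 2 / S by rewrite divr_gt0.
have KS : K%:R <= 2 / S * (N / T).
  rewrite S2 [leRHS](_ : _ = D ^+ 2 / ((q ^ m)%:R * T)); last first.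
    by field; rewrite (gt_eqF qm0) (gt_eqF N0) (gt_eqF T0).
  by rewrite ler_pdivlMr ?mulr_gt0// mulrA.
have piece2 : u * rho ^+ m <= 2 / S * (N / T) `^ (m.+1%:R - alpha) * rho `^ alpha.
  rewrite (split1 _ u0) -ram mulrA; apply: ler_wpM2r; first exact/exprn_ge0/ltW.
  rewrite [X in X * (N / T) `^ _ ](split1 _ (ltW S20)).
  rewrite [leRHS](_ : _ = ((2 / S * (N / T)) `^ (m.+1%:R - alpha)) * ((2 / S * rho) `^ (alpha - m%:R))); last first.
    by rewrite (powRM _ (ltW S20) (ltW NT0)) (powRM _ (ltW S20) (ltW r0)); ring.
  apply: ler_pM; rewrite ?powR_ge0//.
    apply: ge0_ler_powR; rewrite ?nnegrE//; first by apply: mulr_ge0; exact: ltW.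
    exact: le_trans uK KS.
  by apply: ge0_ler_powR; rewrite ?nnegrE//; apply: mulr_ge0; exact: ltW.
have Dq0 : 0 < D * q%:R by rewrite mulr_gt0.
have Dqm : 0 <= (D * q%:R) ^+ m by apply/exprn_ge0/ltW.
have Hs : H rho * sg ^+ m <=
   (4 * W^-1 `^ (m.+1%:R - alpha) + W^-1 * (2 / S) * (N / T) `^ (m.+1%:R - alpha)) * rho `^ alpha.
  apply: (@le_trans _ _ (H rho * rho ^+ m)).
    by apply: ler_wpM2l => //; exact: H_ge0.
  rewrite /H -/m1 -/u [leLHS](_ : _ = 4 * (m1 * rho ^+ m) + m1 * (u * rho ^+ m)); last by ring.
  rewrite [leRHS]mulrDl; apply: lerD; first by rewrite -[leRHS]mulrA ler_wpM2l.
  rewrite -[W^-1 * _ * _]mulrA -[leRHS]mulrA; apply: ler_pM => //.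
  by apply: mulr_ge0 => //; apply/exprn_ge0/ltW.
rewrite exprMn [leLHS](_ : _ = N `^ (1 - alpha) * (D * q%:R) ^+ m * (H rho * sg ^+ m)); last by ring.
apply: (@le_trans _ _ (N `^ (1 - alpha) * (D * q%:R) ^+ m *
   ((4 * W^-1 `^ (m.+1%:R - alpha) + W^-1 * (2 / S) * (N / T) `^ (m.+1%:R - alpha)) * rho `^ alpha))).
  by apply: ler_wpM2l => //; exact: mulr_ge0.
rewrite [leLHS]mulrA; apply: ler_wpM2r; first exact: powR_ge0.
rewrite [leLHS]mulrDr; apply: lerD.
  rewrite [leLHS](_ : _ = 4 * ((D * q%:R) ^+ m * (N `^ (1 - alpha) * W^-1 `^ (m.+1%:R - alpha)))); last by ring.
  rewrite -[leRHS]mulrA ler_wpM2l//.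
  apply: (@le_trans _ _ (c * (D ^+ m * (1 + D ^+ 2 / (N * W))) * (N `^ (1 - alpha) * W^-1 `^ (m.+1%:R - alpha)))).
    by apply: ler_wpM2r => //; apply: mulr_ge0 => //; exact: powR_ge0.
  rewrite -mulrA ler_wpM2l//.
  rewrite [leLHS](_ : _ = N `^ (1 - alpha) * D ^+ m * W^-1 `^ (m.+1%:R - alpha) +
     N `^ (1 - alpha) * D ^+ m.+2 / (N * W) * W^-1 `^ (m.+1%:R - alpha)); last first.
    have eD : D ^+ m.+2 = D ^+ m * D ^+ 2 by rewrite -exprD addn2.
    rewrite eD; move: (W^-1 `^ _) (N `^ _) (D ^+ m) => x y z.
    by field; rewrite (gt_eqF W0) (gt_eqF N0).
  apply: lerD => //; apply: le_trans hC2; apply: ler_wpM2l.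
    by apply: divr_ge0; [exact: mulr_ge0|apply: mulr_ge0; exact: ltW].
  by apply: ge0_ler_powR; rewrite ?nnegrE ?(ltW Wi0) ?(ltW NT0).
apply: le_trans hC2; rewrite le_eqVlt; apply/orP; left; apply/eqP.
have eD : D ^+ m.+2 = D ^+ m * D ^+ 2 by rewrite -exprD addn2.
have qn0 : q%:R ^+ m != 0 :> R by rewrite -natrX (gt_eqF qm0).
rewrite S2 exprMn natrX eD; move: qn0.
move: ((N / T) `^ _) (N `^ _) (D ^+ m) (q%:R ^+ m) => x y z v qn0.
by field; rewrite (gt_eqF W0) (gt_eqF N0) qn0.
Qed.

End dimension.

(** * Dyadic blocks of times *)

Section sequence.
Context {R : realType}.

Lemma counting_le_size (A : set nat) (s : seq nat) :
  (forall i, A i -> i \in s) -> (counting A <= ((size s)%:R : R)%:E)%E.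
Proof.
move=> As; have fA : finite_set A by apply: sub_finite_set (finite_seq s) => i /As.
rewrite /counting; case: asboolP => // _; rewrite lee_fin ler_nat.
rewrite (leq_trans (finmap.fsubset_leq_card (B := finmap.seq_fset tt s) _))//.
  by apply/finmap.fsubsetP => i; rewrite in_fset_set// => /set_mem/As; rewrite finmap.seq_fsetE.
by rewrite finmap.size_seq_fset size_undup.
Qed.

(** Values of size at least delta occur only in the blocks with 2^j <= 1 / delta.
    The bounds on the sizes of the blocks grow geometrically, so the last of
    these blocks dominates, and its bound is a multiple of delta^(- r). *)
Lemma weak_lr_blocks (r C : R) (kap : nat -> nat) (tau : nat -> nat -> R) :
  0 < r -> 0 <= C ->
  (forall j k, (k < kap j)%N -> 0 <= tau j k <= 2^-1 ^+ j) ->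
  (forall j, (kap j)%:R <= C * (2 ^+ j) `^ r) ->
  exists t, weak_lr r t /\ forall j k, (k < kap j)%N -> exists i, t i = tau j k.
Proof.
move=> r0 C0 taub kapb.
pose t i : R := if (pickle_inv i : option (nat * nat)) is Some p then
  (if (p.2 < kap p.1)%N then tau p.1 p.2 else 0) else 0.
exists t; split; last first.
  by move=> j k jk; exists (pickle (j, k)); rewrite /t pickleK_inv /= jk.
pose b : R := 2 `^ r.
have b1 : 1 < b.
  have -> : 1 = 1 `^ r :> R by rewrite powR1.
  by apply: gt0_ltr_powR; rewrite ?nnegrE//; lra.
have pb j : (2 ^+ j) `^ r = b ^+ j :> R.
  by rewrite -powR_mulrn// /b -!powRrM mulrC powRrM powR_mulrn// powR_ge0.
apply: (@le_lt_trans _ _ (C * b / (b - 1))%:E); last exact: ltry.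
apply: ge_ereal_sup => _ [dlt /= d0 <-].
have exJ : exists J, dlt^-1 < 2 ^+ J.
  exists (Num.truncn dlt^-1).+1; apply: lt_le_trans (truncnS_gt _) _.
  by rewrite -natrX ler_nat; apply/ltnW/ltn_expl.
case: (ex_minnP exJ) => J HJ Jmin.
pose s := [seq (pickle (j, k) : nat) | j <- iota 0 J, k <- iota 0 (kap j)].
have ss : (counting [set k | (dlt <= `|t k|)%R] <= ((size s)%:R : R)%:E)%E.
  apply: counting_le_size => i /=; rewrite /t.
  case E : pickle_inv => [[j k]|]; last by rewrite normr0 leNgt d0.
  case: ifP => /= jk; last by rewrite normr0 leNgt d0.
  have /andP[tj0 tj1] := taub _ _ jk.
  rewrite ger0_norm// => dt.
  have <- : pickle (j, k) = i by have := @pickle_invK (nat * nat)%type i; rewrite E.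
  apply/allpairsPdep; exists j, k; split=> //; last by rewrite mem_iota.
  rewrite mem_iota /= add0n ltnNge; apply/negP => Jj.
  have : 2 ^+ J <= dlt^-1.
    apply: (@le_trans _ _ (2 ^+ j)); first by apply: ler_weXn2l => //; lra.
    have : dlt <= 2^-1 ^+ j by exact: le_trans tj1.
    by rewrite exprVn => h; rewrite -[leLHS]invrK lef_pV2 ?posrE ?invr_gt0 ?exprn_gt0.
  by rewrite leNgt HJ.
have sb : ((size s)%:R : R) * (b - 1) <= C * b ^+ J.
  have h : ((size s)%:R : R) <= C * \sum_(j < J) b ^+ j.
    rewrite size_allpairs_dep sumnE big_map natr_sum -(big_mkord xpredT (fun j => b ^+ j)) /index_iota subn0.
    rewrite mulr_sumr; apply: ler_sum => j _; rewrite size_iota -pb; exact: kapb.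
  apply: (@le_trans _ _ (C * (\sum_(j < J) b ^+ j) * (b - 1))).
    by apply: ler_wpM2r => //; lra.
  by rewrite -mulrA ler_wpM2l// mulrC -subrX1; lra.
have [J0|Jpos] := posnP J.
  have : (counting [set k | (dlt <= `|t k|)%R] <= (0 : R)%:E)%E.
    by apply: le_trans ss _; rewrite /s J0.
  move=> h; apply: (@le_trans _ _ 0%E).
    by apply: mule_ge0_le0; rewrite ?lee_fin ?powR_ge0.
  by rewrite lee_fin divr_ge0 ?mulr_ge0//; lra.
have dr0 : 0 < dlt `^ r by rewrite powR_gt0.
have bJ : dlt `^ r * b ^+ J <= b.
  rewrite -(prednK Jpos) exprS mulrCA ler_piMr//; first by lra.
  have hJ : 2 ^+ J.-1 <= dlt^-1.
    rewrite leNgt; apply/negP => /Jmin; by rewrite -{1}(prednK Jpos) ltnn.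
  rewrite -pb -powRM ?(ltW d0) ?exprn_ge0//.
  apply: powR_le_id; rewrite ?mulr_ge0 ?exprn_ge0 ?(ltW d0) ?(ltW r0)//.
  by rewrite -ler_pdivlMl// mulr1.
apply: (@le_trans _ _ ((dlt `^ r)%:E * ((size s)%:R)%:E)%E).
  by apply: lee_wpmul2l; rewrite ?lee_fin ?(ltW dr0).
rewrite -EFinM lee_fin ler_pdivlMr; last by lra.
rewrite -mulrA; apply: (@le_trans _ _ (dlt `^ r * (C * b ^+ J))).
  by rewrite ler_wpM2l// ltW.
by rewrite mulrCA ler_wpM2l.
Qed.
End sequence.

(** * The parameters at scale T *)

Section scale.
Context {R : realType}.

(** Bernoulli's inequality for powers of 2^e. *)
Lemma large_power_dyadic (c e : R) : 0 < e ->
  exists j0, forall j, (j0 <= j)%N -> c <= (2 ^+ j) `^ e.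
Proof.
move=> e0; have b1 : 1 < 2 `^ e :> R.
  have e1 : 1 `^ e = 1 :> R by rewrite powR1.
  rewrite -[ltLHS]e1.
  by apply: gt0_ltr_powR; rewrite ?nnegrE//; lra.
have pb j : (2 ^+ j) `^ e = (2 `^ e) ^+ j :> R.
  by rewrite -powR_mulrn// -!powRrM mulrC powRrM powR_mulrn// powR_ge0.
set y := c / (2 `^ e - 1).
exists (Num.truncn y).+1 => j hj; rewrite pb.
have bj : 1 + j%:R * (2 `^ e - 1) <= (2 `^ e) ^+ j.
  elim: (j) => [|k IH]; first by rewrite mul0r addr0 expr0.
  rewrite exprS; apply: (@le_trans _ _ (2 `^ e * (1 + k%:R * (2 `^ e - 1)))); last first.
    by rewrite ler_wpM2l// powR_ge0.
  rewrite -natr1; have : 0 <= k%:R * (2 `^ e - 1) ^+ 2 :> R by rewrite mulr_ge0// sqr_ge0.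
  by rewrite expr2; move: (2 `^ e) => b; lra.
have yj : y <= j%:R by apply: (le_trans (ltW (truncnS_gt y))); rewrite ler_nat.
apply: le_trans bj; have : c <= j%:R * (2 `^ e - 1) by rewrite -ler_pdivrMr//; lra.
by lra.
Qed.

Lemma truncn_ge_half (x : R) : 1 <= x -> x / 2 <= (Num.truncn x)%:R.
Proof.
move=> x1; have h1 : (1 <= Num.truncn x)%N by rewrite truncn_gt0.
have := truncnS_gt x; rewrite -natr1 => h; rewrite ler_pdivrMr//.
have : (1 : R) <= (Num.truncn x)%:R by rewrite ler1n.
by lra.
Qed.

Variables (m : nat) (nu rp : R).

(** Small enough for [datum_large_at_peak] and for all boxes to lie in the unit
    ball. *)
Definition cell_ratio : R := (320 * m.+1%:R)^-1.

(** Large compared with 1 / cell_ratio, so that the integer parts defining the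
    numbers of blocks and of grid positions are at least one. *)
Definition step_factor : R := 2 ^+ m.+2 / cell_ratio.
Local Notation dl := cell_ratio.
Local Notation A := step_factor.

(** At scale T the times are below 1 / T and are multiples of 1 / D^2; this choice
    of D makes their number about T^rp. *)
Definition step_at (T : R) := A * T `^ ((1 + rp) / 2).

(** Up to rounding, the least q for which consecutive blocks are at least 1 / W
    apart in the first coordinate, where N = T^nu and W = T^(1/2). *)
Definition modulus_at (T : R) :=
  (Num.truncn ((step_at T ^+ 2 / (T `^ nu * T `^ 2^-1)) `^ m%:R^-1)).+1.
Definition repetitions_at (T : R) :=
  Num.truncn (dl * step_at T ^+ 2 / (2 * T * (modulus_at T ^ m)%:R)).
Definition cells_at (T : R) := Num.truncn (dl * (step_at T * (modulus_at T)%:R)).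
Definition harmonics_at (T : R) := Num.truncn (T `^ nu / step_at T).

Hypotheses (m0 : (0 < m)%N).

Let c320 : 0 < 320 :> R. Proof. by rewrite ltr0n. Qed.

Lemma cell_ratio_gt0 : 0 < dl.
Proof. by rewrite invr_gt0; apply: mulr_gt0; [exact: c320|rewrite ltr0n]. Qed.

Lemma cell_ratio_mul : dl * (320 * m.+1%:R) = 1.
Proof.
rewrite /dl; apply: mulVf; apply: lt0r_neq0.
by apply: mulr_gt0; [exact: c320|rewrite ltr0n].
Qed.

Let dl0 := cell_ratio_gt0.

Lemma cell_ratio_le : 320 * dl <= 1.
Proof.
rewrite -[leRHS]cell_ratio_mul; have h : 1 <= m.+1%:R :> R by rewrite ler1n.
have : 0 <= dl * (m.+1%:R - 1) by apply: mulr_ge0; [exact: ltW|rewrite subr_ge0].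
by lra.
Qed.

Lemma step_factor_large : [/\ 1 <= A, dl^-1 <= A & 2 ^+ m.+2 / dl <= A ^+ 2].
Proof.
have d1 : dl <= 1 by have := cell_ratio_le; lra.
have h1 : 1 <= 2 ^+ m.+2 :> R by apply: exprn_ege1; lra.
have h2 : 1 <= dl^-1 by rewrite invf_ge1.
have h3 : dl^-1 <= A by rewrite /A ler_peMl// invr_ge0 ltW.
have h4 : 1 <= A by exact: le_trans h3.
by split => //; rewrite -/A expr2 ler_peMl// (le_trans _ h4).
Qed.

Section one_scale.
Variable T : R.
Hypotheses (T1 : 1 <= T) (nu0 : 2^-1 <= nu) (nu1 : nu <= 1) (rp0 : 0 <= rp).

Let T0 : 0 < T. Proof. exact: lt_le_trans T1. Qed.
Let N := T `^ nu.
Let W := T `^ 2^-1.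
Let D := step_at T.
Let q := modulus_at T.
Let K := repetitions_at T.
Let P := cells_at T.
Let M := harmonics_at T.

Lemma powT_D a b : T `^ (a + b) = T `^ a * T `^ b.
Proof. by rewrite powRD//; apply/implyP => _; rewrite gt_eqF. Qed.

Lemma powT_X a k : (T `^ a) ^+ k = T `^ (a * k%:R).
Proof. by rewrite powRrM powR_mulrn// powR_ge0. Qed.

Lemma powT_ge1 a : 0 <= a -> 1 <= T `^ a.
Proof. by move=> a0; rewrite -[leLHS](powRr0 T); exact: ler_powR. Qed.

Lemma powT_le1 a : a <= 0 -> T `^ a <= 1.
Proof. by move=> a0; rewrite -[leRHS](powRr0 T); exact: ler_powR. Qed.

Let W1 : 1 <= W. Proof. by apply: powT_ge1; rewrite invr_ge0. Qed.
Let WN : W <= N. Proof. exact: ler_powR. Qed.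
Let N1 : 1 <= N. Proof. exact: le_trans WN. Qed.
Let N0 : 0 < N. Proof. exact: lt_le_trans N1. Qed.
Let W0 : 0 < W. Proof. exact: lt_le_trans W1. Qed.
Let NT : N <= T. Proof. by rewrite -[leRHS](powRr1 (ltW T0)); exact: ler_powR. Qed.

Let W2 : W ^+ 2 = T.
Proof. by rewrite powT_X mulVf// powRr1// ltW. Qed.

Let D2 : D ^+ 2 = A ^+ 2 * T * T `^ rp.
Proof.
rewrite /D /step_at exprMn powT_X divfK// powT_D powRr1 ?(ltW T0)//.
by rewrite mulrA.
Qed.

Let A1 : 1 <= A. Proof. by case: step_factor_large. Qed.

Let D1 : A <= D.
Proof.
rewrite /D /step_at ler_peMr ?(le_trans ler01)//.
by apply: powT_ge1; rewrite divr_ge0// addr_ge0.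
Qed.

Let D0 : 0 < D. Proof. by apply: lt_le_trans D1; apply: lt_le_trans A1. Qed.

Let y := (D ^+ 2 / (N * W)) `^ m%:R^-1.

Let ym : y ^+ m = D ^+ 2 / (N * W).
Proof.
have z0 : 0 <= D ^+ 2 / (N * W).
  apply: divr_ge0; first exact/exprn_ge0/ltW.
  by apply: mulr_ge0; exact: ltW.
rewrite /y -powR_mulrn ?powR_ge0// -powRrM mulVf ?powRr1//.
by rewrite pnatr_eq0 -lt0n.
Qed.

Let yq : y <= q%:R <= 1 + y.
Proof.
apply/andP; split; first exact/ltW/truncnS_gt.
by rewrite /q /modulus_at -natr1 addrC lerD2l truncn_le// powR_ge0.
Qed.

Lemma modulus_gt0 : (0 < q)%N. Proof. by []. Qed.

Let qm0 : 0 < (q ^ m)%:R :> R. Proof. by rewrite ltr0n expn_gt0. Qed.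

Let y0 : 0 <= y. Proof. exact: powR_ge0. Qed.

Lemma modulus_lower : D ^+ 2 <= N * W * (q ^ m)%:R.
Proof.
rewrite mulrC -ler_pdivrMr ?mulr_gt0// -ym natrX.
by have /andP[h _] := yq; rewrite lerXn2r ?nnegrE.
Qed.

Lemma modulus_upper : (q ^ m)%:R <= 2 ^+ m * (1 + D ^+ 2 / (N * W)).
Proof.
rewrite -ym natrX; apply: le_trans (expr1D_le m y0).
by have /andP[_ h] := yq; rewrite lerXn2r ?nnegrE ?addr_ge0.
Qed.

Lemma repetitions_upper : (K * q ^ m)%:R * (2 * T) <= dl * D ^+ 2.
Proof.
rewrite natrM -mulrA [X in _ * X]mulrC -ler_pdivlMr ?mulr_gt0//.
rewrite truncn_le//; apply: divr_ge0.
  by apply: mulr_ge0; [exact: ltW|exact/exprn_ge0/ltW].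
by apply: mulr_ge0; [apply: mulr_ge0 => //; exact: ltW|exact: ltW].
Qed.

Lemma step_ge1 : 1 <= D. Proof. exact: le_trans D1. Qed.

Lemma ticks_upper : (K * q ^ m)%:R <= dl * A ^+ 2 / 2 * T `^ rp.
Proof.
have := repetitions_upper; rewrite -ler_pdivlMr ?mulr_gt0// D2 => h.
apply: le_trans h _; rewrite le_eqVlt; apply/orP; left; apply/eqP.
by field; rewrite (gt_eqF T0).
Qed.

Lemma tick_time_le k : (k < K * q ^ m)%N -> 0 <= k%:R / D ^+ 2 <= T^-1.
Proof.
move=> hk; have DD : 0 < D ^+ 2 by apply: exprn_gt0.
rewrite divr_ge0//= ?(ltW DD)// ler_pdivrMr// ler_pdivlMl// mulrC.
have h1 : k%:R * (2 * T) <= dl * D ^+ 2.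
  apply: le_trans repetitions_upper; rewrite ler_wpM2r ?mulr_ge0 ?(ltW T0)//.
  by rewrite ler_nat ltnW.
have h2 : dl * D ^+ 2 <= 1 * D ^+ 2.
  by rewrite ler_wpM2r ?(ltW DD)//; have := cell_ratio_le; have := dl0; lra.
have h3 : 0 <= k%:R * T by rewrite mulr_ge0// ltW.
lra.
Qed.

Lemma time_upper : (K * q ^ m)%:R * (N + W ^+ 2) <= dl * D ^+ 2.
Proof.
apply: le_trans repetitions_upper; rewrite ler_wpM2l// W2.
by have := NT; lra.
Qed.

Lemma cells_upper : P%:R <= dl * (D * q%:R).
Proof. by rewrite truncn_le// mulr_ge0 ?(ltW dl0)// mulr_ge0// ltW. Qed.

Lemma harmonics_upper : D * M%:R <= N.
Proof. by rewrite mulrC -ler_pdivlMr// truncn_le// divr_ge0// ltW. Qed.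

Lemma cells_lower : dl * (D * q%:R) / 2 <= P%:R.
Proof.
apply: truncn_ge_half; have [_ h _] := step_factor_large.
rewrite -ler_pdivrMl// mulr1; apply: le_trans h _; apply: le_trans D1 _.
by rewrite ler_peMr ?(ltW D0)// ler1n.
Qed.

Hypothesis L1 : 2 ^+ m.+2 / dl <= T `^ (nu - 2^-1).

Lemma repetitions_lower :
  1 <= dl * D ^+ 2 / (2 * T * (q ^ m)%:R) /\ dl * D ^+ 2 / (2 * T * (q ^ m)%:R) / 2 <= K%:R.
Proof.
suff h : 1 <= dl * D ^+ 2 / (2 * T * (q ^ m)%:R) by split => //; exact: truncn_ge_half.
rewrite ler_pdivlMr ?mulr_gt0// mul1r.
apply: (@le_trans _ _ (2 * T * (2 ^+ m * (1 + D ^+ 2 / (N * W))))).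
  by rewrite ler_wpM2l ?modulus_upper// mulr_ge0// ltW.
have [_ _ hA] := step_factor_large.
have e4 : 2 ^+ m.+2 = 4 * 2 ^+ m :> R by rewrite !exprS; ring.
have h1 : 2 ^+ m.+2 * T <= dl * D ^+ 2.
  rewrite D2 -ler_pdivrMl// mulrA [_^-1 * _]mulrC.
  rewrite -[leRHS]mulrA; apply: ler_pM => //; try exact: ltW.
    by rewrite divr_ge0// ?exprn_ge0// ltW.
  by rewrite ler_peMr ?(ltW T0)//; exact: powT_ge1.
have h2 : 2 ^+ m.+2 * T * (D ^+ 2 / (N * W)) <= dl * D ^+ 2.
  have -> : 2 ^+ m.+2 * T * (D ^+ 2 / (N * W)) = (2 ^+ m.+2 * T / (N * W)) * D ^+ 2.
    by move: (2 ^+ _) => b; field; rewrite (gt_eqF N0) (gt_eqF W0).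
  rewrite ler_wpM2r ?exprn_ge0 ?(ltW D0)// ler_pdivrMr ?mulr_gt0//.
  have eNW : N * W = T `^ (nu - 2^-1) * T.
    have -> : N = T `^ (nu - 2^-1) * W by rewrite -powT_D subrK.
    by rewrite -mulrA -expr2 W2.
  by rewrite eNW mulrA ler_wpM2r ?(ltW T0)// -ler_pdivrMl// mulrC.
rewrite e4 in h1 h2; move: h1 h2; move: (2 ^+ m) (D ^+ 2 / (N * W)) (dl * D ^+ 2) => a b c.
by lra.
Qed.

Hypothesis L2 : A <= T `^ (nu - (1 + rp) / 2).

Lemma harmonics_lower : 1 <= N / D /\ N / D / 2 <= M%:R.
Proof.
suff h : 1 <= N / D by split => //; exact: truncn_ge_half.
rewrite ler_pdivlMr// mul1r /D /step_at.
have -> : N = T `^ (nu - (1 + rp) / 2) * T `^ ((1 + rp) / 2) by rewrite -powT_D subrK.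
by rewrite ler_wpM2r ?powR_ge0.
Qed.

(** The lower bounds for the numbers of waves, blocks and grid positions multiply
    to N^m D^2 / T up to a constant: q and the powers of D cancel. *)
Lemma gain_lower (d : R) : 0 <= d ->
  W * M%:R ^+ m * ((dl ^+ 2 / 8) ^+ m.+1 * d * T `^ rp) <=
  (2^-1 ^+ m.+1 * (W * M%:R ^+ m)) ^+ 2 *
    (d * (2 * (dl / W)) * (2 * (dl / N)) ^+ m * (K%:R * P%:R ^+ m)).
Proof.
move=> d0; have [_ hM] := harmonics_lower; have [_ hK] := repetitions_lower.
have hP := cells_lower.
have q0 : 0 < q%:R :> R by rewrite ltr0n modulus_gt0.
have ND0 : 0 <= N / D / 2 by apply: divr_ge0 => //; apply: divr_ge0; exact: ltW.
have dq0 : 0 <= dl * (D * q%:R) / 2.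
  by apply: divr_ge0 => //; apply: mulr_ge0; [exact: ltW|apply: mulr_ge0 => //; exact: ltW].
have kk0 : 0 <= dl * D ^+ 2 / (2 * T * (q ^ m)%:R) / 2.
  apply: divr_ge0 => //; apply: divr_ge0.
    by apply: mulr_ge0; [exact: ltW|apply/exprn_ge0/ltW].
  by apply: mulr_ge0 => //; apply: mulr_ge0 => //; exact: ltW.
have hMm : (N / D / 2) ^+ m <= M%:R ^+ m by rewrite lerXn2r ?nnegrE// (le_trans ND0).
have hPm : (dl * (D * q%:R) / 2) ^+ m <= P%:R ^+ m by rewrite lerXn2r ?nnegrE// (le_trans dq0).
have dW0 : 0 <= 2 * dl by apply: mulr_ge0 => //; exact: ltW.
have dN0 : 0 <= 2 * (dl / N) by apply: mulr_ge0 => //; apply: divr_ge0; exact: ltW.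
rewrite [leRHS](_ : _ = W * M%:R ^+ m * ((2^-1 ^+ m.+1) ^+ 2 * d * (2 * dl) * (2 * (dl / N)) ^+ m *
    (M%:R ^+ m * (K%:R * P%:R ^+ m)))); last first.
  move: (2^-1 ^+ m.+1) ((2 * (dl / N)) ^+ m) (M%:R ^+ m) (P%:R ^+ m) => a b c e.
  by field; rewrite (gt_eqF W0).
apply: ler_wpM2l; first by apply: mulr_ge0; [exact: ltW|exact: exprn_ge0].
apply: (@le_trans _ _ ((2^-1 ^+ m.+1) ^+ 2 * d * (2 * dl) * (2 * (dl / N)) ^+ m *
  ((N / D / 2) ^+ m * (dl * D ^+ 2 / (2 * T * (q ^ m)%:R) / 2 * (dl * (D * q%:R) / 2) ^+ m)))); last first.
  apply: ler_wpM2l.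
    apply: mulr_ge0; last exact: exprn_ge0.
    apply: mulr_ge0 => //; apply: mulr_ge0 => //; exact: sqr_ge0.
  apply: ler_pM => //; first exact: exprn_ge0.
    by apply: mulr_ge0 => //; exact: exprn_ge0.
  by apply: ler_pM => //; exact: exprn_ge0.
have em : 2^-1 ^+ m * 2^-1 ^+ m * (2 * (dl / N)) ^+ m * (N / D / 2) ^+ m *
    (dl * (D * q%:R) / 2) ^+ m = (dl ^+ 2 / 8) ^+ m * q%:R ^+ m.
  rewrite -!exprMn; congr (_ ^+ m); move: dl => b.
  by field; rewrite (gt_eqF N0) (gt_eqF D0).
have qn0 : q%:R ^+ m != 0 :> R by rewrite -natrX (gt_eqF qm0).
rewrite [leRHS](_ : _ = (dl ^+ 2 / 8) ^+ m.+1 * d * (D ^+ 2 / T)); last first.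
  rewrite natrX; apply: (mulIf qn0).
  rewrite [RHS](_ : _ = (dl ^+ 2 / 8) ^+ m * q%:R ^+ m * (dl ^+ 2 / 8 * d * (D ^+ 2 / T))); last first.
    by rewrite exprS; move: ((dl ^+ 2 / 8) ^+ m) (q%:R ^+ m) => a b; ring.
  rewrite -em [2^-1 ^+ m.+1]exprS; move: qn0.
  move: (2^-1 ^+ m) ((2 * (dl / N)) ^+ m) ((N / D / 2) ^+ m) ((dl * (D * q%:R) / 2) ^+ m) (q%:R ^+ m) => a b c e v v0.
  by field; rewrite (gt_eqF T0) v0.
apply: ler_wpM2l; first by apply: mulr_ge0 => //; apply/exprn_ge0/divr_ge0 => //; exact: sqr_ge0.
rewrite D2 ler_pdivlMr// mulrC -mulrA ler_peMl//; first by rewrite mulr_ge0// ?powR_ge0 ?(ltW T0).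
exact: exprn_ege1.
Qed.

Variable alpha : R.
Hypotheses (alpha1 : 1 <= alpha) (alphan : alpha <= m.+1%:R).

Let dl1 : dl <= 1. Proof. by have := cell_ratio_le; have := dl0; lra. Qed.

Let Kup : K%:R * (q ^ m)%:R * T <= D ^+ 2.
Proof.
have := repetitions_upper; rewrite natrM => h.
have : dl * D ^+ 2 <= D ^+ 2 by rewrite ler_piMl// exprn_ge0// ltW.
have : 0 <= K%:R * (q ^ m)%:R * T by apply: mulr_ge0; [exact: mulr_ge0|exact: ltW].
by move: h; move: (K%:R * _) => a; lra.
Qed.

Let Pup : P%:R <= D * q%:R.
Proof. by apply: le_trans cells_upper _; rewrite ler_piMl// mulr_ge0// ltW. Qed.

Let K1 : (0 < K)%N.
Proof. by rewrite truncn_gt0; have [h _] := repetitions_lower. Qed.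

Let expand_D k : D ^+ k = A ^+ k * T `^ ((1 + rp) / 2 * k%:R).
Proof. by rewrite /D /step_at exprMn powT_X. Qed.

Let A_le k e : e <= 0 -> A ^+ k * T `^ e <= A ^+ k.
Proof. by move=> e0; rewrite ler_piMr ?powT_le1// exprn_ge0// (le_trans ler01). Qed.

Let Tinv e : (T `^ e)^-1 = T `^ (- e). Proof. by rewrite powRN. Qed.

Lemma ball_bound_scale_low : alpha <= m%:R ->
  nu * (1 - alpha) + (1 + rp) / 2 * m.+2%:R - 3 / 2 <= 0 ->
  0 <= dimension_const m dl alpha (5 * A ^+ m.+2) /\
  forall rho, 0 < rho -> ball_bound m q K P D N W dl (N `^ (m.+1%:R - alpha)) rho <=
    dimension_const m dl alpha (5 * A ^+ m.+2) * rho `^ alpha.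
Proof.
move=> am h; apply: (@ball_bound_low_dimension _ m q K P D N W dl T alpha) => //.
- exact: le_trans D1.
- exact: modulus_lower.
have e : N `^ (1 - alpha) * D ^+ m.+2 / (T * W) =
    A ^+ m.+2 * T `^ (nu * (1 - alpha) + (1 + rp) / 2 * m.+2%:R - 3 / 2).
  have -> : T * W = T `^ (3 / 2).
    have -> : 3 / 2 = 1 + 2^-1 :> R by field.
    by rewrite powT_D powRr1// ltW.
  by rewrite expand_D Tinv /N -powRrM !powT_D; ring.
by rewrite e; exact: A_le.
Qed.

Lemma ball_bound_scale_high : m%:R <= alpha ->
  nu * (1 - alpha) + (1 + rp) / 2 * m%:R - (m.+1%:R - alpha) / 2 <= 0 ->
  - (nu * alpha) + (1 + rp) / 2 * m.+2%:R + (nu - 1) * (m.+1%:R - alpha) - 1 / 2 <= 0 ->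
  let CB := 4 * 2 ^+ m * (A ^+ m + A ^+ m.+2) + A ^+ m.+2 in
  0 <= dimension_const m dl alpha CB /\
  forall rho, 0 < rho -> ball_bound m q K P D N W dl (N `^ (m.+1%:R - alpha)) rho <=
    dimension_const m dl alpha CB * rho `^ alpha.
Proof.
move=> am h1 h2 CB; apply: (@ball_bound_high_dimension _ m q K P D N W dl T alpha) => //.
- exact: le_trans D1.
- exact: modulus_lower.
- rewrite exprMn -[q%:R ^+ m]natrX [leRHS]mulrCA ler_wpM2l ?exprn_ge0 ?(ltW D0)//.
  exact: modulus_upper.
- have -> : N / T = T `^ (nu - 1) by rewrite powT_D powRN powRr1// ltW.
  rewrite Tinv; apply: ler_powR => //.
  have -> : - 2^-1 = 2^-1 - 1 :> R by field.
  by rewrite lerD2r.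
- have -> : N `^ (1 - alpha) * D ^+ m * W^-1 `^ (m.+1%:R - alpha) =
    A ^+ m * T `^ (nu * (1 - alpha) + (1 + rp) / 2 * m%:R - (m.+1%:R - alpha) / 2).
    have e : - ((m.+1%:R - alpha) / 2) = - 2^-1 * (m.+1%:R - alpha) :> R by ring.
    by rewrite e expand_D Tinv /N -!powRrM !powT_D; ring.
  exact: A_le.
have -> : N `^ (1 - alpha) * D ^+ m.+2 / (N * W) * (N / T) `^ (m.+1%:R - alpha) =
    A ^+ m.+2 * T `^ (- (nu * alpha) + (1 + rp) / 2 * m.+2%:R + (nu - 1) * (m.+1%:R - alpha) - 1 / 2).
  have -> : N / T = T `^ (nu - 1) by rewrite powT_D powRN powRr1// ltW.
  have -> : N * W = T `^ (nu + 2^-1) by rewrite powT_D.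
  rewrite Tinv expand_D /N -!powRrM.
  have e : - (nu * alpha) = nu * (1 - alpha) - nu :> R by ring.
  have e' : - (nu + 2^-1) = - nu - 1 / 2 :> R by field.
  by rewrite e e' !powT_D; ring.
exact: A_le.
Qed.

End one_scale.

End scale.

(** * The lower bound for the Sobolev exponent *)

Section exponent.
Context {R : realType}.

(** At scale T = 2^j, [one_scale_inequality] and [gain_lower] give
    T^(nu (n - alpha) + rp) <= B T^(2 s nu) with B independent of j, where
    n = m + 1. One sequence contains the times of all scales, as the constant of
    the estimate may depend on the sequence; letting j grow compares exponents. *)
Lemma exponent_lower_bound m (nu rp alpha r s C : R) : (0 < m)%N -> 0 < r ->
  2^-1 < nu -> nu <= 1 -> 0 <= rp -> rp <= r -> (1 + rp) / 2 < nu -> 0 <= C ->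
  (forall T, 1 <= T -> 2 ^+ m.+2 / cell_ratio m <= T `^ (nu - 2^-1) ->
    step_factor m <= T `^ (nu - (1 + rp) / 2) ->
    forall rho, 0 < rho ->
    ball_bound m (modulus_at m nu rp T) (repetitions_at m nu rp T)
      (cells_at m nu rp T) (step_at m rp T) (T `^ nu) (T `^ 2^-1) (cell_ratio m)
      ((T `^ nu) `^ (m.+1%:R - alpha)) rho <= C * rho `^ alpha) ->
  0 <= s -> fractal_maximal_estimate m.+1 alpha r s ->
  (m.+1%:R - alpha) / 2 + rp / (2 * nu) <= s.
Proof.
move=> m0 r0 nuh nu1 rp0 rpr nurp C0 HC s0 hest.
have nuh' := ltW nuh.
have nu0 : 0 < nu by apply: lt_trans nuh; rewrite invr_gt0.
have d0 := @cell_ratio_gt0 R m.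
have T1 j : 1 <= 2 ^+ j :> R by apply: exprn_ege1; lra.
have T0 j : 0 < 2 ^+ j :> R by exact: lt_le_trans (T1 j).
pose kap j := (repetitions_at m nu rp (2 ^+ j : R) * modulus_at m nu rp (2 ^+ j : R) ^ m)%N.
have [|||t [tlr ht]] := @weak_lr_blocks R r (cell_ratio m * step_factor m ^+ 2 / 2) kap
    (fun j k => k%:R / step_at m rp (2 ^+ j) ^+ 2) r0.
- by apply: divr_ge0 => //; apply: mulr_ge0; [exact: ltW|exact: sqr_ge0].
- move=> j k jk; rewrite exprVn; exact: (tick_time_le (T1 j) rp0 jk).
- move=> j; apply: (le_trans (ticks_upper m nu (T1 j) rp0)) => //.
  apply: ler_wpM2l; last exact: ler_powR.
  by apply: divr_ge0 => //; apply: mulr_ge0; [exact: ltW|exact: sqr_ge0].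
have [Kc hKc] := hest t tlr.
rewrite leNgt; apply/negP => hs.
pose e := nu * (m.+1%:R - alpha) + rp - 2 * s * nu.
have e0 : 0 < e.
  have -> : e = 2 * nu * ((m.+1%:R - alpha) / 2 + rp / (2 * nu) - s).
    by rewrite /e; field; rewrite (gt_eqF nu0).
  by rewrite mulr_gt0 ?subr_gt0// mulr_gt0.
pose c : R := (cell_ratio m ^+ 2 / 8) ^+ m.+1.
have c0 : 0 < c by apply/exprn_gt0/divr_gt0 => //; exact: exprn_gt0.
pose B := `|Kc| * C * energy_const s ^+ m.+1 / c.
have [j1 hj1] := @large_power_dyadic R (2 ^+ m.+2 / cell_ratio m) (nu - 2^-1) ltac:(lra).
have [j2 hj2] := @large_power_dyadic R (step_factor m) (nu - (1 + rp) / 2) ltac:(lra).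
have [j3 hj3] := @large_power_dyadic R (4 * s / pi) (2 * nu - 1) ltac:(lra).
have [j4 hj4] := @large_power_dyadic R (B + 1) e e0.
have [j [/hj1 {}hj1 /hj2 {}hj2 /hj3 {}hj3 /hj4 {}hj4]] :
    exists j, [/\ (j1 <= j)%N, (j2 <= j)%N, (j3 <= j)%N & (j4 <= j)%N].
  exists (maxn (maxn j1 j2) (maxn j3 j4)).
  by rewrite !leq_max !leqnn ?orbT.
set T : R := 2 ^+ j in hj1 hj2 hj3 hj4.
have {}T1 : 1 <= T := T1 j; have {}T0 : 0 < T := T0 j.
have W0 : 0 < T `^ 2^-1 by exact: powR_gt0.
have dd0 : 0 <= (T `^ nu) `^ (m.+1%:R - alpha) by exact: powR_ge0.
have W2 : (T `^ 2^-1) ^+ 2 = T by rewrite powT_X mulVf// powRr1// ltW.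
have h160 : 160 * cell_ratio m <= 1 / 2 :> R.
  by have := @cell_ratio_le R m; lra.
have small : m.+1%:R * (9 * cell_ratio m ^+ 2) < 1 :> R.
  have := @cell_ratio_mul R m; have := @cell_ratio_le R m; move: d0.
  set w : R := cell_ratio m; set a : R := m.+1%:R => w0 h1 h2.
  have -> : a * (9 * w ^+ 2) = 9 / 320 * (w * (320 * a)) * w by field.
  by rewrite h2; lra.
have four : 4 * s * (T `^ 2^-1) ^+ 2 <= pi * (T `^ nu) ^+ 2.
  rewrite W2 powT_X//; have -> : nu * 2%:R = (2 * nu - 1) + 1 by ring.
  rewrite powT_D// powRr1 ?(ltW T0)// mulrA ler_wpM2r ?(ltW T0)//.
  by rewrite [leRHS]mulrC -ler_pdivrMr ?pi_gt0.
have peaks (z : peak m (repetitions_at m nu rp T) (cells_at m nu rp T)) :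
    exists k, t k = peak_time (modulus_at m nu rp T) (step_at m rp T) z.
  exact: (ht j _ (tick_lt (modulus_gt0 _ _ _ _) z)).
have W1 : 1 <= T `^ 2^-1 by apply: powT_ge1; rewrite // invr_ge0.
have key := one_scale_inequality (modulus_gt0 m nu rp T)
  (step_ge1 m T1 rp0) (powT_ge1 T1 (ltW nu0)) W1 d0
  (harmonics_upper m T1 nuh' rp0) (time_upper m T1 nu1 rp0) (cells_upper m nu T1 rp0)
  h160 small s0 four peaks dd0 C0 (HC T T1 hj1 hj2) hKc.
have {}key := le_trans (gain_lower m0 T1 nuh' rp0 hj1 hj2 dd0) key.
have M0 : 0 < (harmonics_at m nu rp T)%:R :> R.
  rewrite ltr0n /harmonics_at truncn_gt0.
  by have [] := harmonics_lower T1 rp0 hj2.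
have WM : 0 < T `^ 2^-1 * (harmonics_at m nu rp T)%:R ^+ m.
  by apply: mulr_gt0 => //; exact: exprn_gt0.
have {key} : c * (T `^ nu) `^ (m.+1%:R - alpha) * T `^ rp <=
    `|Kc| * C * energy_const s ^+ m.+1 * (T `^ nu) `^ (2 * s).
  rewrite -(ler_pM2l WM); apply: le_trans key _; rewrite le_eqVlt; apply/orP; left.
  by apply/eqP; move: (energy_const s ^+ _) (_ ^+ m) => x y; ring.
rewrite -!powRrM => key.
have : T `^ e <= B.
  rewrite /B ler_pdivlMr// mulrC.
  have Ts0 : 0 < T `^ (nu * (2 * s)) by exact: powR_gt0.
  rewrite -(ler_pM2r Ts0) -[leLHS]mulrA -powT_D//.
  have -> : e + nu * (2 * s) = nu * (m.+1%:R - alpha) + rp by rewrite /e; ring.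
  by rewrite powT_D// [leLHS]mulrA.
by move: hj4; lra.
Qed.

Lemma exponent_low_dimension m (nu rp alpha r s : R) : (0 < m)%N -> 0 < r ->
  2^-1 < nu -> nu <= 1 -> 0 <= rp -> rp <= r -> (1 + rp) / 2 < nu ->
  1 <= alpha -> alpha <= m%:R ->
  nu * (1 - alpha) + (1 + rp) / 2 * m.+2%:R - 3 / 2 <= 0 ->
  0 <= s -> fractal_maximal_estimate m.+1 alpha r s ->
  (m.+1%:R - alpha) / 2 + rp / (2 * nu) <= s.
Proof.
move=> m0 r0 nuh nu1 rp0 rpr nurp a1 am cond.
have an : alpha <= m.+1%:R by apply: le_trans am _; rewrite ler_nat.
pose C := dimension_const m (cell_ratio m) alpha (5 * step_factor m ^+ m.+2).
have C0 : 0 <= C.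
  apply: mulr_ge0; first by apply: mulr_ge0 => //; exact: exprn_ge0.
  apply: addr_ge0; first by apply: mulr_ge0 => //; exact: powR_ge0.
  apply: mulr_ge0 => //; apply: exprn_ge0; apply: (le_trans ler01).
  by case: (@step_factor_large R m).
apply: (@exponent_lower_bound m nu rp alpha r s C) => // T T1 L1 L2.
by have [] := ball_bound_scale_low m0 T1 (ltW nuh) rp0 L1 a1 an am cond.
Qed.

Lemma exponent_high_dimension m (nu rp alpha r s : R) : (0 < m)%N -> 0 < r ->
  2^-1 < nu -> nu <= 1 -> 0 <= rp -> rp <= r -> (1 + rp) / 2 < nu ->
  m%:R <= alpha -> alpha <= m.+1%:R ->
  nu * (1 - alpha) + (1 + rp) / 2 * m%:R - (m.+1%:R - alpha) / 2 <= 0 ->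
  - (nu * alpha) + (1 + rp) / 2 * m.+2%:R + (nu - 1) * (m.+1%:R - alpha) - 1 / 2 <= 0 ->
  0 <= s -> fractal_maximal_estimate m.+1 alpha r s ->
  (m.+1%:R - alpha) / 2 + rp / (2 * nu) <= s.
Proof.
move=> m0 r0 nuh nu1 rp0 rpr nurp am an cond1 cond2.
have a1 : 1 <= alpha by apply: le_trans am; rewrite ler1n.
pose C := dimension_const m (cell_ratio m) alpha
  (4 * 2 ^+ m * (step_factor m ^+ m + step_factor m ^+ m.+2) + step_factor m ^+ m.+2).
have A0 k : 0 <= step_factor m ^+ k :> R.
  apply: exprn_ge0; apply: (le_trans ler01).
  by case: (@step_factor_large R m).
have C0 : 0 <= C.
  apply: mulr_ge0; first by apply: mulr_ge0 => //; exact: exprn_ge0.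
  apply: addr_ge0; first by apply: mulr_ge0 => //; exact: powR_ge0.
  apply: addr_ge0 => //; apply: mulr_ge0; last exact: addr_ge0.
  by apply: mulr_ge0 => //; exact: exprn_ge0.
apply: (@exponent_lower_bound m nu rp alpha r s C) => // T T1 L1 L2.
by have [] := ball_bound_scale_high m0 T1 (ltW nuh) rp0 a1 an am cond1 cond2.
Qed.
End exponent.

Theorem theorem1p4 (R : realType) (n : nat) (r : R) :
  (2 <= n)%N -> 0 < r ->
  (forall alpha : R, n%:R - 1 <= alpha <= n%:R ->
    (((n%:R - alpha) / 2 +
      Num.min ((2 * alpha - n%:R) / (2 * (n%:R + 1)))
              (r * (2 * alpha - n%:R) / (r * (n%:R + 1) + 2 * alpha - n%:R)))%:E
     <= critical_exponent n alpha r)%E) /\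
  (forall alpha : R, n%:R / 2 < alpha <= n%:R - 1 ->
    (((n%:R - alpha) / 2 +
      Num.min ((2 * alpha - n%:R) / (2 * (n%:R + 1)))
              (r * alpha / (r * (n%:R + 1) + n%:R)))%:E
     <= critical_exponent n alpha r)%E).
Proof.
case: n => [|m]; first by [].
rewrite ltnS => m0 r0.
have m1 : 1 <= m%:R :> R by rewrite ler1n.
have nE : m.+1%:R = m%:R + 1 :> R by rewrite natr1.
have n2E : m.+2%:R = m%:R + 2 :> R by rewrite -natr1 nE; ring.
split=> alpha /andP[al au]; apply: le_ereal_inf_tmp => _ [s [s0 hs] <-]; rewrite lee_fin.
- have malpha : m%:R <= alpha by move: al; rewrite nE; lra.
  set g := 2 * alpha - m.+1%:R.
  have g0 : 0 <= g by rewrite /g nE; lra.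
  rewrite (_ : r * (m.+1%:R + 1) + 2 * alpha - m.+1%:R = r * (m.+1%:R + 1) + g); last by rewrite /g; ring.
  have n10 : 0 < m.+1%:R + 1 :> R by rewrite nE; lra.
  have [g1|g1] := leP g 0.
    (* here alpha = n / 2, which forces n = 2 *)
    have ge : g = 0 by lra.
    have mm : m%:R = 1 :> R by move: ge; rewrite /g nE; lra.
    have aa : alpha = 1 by move: ge; rewrite /g nE mm; lra.
    rewrite ge mulr0 !mul0r minxx.
    have := @exponent_high_dimension R m 1 0 alpha r s m0 r0; rewrite !mul0r; apply => //; try lra.
  have [p [p0 pr pg pmin]] : exists p, [/\ 0 < p, p <= r, p * (m.+1%:R + 1) <= g &
      Num.min (g / (2 * (m.+1%:R + 1))) (r * g / (r * (m.+1%:R + 1) + g)) <=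
      p * g / (p * (m.+1%:R + 1) + g)].
    have [h|h] := leP (r * (m.+1%:R + 1)) g.
      by exists r; rewrite r0 lexx h ge_min lexx orbT.
    exists (g / (m.+1%:R + 1)); rewrite divfK ?gt_eqF// lexx ge_min; split => //.
    + exact: divr_gt0.
    + by rewrite ler_pdivrMr// ltW.
    + apply/orP; left; rewrite le_eqVlt; apply/orP; left; apply/eqP.
      by field; rewrite !gt_eqF// addr_gt0.
  (* nu = 1/2 + u is the value for which the condition at scale N / T is an equality *)
  pose u := p * (m.+1%:R + 1) / (2 * g).
  have u0 : 0 < u by rewrite divr_gt0 ?mulr_gt0.
  have ue : u * (2 * g) = p * (m.+1%:R + 1) by rewrite divfK// gt_eqF// mulr_gt0.
  have u1 : u <= 2^-1.
    by rewrite ler_pdivrMr ?mulr_gt0// mulKf.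
  apply: le_trans (@exponent_high_dimension R m (2^-1 + u) p alpha r s m0 r0 _ _ _ pr _ malpha au _ _ s0 hs).
  + rewrite lerD2l; apply: le_trans pmin _; rewrite le_eqVlt; apply/orP; left; apply/eqP.
    have -> : 2 * (2^-1 + u) = (p * (m.+1%:R + 1) + g) / g.
      by rewrite /u; field; rewrite (gt_eqF g1).
    by rewrite invf_div mulrA.
  + by rewrite ltrDl.
  + by rewrite [leRHS](_ : 1 = 2^-1 + 2^-1); [rewrite lerD2l|field].
  + exact: ltW.
  + have gn : g < m.+1%:R + 1 by move: au; rewrite /g; lra.
    have : p * g < u * (2 * g) by rewrite ue ltr_pM2l.
    rewrite mulrA ltr_pM2r// => pu.
    have -> : (1 + p) / 2 = 2^-1 + p / 2 :> R by field.
    by rewrite ltrD2l ltr_pdivrMr// mulrC.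
  + have m20 : 0 < m%:R + 2 :> R by lra.
    rewrite -(pmulr_lle0 _ m20).
    have -> : ((2^-1 + u) * (1 - alpha) + (1 + p) / 2 * m%:R - (m.+1%:R - alpha) / 2) * (m%:R + 2) =
        - u * ((m%:R - 1) * (2 - (alpha - m%:R)) + (alpha - m%:R)) +
        m%:R / 2 * (p * (m.+1%:R + 1) - u * (2 * g)) by rewrite /g nE; field.
    rewrite ue subrr mulr0 addr0 mulNr oppr_le0 mulr_ge0 ?(ltW u0)// addr_ge0 ?subr_ge0//.
    by rewrite mulr_ge0 ?subr_ge0//; move: au; rewrite nE; lra.
  + have -> : - ((2^-1 + u) * alpha) + (1 + p) / 2 * m.+2%:R + (2^-1 + u - 1) * (m.+1%:R - alpha) - 1 / 2 =
      (p * (m.+1%:R + 1) - u * (2 * g)) / 2 by rewrite /g n2E nE; field.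
    by rewrite ue subrr mul0r.
- have am : alpha <= m%:R by move: au; rewrite nE; lra.
  have a1 : 1 <= alpha by move: al; rewrite nE; lra.
  have a0 : 0 < alpha by lra.
  set g := 2 * alpha - m.+1%:R.
  have g0 : 0 < g by move: al; rewrite /g; lra.
  have n10 : 0 < m.+1%:R + 1 :> R by rewrite nE; lra.
  have n0 : 0 < m.+1%:R :> R by rewrite nE; lra.
  have [p [p0 pr pg pmin]] : exists p, [/\ 0 < p, p <= r, p * (m.+1%:R + 1) <= g &
      Num.min (g / (2 * (m.+1%:R + 1))) (r * alpha / (r * (m.+1%:R + 1) + m.+1%:R)) <=
      p * alpha / (p * (m.+1%:R + 1) + m.+1%:R)].
    have [h|h] := leP (r * (m.+1%:R + 1)) g.
      by exists r; rewrite r0 lexx h ge_min lexx orbT.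
    exists (g / (m.+1%:R + 1)); rewrite divfK ?gt_eqF// lexx ge_min; split => //.
    + exact: divr_gt0.
    + by rewrite ler_pdivrMr// ltW.
    + apply/orP; left; rewrite le_eqVlt; apply/orP; left; apply/eqP.
      have -> : g + m.+1%:R = 2 * alpha by rewrite /g subrK.
      by field; rewrite !gt_eqF.
  (* with nu = v, the condition on the total mass reads v <= 1 *)
  pose v := (p * (m.+1%:R + 1) + m.+1%:R) / (2 * alpha).
  have ve : v * (2 * alpha) = p * (m.+1%:R + 1) + m.+1%:R by rewrite divfK// gt_eqF// mulr_gt0.
  have pn0 : 0 < p * (m.+1%:R + 1) by rewrite mulr_gt0.
  have v0 : 0 < v by rewrite divr_gt0 ?mulr_gt0 ?addr_gt0.
  have v1 : v <= 1 by rewrite ler_pdivrMr ?mulr_gt0// mul1r; move: pg; rewrite /g; lra.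
  apply: le_trans (@exponent_low_dimension R m v p alpha r s m0 r0 _ v1 (ltW p0) pr _ a1 am _ s0 hs).
  + rewrite lerD2l; apply: le_trans pmin _; rewrite le_eqVlt; apply/orP; left; apply/eqP.
    have -> : 2 * v = (p * (m.+1%:R + 1) + m.+1%:R) / alpha.
      by rewrite /v; field; rewrite (gt_eqF a0).
    by rewrite invf_div mulrA.
  + by rewrite ltr_pdivlMr ?mulr_gt0// mulKf//; move: am; rewrite nE; lra.
  + rewrite ltr_pdivlMr ?mulr_gt0// mulrA divfK//.
    rewrite mulrDl mul1r addrC; apply: ltr_leD; last by move: am; rewrite nE; lra.
    by rewrite ltr_pM2l//; move: am; rewrite nE; lra.
  + have -> : v * (1 - alpha) + (1 + p) / 2 * m.+2%:R - 3 / 2 =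
      v - 1 + (p * (m.+1%:R + 1) + m.+1%:R - v * (2 * alpha)) / 2 by rewrite n2E nE; field.
    by rewrite ve subrr mul0r addr0 subr_le0.
Qed.
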